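(* Let $T$ be a complex (connected) algebraic torus acting algebraically on $X=\mathbb{P}^1(\mathbb{C})$, and let $E$ be a $T$-equivariant algebraic vector bundle on $X$. Then there exist $T$-equivariant line subbundles $L_1,\dots,L_m\subset E$ such that the map $$L_1\oplus\cdots\oplus L_m\longrightarrow E,\qquad v_1\oplus\cdots\oplus v_m\longmapsto v_1+\cdots+v_m,$$ is an isomorphism of $T$-equivariant vector bundles over $X=\mathbb{P}^1(\mathbb{C})$ (in particular it commutes with the projections to $\mathbb{P}^1(\mathbb{C})$).
   Context: A complex (connected) torus is an algebraic group over $\mathbb{C}$ isomorphic to $(\mathbb{C}^* )^r$ for some $r\ge 0$. The action of $T$ on $X=\mathbb{P}^1(\mathbb{C})$ is an arbitrary algebraic action (possibly trivial). A $T$-equivariant algebraic vector bundle on $X$ is an algebraic vector bundle $p:E\to X$ of finite rank together with an algebraic action of $T$ on the total space $E$ such that $p$ is $T$-equivariant and each $t\in T$ maps the fiber $E_x$ linearly to the fiber $E_{tx}$ for every $x\in X$. A $T$-equivariant line subbundle of $E$ is an algebraic subbundle $L\subset E$ of rank $1$ (so each fiber $L_x$ is a line in $E_x$) that is stable under the action of $T$, with the induced $T$-equivariant structure. An isomorphism of $T$-equivariant vector bundles is an isomorphism of algebraic vector bundles over the identity of $X$ that commutes with the $T$-actions. *)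

(* Defs.v *)
From HB Require Import structures.
From mathcomp Require Import all_boot all_order all_algebra.
From mathcomp Require Import all_classical all_reals topology complex.
(* The notations of mpoly clash with those of topology. *)
From mathcomp Require mpoly.
Import (canonicals, coercions) mpoly.

Set Implicit Arguments.
Unset Strict Implicit.
Unset Printing Implicit Defensive.

Import GRing.Theory.
Local Open Scope classical_set_scope.
Local Open Scope ring_scope.

(******************************************************************************)
(* Algebraic varieties over k are treated as "spaces with functions": a       *)
(* (Zariski) topological space X together with a sheaf of k-valued functions  *)
(* such that the inverse of a nonvanishing section is a section and the       *)
(* nonvanishing locus of a section is open.  The sheaf is given by its        *)
(* stalks: regular_at f x says that the total function f agrees near x with   *)
(* a section defined near x.  The sections on an open U are the functions     *)
(* regular at every point of U, their values outside U being irrelevant.      *)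
(* Being a variety is not part of the structure: the spaces used below are    *)
(* affine and projective spaces, groups isomorphic to (k^* )^r, and total     *)
(* spaces of vector bundles, which are locally products U x k^n.              *)
(******************************************************************************)
HB.mixin Record isSpaceWithFunctions (k : fieldType) X & Topological X := {
  regular_at : (X -> k) -> X -> Prop;
  near_eq_regular_at : forall f g x,
    (\forall y \near x, f y = g y) -> regular_at f x -> regular_at g x;
  regular_at_near : forall f x,
    regular_at f x -> \forall y \near x, regular_at f y;
  regular_at_cst : forall c x, regular_at (fun=> c) x;
  regular_atD : forall f g x,
    regular_at f x -> regular_at g x -> regular_at (fun y => f y + g y) x;
  regular_atM : forall f g x,
    regular_at f x -> regular_at g x -> regular_at (fun y => f y * g y) x;
  regular_at_neq0 : forall f x,
    regular_at f x -> f x != 0 -> \forall y \near x, f y != 0;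
  regular_atV : forall f x,
    regular_at f x -> f x != 0 -> regular_at (fun y => (f y)^-1) x
}.

#[short(type="swfType")]
HB.structure Definition SpaceWithFunctions (k : fieldType) :=
  {X of isSpaceWithFunctions k X & Topological X}.

Arguments near_eq_regular_at {k s f g x}.
Arguments regular_at_near {k s f x}.
Arguments regular_atD {k s f g x}.
Arguments regular_atM {k s f g x}.
Arguments regular_at_neq0 {k s f x}.
Arguments regular_atV {k s f x}.

Section Morphisms.
Context {k : fieldType}.

(* A map is a morphism on an open set when it is one at each of its points. *)
Definition morphism_at (X Y : swfType k) (f : X -> Y) (x : X) : Prop :=
  {for x, continuous f} /\
  forall g : Y -> k, regular_at g (f x) -> regular_at (g \o f) x.

Definition morphism (X Y : swfType k) (f : X -> Y) : Prop :=
  forall x, morphism_at f x.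

Lemma morphism_at_id (X : swfType k) (x : X) : morphism_at (fun y => y) x.
Proof. by split=> //; exact: cvg_id. Qed.

Lemma morphism_at_comp (X Y Z : swfType k) (f : X -> Y) (g : Y -> Z) x :
  morphism_at f x -> morphism_at g (f x) -> morphism_at (fun y => g (f y)) x.
Proof.
move=> [cf rf] [cg rg]; split=> [|h /rg/rf //].
exact: (@continuous_comp _ _ _ f g).
Qed.

Lemma near_eq_morphism_at (X Y : swfType k) (f g : X -> Y) x :
  (\forall y \near x, f y = g y) -> morphism_at f x -> morphism_at g x.
Proof.
move=> fg [cf rf]; have fgx : f x = g x := nbhs_singleton fg.
split=> [A|h].
  rewrite -fgx => /cf; change (nbhs x (f @^-1` A) -> nbhs x (g @^-1` A)).
  by apply: filterS2 fg => y /= ->.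
rewrite -fgx => /rf; apply: near_eq_regular_at.
by apply: filterS fg => y /= ->.
Qed.

End Morphisms.

(******************************************************************************)
(* Affine space, with its Zariski topology.                                   *)
(******************************************************************************)
Definition polyval (k : fieldType) n (p : mpoly.mpoly n k) (v : 'rV[k]_n) : k :=
  mpoly.meval (fun i => v 0 i) p.

Definition affine (k : fieldType) (n : nat) : Type := 'rV[k]_n.

Section Affine.
Context (k : fieldType) (n : nat).

HB.instance Definition _ := Choice.copy (affine k n) 'rV[k]_n.

Definition affine_nbhs (v : affine k n) : set_system (affine k n) :=
  [set A | exists h : mpoly.mpoly n k,
     polyval h v != 0 /\ forall w, polyval h w != 0 -> A w].

HB.instance Definition _ := hasNbhs.Build (affine k n) affine_nbhs.

Let affine_singleton (v : affine k n) A : nbhs v A -> A v.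
Proof. by move=> [h [hv hA]]; exact: hA. Qed.

Let affine_filter (v : affine k n) : ProperFilter (nbhs v).
Proof.
apply: Build_ProperFilter_ex => [A /affine_singleton Av|]; first by exists v.
split.
- by exists 1; rewrite /polyval mpoly.meval1 oner_eq0.
- move=> A B [h [hv hA]] [g [gv gB]]; exists (h * g).
  rewrite /polyval mpoly.mevalM mulf_neq0//; split=> // w.
  by rewrite mpoly.mevalM mulf_eq0 negb_or => /andP[/hA ? /gB].
- by move=> A B AB [h [hv hA]]; exists h; split=> // w /hA/AB.
Qed.

Let affine_nbhs_nbhs (v : affine k n) A : nbhs v A -> nbhs v (nbhs^~ A).
Proof. by move=> [h [hv hA]]; exists h; split=> // w hw; exists h. Qed.

HB.instance Definition _ := Nbhs_isNbhsTopological.Build (affine k n)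
  affine_filter affine_singleton affine_nbhs_nbhs.

Definition affine_regular_at (f : affine k n -> k) (v : affine k n) : Prop :=
  exists a h : mpoly.mpoly n k, polyval h v != 0 /\
    \forall w \near v, f w = polyval a w / polyval h w.

Let affine_open (h : mpoly.mpoly n k) (v : affine k n) :
  polyval h v != 0 -> \forall w \near v, polyval h w != 0.
Proof. by move=> hv; exists h. Qed.

Let affine_near_eq f g (v : affine k n) : (\forall y \near v, f y = g y) ->
  affine_regular_at f v -> affine_regular_at g v.
Proof.
move=> fg [a [h [hv fE]]]; exists a, h; split=> //.
by near=> y; rewrite -(near fg y _)//; near: y.
Unshelve. all: by end_near. Qed.

Let affine_near f (v : affine k n) : affine_regular_at f v ->
  \forall y \near v, affine_regular_at f y.
Proof.
move=> [a [h [hv fE]]]; near=> y; exists a, h; split; first by near: y; exact: affine_open.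
by near: y; exact: (affine_nbhs_nbhs fE).
Unshelve. all: by end_near. Qed.

Let affine_cst c (v : affine k n) : affine_regular_at (fun=> c) v.
Proof.
exists (mpoly.mpolyC n c), 1; rewrite /polyval mpoly.meval1 oner_eq0; split=> //.
by near=> w; rewrite mpoly.mevalC mpoly.meval1 divr1.
Unshelve. all: by end_near. Qed.

Let affineD f g (v : affine k n) : affine_regular_at f v ->
  affine_regular_at g v -> affine_regular_at (fun y => f y + g y) v.
Proof.
move=> [a [h [hv fE]]] [b [j [jv gE]]]; exists (a * j + b * h), (h * j).
rewrite {1}/polyval mpoly.mevalM mulf_neq0//; split=> //; near=> w.
have hw : polyval h w != 0 by near: w; exact: affine_open.
have jw : polyval j w != 0 by near: w; exact: affine_open.
rewrite (near fE w)// (near gE w)// addf_div// /polyval mpoly.mevalD.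
by rewrite !mpoly.mevalM.
Unshelve. all: by end_near. Qed.

Let affineM f g (v : affine k n) : affine_regular_at f v ->
  affine_regular_at g v -> affine_regular_at (fun y => f y * g y) v.
Proof.
move=> [a [h [hv fE]]] [b [j [jv gE]]]; exists (a * b), (h * j).
rewrite {1}/polyval mpoly.mevalM mulf_neq0//; split=> //; near=> w.
by rewrite (near fE w)// (near gE w)// mulf_div /polyval !mpoly.mevalM.
Unshelve. all: by end_near. Qed.

Let affine_num f a h (v : affine k n) :
  (\forall w \near v, f w = polyval a w / polyval h w) ->
  f v != 0 -> polyval a v != 0.
Proof.
by move=> /nbhs_singleton ->; rewrite mulf_eq0 negb_or => /andP[].
Qed.

Let affine_neq0 f (v : affine k n) : affine_regular_at f v -> f v != 0 ->
  \forall y \near v, f y != 0.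
Proof.
move=> [a [h [hv fE]]] /(affine_num fE) av; near=> w; rewrite (near fE w)//.
by rewrite mulf_neq0// ?invr_eq0; near: w; exact: affine_open.
Unshelve. all: by end_near. Qed.

Let affineV f (v : affine k n) : affine_regular_at f v -> f v != 0 ->
  affine_regular_at (fun y => (f y)^-1) v.
Proof.
move=> [a [h [hv fE]]] /(affine_num fE) av; exists h, a; split=> //.
by near=> w; rewrite (near fE w)// invf_div.
Unshelve. all: by end_near. Qed.

HB.instance Definition _ := isSpaceWithFunctions.Build k (affine k n)
  affine_near_eq affine_near affine_cst affineD affineM affine_neq0 affineV.

End Affine.

(******************************************************************************)
(* Projective space: the lines of k^(n+1), with the topology generated by the *)
(* D_+(h), h homogeneous, and locally the quotients of homogeneous            *)
(* polynomials of the same degree as functions.                               *)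
(******************************************************************************)
Definition projective (k : fieldType) (n : nat) : Type :=
  {L : {vspace 'rV[k]_n.+1} | \dim L == 1%N}.

Section Projective.
Context (k : fieldType) (n : nat).

HB.instance Definition _ := Choice.copy (projective k n)
  {L : {vspace 'rV[k]_n.+1} | \dim L == 1%N}.

Definition homogeneous (d : nat) (p : mpoly.mpoly n.+1 k) : bool :=
  p \is mpoly.ishomog1 d mpoly.mdeg.

(* v is a vector of homogeneous coordinates of L *)
Definition coords (L : projective k n) (v : 'rV[k]_n.+1) : Prop :=
  v \in val L /\ v != 0.

Lemma coords_ex L : exists v, coords L v.
Proof.
exists (vpick (val L)); split; first exact: memv_pick.
by rewrite vpick0 -dimv_eq0 (eqP (valP L)).
Qed.

Definition nonvanishing (h : mpoly.mpoly n.+1 k) (L : projective k n) : Prop :=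
  forall v, coords L v -> polyval h v != 0.

Definition projective_nbhs (L : projective k n) : set_system (projective k n) :=
  [set A | exists d h, [/\ homogeneous d h, nonvanishing h L &
     forall M, nonvanishing h M -> A M]].

HB.instance Definition _ := hasNbhs.Build (projective k n) projective_nbhs.

Let nonvanishingM h j L :
  nonvanishing (h * j) L <-> nonvanishing h L /\ nonvanishing j L.
Proof.
split=> [hj|[hL jL] v Lv]; last first.
  by rewrite /polyval mpoly.mevalM mulf_neq0 ?hL ?jL.
by split=> v /hj; rewrite /polyval mpoly.mevalM mulf_eq0 negb_or => /andP[].
Qed.

Let nonvanishing1 L : nonvanishing 1 L.
Proof. by move=> v _; rewrite /polyval mpoly.meval1 oner_eq0. Qed.

Let proj_singleton (L : projective k n) A : nbhs L A -> A L.
Proof. by move=> [d [h [_ hL hA]]]; exact: hA. Qed.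

Let proj_filter (L : projective k n) : ProperFilter (nbhs L).
Proof.
apply: Build_ProperFilter_ex => [A /proj_singleton AL|]; first by exists L.
split.
- by exists 0%N, 1; split=> //; exact: mpoly.dhomog1.
- move=> A B [d [h [hd hL hA]]] [e [j [je jL jB]]]; exists (d + e)%N, (h * j).
  split; [exact: mpoly.dhomogM | exact/nonvanishingM |].
  by move=> M /nonvanishingM[/hA ? /jB].
- by move=> A B AB [d [h [hd hL hA]]]; exists d, h; split=> // M /hA/AB.
Qed.

Let proj_nbhs_nbhs (L : projective k n) A : nbhs L A -> nbhs L (nbhs^~ A).
Proof.
by move=> [d [h [hd hL hA]]]; exists d, h; split=> // M hM; exists d, h.
Qed.

HB.instance Definition _ := Nbhs_isNbhsTopological.Build (projective k n)
  proj_filter proj_singleton proj_nbhs_nbhs.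

Definition projective_regular_at (f : projective k n -> k) (L : projective k n)
    : Prop :=
  exists d a h, [/\ homogeneous d a, homogeneous d h, nonvanishing h L &
    \forall M \near L, forall v, coords M v -> f M = polyval a v / polyval h v].

Let proj_open d h (L : projective k n) : homogeneous d h -> nonvanishing h L ->
  \forall M \near L, nonvanishing h M.
Proof. by move=> hd hL; exists d, h. Qed.

Let proj_near_eq f g (L : projective k n) : (\forall y \near L, f y = g y) ->
  projective_regular_at f L -> projective_regular_at g L.
Proof.
move=> fg [d [a [h [ad hd hL fE]]]]; exists d, a, h; split=> //.
by near=> y; rewrite -(near fg y _)//; near: y.
Unshelve. all: by end_near. Qed.

Let proj_near f (L : projective k n) : projective_regular_at f L ->
  \forall y \near L, projective_regular_at f y.
Proof.
move=> [d [a [h [ad hd hL fE]]]]; near=> y; exists d, a, h; split=> //.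
  by near: y; exact: (proj_open hd).
by near: y; exact: (proj_nbhs_nbhs fE).
Unshelve. all: by end_near. Qed.

Let proj_cst c (L : projective k n) : projective_regular_at (fun=> c) L.
Proof.
exists 0%N, (c *: 1), 1; split.
- by apply: rpredZ; exact: mpoly.dhomog1.
- exact: mpoly.dhomog1.
- exact: nonvanishing1.
- by near=> M => v _; rewrite /polyval mpoly.mevalZ mpoly.meval1 mulr1 divr1.
Unshelve. all: by end_near. Qed.

Let projD f g (L : projective k n) : projective_regular_at f L ->
  projective_regular_at g L -> projective_regular_at (fun y => f y + g y) L.
Proof.
move=> [d [a [h [ad hd hL fE]]]] [e [b [j [be je jL gE]]]].
exists (d + e)%N, (a * j + b * h), (h * j); split.
- apply: rpredD; first exact: mpoly.dhomogM.
  by rewrite /= addnC; exact: mpoly.dhomogM.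
- exact: mpoly.dhomogM.
- exact/nonvanishingM.
near=> M => v Mv.
have hM : nonvanishing h M by near: M; exact: (proj_open hd).
have jM : nonvanishing j M by near: M; exact: (proj_open je).
rewrite (near fE M _ v)// (near gE M _ v)// addf_div ?hM ?jM//.
by rewrite /polyval mpoly.mevalD !mpoly.mevalM.
Unshelve. all: by end_near. Qed.

Let projM f g (L : projective k n) : projective_regular_at f L ->
  projective_regular_at g L -> projective_regular_at (fun y => f y * g y) L.
Proof.
move=> [d [a [h [ad hd hL fE]]]] [e [b [j [be je jL gE]]]].
exists (d + e)%N, (a * b), (h * j); split.
- exact: mpoly.dhomogM.
- exact: mpoly.dhomogM.
- exact/nonvanishingM.
near=> M => v Mv; rewrite (near fE M _ v)// (near gE M _ v)// mulf_div.
by rewrite /polyval !mpoly.mevalM.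
Unshelve. all: by end_near. Qed.

Let proj_num f a h (L : projective k n) :
  (\forall M \near L, forall v, coords M v -> f M = polyval a v / polyval h v) ->
  f L != 0 -> nonvanishing a L.
Proof.
move=> /nbhs_singleton fE fL v Lv; move: fL.
by rewrite (fE _ Lv) mulf_eq0 negb_or => /andP[].
Qed.

Let proj_neq0 f (L : projective k n) : projective_regular_at f L -> f L != 0 ->
  \forall y \near L, f y != 0.
Proof.
move=> [d [a [h [ad hd hL fE]]]] /(proj_num fE) aL; near=> M.
have [v Mv] := coords_ex M; rewrite (near fE M _ v)//.
have aM : nonvanishing a M by near: M; exact: (proj_open ad).
have hM : nonvanishing h M by near: M; exact: (proj_open hd).
by rewrite mulf_neq0 ?invr_eq0 ?aM ?hM.
Unshelve. all: by end_near. Qed.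

Let projV f (L : projective k n) : projective_regular_at f L -> f L != 0 ->
  projective_regular_at (fun y => (f y)^-1) L.
Proof.
move=> [d [a [h [ad hd hL fE]]]] /(proj_num fE) aL; exists d, h, a; split=> //.
by near=> M => v Mv; rewrite (near fE M _ v)// invf_div.
Unshelve. all: by end_near. Qed.

HB.instance Definition _ := isSpaceWithFunctions.Build k (projective k n)
  proj_near_eq proj_near proj_cst projD projM proj_neq0 projV.

End Projective.

(******************************************************************************)
(* The categorical product.  Near (x, y) the functions are the quotients a / h*)
(* with a and h in the image of O_x (x) O_y, and the nonvanishing loci of     *)
(* such h generate the topology, which is finer than the product topology.    *)
(******************************************************************************)
Definition zprod (k : fieldType) (X Y : swfType k) : Type := (X * Y)%type.

Section Product.
Context (k : fieldType) (X Y : swfType k).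
Local Notation XY := (zprod X Y).

HB.instance Definition _ := Choice.copy XY (X * Y)%type.

(* The algebra generated by the pullbacks of the functions regular at q.1 and *)
(* at q.2.                                                                    *)
Inductive tensor_at (q : XY) : (XY -> k) -> Prop :=
| tensor_fst f of regular_at f q.1 : tensor_at q (fun r => f r.1)
| tensor_snd g of regular_at g q.2 : tensor_at q (fun r => g r.2)
| tensorD a b of tensor_at q a & tensor_at q b : tensor_at q (fun r => a r + b r)
| tensorM a b of tensor_at q a & tensor_at q b : tensor_at q (fun r => a r * b r).

Definition zprod_nbhs (q : XY) : set_system XY :=
  [set A | exists U V h, [/\ nbhs q.1 U, nbhs q.2 V, tensor_at q h, h q != 0 &
     forall r : XY, U r.1 -> V r.2 -> h r != 0 -> A r]].

HB.instance Definition _ := hasNbhs.Build XY zprod_nbhs.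

Let zprod_singleton (q : XY) A : nbhs q A -> A q.
Proof.
by move=> [U [V [h [/nbhs_singleton ? /nbhs_singleton ? _ hq]]]]; exact.
Qed.

Let tensor1 q : tensor_at q (fun=> 1).
Proof. by apply: (@tensor_fst _ (fun=> 1)); exact: regular_at_cst. Qed.

Let zprod_filter (q : XY) : ProperFilter (nbhs q).
Proof.
apply: Build_ProperFilter_ex => [A /zprod_singleton Aq|]; first by exists q.
split.
- exists setT, setT, (fun=> 1).
  by split=> //; [exact: filterT | exact: filterT | rewrite oner_eq0].
- move=> A B [U [V [h [qU qV qh hq hA]]]] [U' [V' [j [qU' qV' qj jq jB]]]].
  exists (U `&` U'), (V `&` V'), (fun r => h r * j r).
  split; [exact: filterI | exact: filterI | exact: tensorM | exact: mulf_neq0 |].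
  move=> r [Ur U'r] [Vr V'r]; rewrite mulf_eq0 negb_or => /andP[hr jr].
  by split; [exact: hA | exact: jB].
- move=> A B AB [U [V [h [qU qV qh hq hA]]]]; exists U, V, h; split=> // r Ur Vr hr.
  exact/AB/hA.
Qed.

#[local] Existing Instance zprod_filter.

Let zprod_rect (q : XY) U V : nbhs q.1 U -> nbhs q.2 V ->
  \forall r \near q, U r.1 /\ V r.2.
Proof. by move=> qU qV; exists U, V, (fun=> 1); split=> //; rewrite oner_eq0. Qed.

Let tensor_open (q : XY) h : tensor_at q h -> h q != 0 ->
  \forall r \near q, h r != 0.
Proof.
by move=> qh hq; exists setT, setT, h; split=> //; exact: filterT.
Qed.

Let tensor_near (q : XY) h : tensor_at q h -> \forall r \near q, tensor_at r h.
Proof.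
elim=> [f fq|g gq|a b _ IHa _ IHb|a b _ IHa _ IHb].
- apply: filterS (zprod_rect (regular_at_near fq) filterT) => r [fr _].
  exact: tensor_fst.
- apply: filterS (zprod_rect filterT (regular_at_near gq)) => r [_ gr].
  exact: tensor_snd.
- by apply: filterS2 IHa IHb => r; exact: tensorD.
- by apply: filterS2 IHa IHb => r; exact: tensorM.
Qed.

Let zprod_nbhs_nbhs (q : XY) A : nbhs q A -> nbhs q (nbhs^~ A).
Proof.
move=> [U [V [h [qU qV qh hq hA]]]].
have qUV := zprod_rect (nbhs_interior qU) (nbhs_interior qV).
apply: filterS3 qUV (tensor_near qh) (tensor_open qh hq) => r [rU rV] rh r0.
by exists U, V, h; split.
Qed.

HB.instance Definition _ := Nbhs_isNbhsTopological.Build XY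
  zprod_filter zprod_singleton zprod_nbhs_nbhs.

Definition zprod_regular_at (f : XY -> k) (q : XY) : Prop :=
  exists a h, [/\ tensor_at q a, tensor_at q h, h q != 0 &
    \forall r \near q, f r = a r / h r].

Let zprod_near_eq f g (q : XY) : (\forall y \near q, f y = g y) ->
  zprod_regular_at f q -> zprod_regular_at g q.
Proof.
move=> fg [a [h [aq hq h0 fE]]]; exists a, h; split=> //.
by near=> y; rewrite -(near fg y _)//; near: y.
Unshelve. all: by end_near. Qed.

Let zprod_near f (q : XY) : zprod_regular_at f q ->
  \forall y \near q, zprod_regular_at f y.
Proof.
move=> [a [h [aq hq h0 fE]]]; near=> r; exists a, h; split.
- by near: r; exact: tensor_near.
- by near: r; exact: tensor_near.
- by near: r; exact: tensor_open.
- by near: r; exact: (zprod_nbhs_nbhs fE).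
Unshelve. all: by end_near. Qed.

Let zprod_cst c (q : XY) : zprod_regular_at (fun=> c) q.
Proof.
exists (fun=> c), (fun=> 1); split=> //; last 2 first.
- by rewrite oner_eq0.
- by near=> r; rewrite divr1.
by apply: (@tensor_fst _ (fun=> c)); exact: regular_at_cst.
Unshelve. all: by end_near. Qed.

Let zprodD f g (q : XY) : zprod_regular_at f q -> zprod_regular_at g q ->
  zprod_regular_at (fun y => f y + g y) q.
Proof.
move=> [a [h [aq hq h0 fE]]] [b [j [bq jq j0 gE]]].
exists (fun r => a r * j r + b r * h r), (fun r => h r * j r); split.
- by apply: tensorD; exact: tensorM.
- exact: tensorM.
- exact: mulf_neq0.
near=> r; rewrite (near fE r)// (near gE r)// addf_div//.
  by near: r; exact: tensor_open.
by near: r; exact: tensor_open.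
Unshelve. all: by end_near. Qed.

Let zprodM f g (q : XY) : zprod_regular_at f q -> zprod_regular_at g q ->
  zprod_regular_at (fun y => f y * g y) q.
Proof.
move=> [a [h [aq hq h0 fE]]] [b [j [bq jq j0 gE]]].
exists (fun r => a r * b r), (fun r => h r * j r); split.
- exact: tensorM.
- exact: tensorM.
- exact: mulf_neq0.
by apply: filterS2 fE gE => r -> ->; rewrite -mulf_div.
Qed.

Let zprod_num (f a h : XY -> k) (q : XY) : (\forall r \near q, f r = a r / h r) ->
  f q != 0 -> a q != 0.
Proof. by move=> /nbhs_singleton ->; rewrite mulf_eq0 negb_or => /andP[]. Qed.

Let zprod_neq0 f (q : XY) : zprod_regular_at f q -> f q != 0 ->
  \forall y \near q, f y != 0.
Proof.
move=> [a [h [aq hq h0 fE]]] /(zprod_num fE) a0; near=> r; rewrite (near fE r)//.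
by rewrite mulf_neq0// ?invr_eq0; near: r; exact: tensor_open.
Unshelve. all: by end_near. Qed.

Let zprodV f (q : XY) : zprod_regular_at f q -> f q != 0 ->
  zprod_regular_at (fun y => (f y)^-1) q.
Proof.
move=> [a [h [aq hq h0 fE]]] /(zprod_num fE) a0; exists h, a; split=> //.
by near=> r; rewrite (near fE r)// invf_div.
Unshelve. all: by end_near. Qed.

HB.instance Definition _ := isSpaceWithFunctions.Build k XY
  zprod_near_eq zprod_near zprod_cst zprodD zprodM zprod_neq0 zprodV.

Lemma morphism_at_fst (q : XY) : morphism_at (fun r : XY => r.1 : X) q.
Proof.
split=> [A qA|f fq]; first by apply: filterS (zprod_rect qA filterT) => r [].
exists (fun r => f r.1), (fun=> 1); split=> //; first exact: tensor_fst.
- by rewrite oner_eq0.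
- by near=> r; rewrite divr1.
Unshelve. all: by end_near. Qed.

Lemma morphism_at_snd (q : XY) : morphism_at (fun r : XY => r.2 : Y) q.
Proof.
split=> [A qA|f fq]; first by apply: filterS (zprod_rect filterT qA) => r [].
exists (fun r => f r.2), (fun=> 1); split=> //; first exact: tensor_snd.
- by rewrite oner_eq0.
- by near=> r; rewrite divr1.
Unshelve. all: by end_near. Qed.

Lemma morphism_at_pair (Z : swfType k) (f : Z -> X) (g : Z -> Y) z :
  morphism_at f z -> morphism_at g z ->
  morphism_at (fun w => (f w, g w) : XY) z.
Proof.
move=> [cf rf] [cg rg]; set fg : Z -> XY := fun w => _.
have tensor_fg h : tensor_at (fg z) h -> regular_at (h \o fg) z.
  elim=> [u /rf//|u /rg//|a b _ ra _ rb|a b _ ra _ rb].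
  - exact: (regular_atD ra rb).
  - exact: (regular_atM ra rb).
have cfg : {for z, continuous fg}.
  move=> A; change (zprod_nbhs (fg z) A -> nbhs z (fg @^-1` A)).
  move=> [U [V [h [zU zV zh hz hA]]]].
  have nh := regular_at_neq0 (tensor_fg _ zh) hz.
  have nU := cf _ zU; have nV := cg _ zV.
  by near=> w; apply: hA; near: w.
split=> // u [a [h [za zh hz uE]]].
apply: near_eq_regular_at (regular_atM (tensor_fg _ za)
  (regular_atV (tensor_fg _ zh) hz)).
have : \forall w \near z, u (fg w) = a (fg w) / h (fg w) := cfg _ uE.
by apply: filterS => w /= ->.
Unshelve. all: by end_near. Qed.

End Product.

(******************************************************************************)
(* The structure induced on Z by a map j : Z -> Y; for j injective, that of a *)
(* subspace of Y.                                                             *)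
(******************************************************************************)
Definition induced (Z : Type) (k : fieldType) (Y : swfType k) (j : Z -> Y)
  : Type := initial_topology j.

Section Induced.
Context (Z : choiceType) (k : fieldType) (Y : swfType k) (j : Z -> Y).
Local Notation I := (induced j).

HB.instance Definition _ := Topological.copy I (initial_topology j).

Lemma induced_nbhs (z : I) A :
  nbhs z A <-> exists B, nbhs (j z) B /\ forall w, B (j w) -> A w.
Proof.
split=> [|[B [zB BA]]].
  rewrite nbhsE => -[_ [[B oB <-] Bz] BA]; exists B; split=> //.
  exact: open_nbhs_nbhs.
have : nbhs z (j @^-1` B) by exact: (@initial_continuous _ _ j z B zB).
by apply: filterS => w /BA.
Qed.

Definition induced_regular_at (f : I -> k) (z : I) : Prop :=
  exists g : Y -> k, regular_at g (j z) /\ \forall w \near z, f w = g (j w).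

Let induced_open (z : I) B : nbhs (j z) B -> \forall w \near z, B (j w).
Proof. by move=> zB; apply/induced_nbhs; exists B. Qed.

Let induced_near_eq f g (z : I) : (\forall y \near z, f y = g y) ->
  induced_regular_at f z -> induced_regular_at g z.
Proof.
move=> fg [h [rh fE]]; exists h; split=> //.
by near=> y; rewrite -(near fg y _)//; near: y.
Unshelve. all: by end_near. Qed.

Let induced_near f (z : I) : induced_regular_at f z ->
  \forall y \near z, induced_regular_at f y.
Proof.
move=> [h [rh fE]]; near=> w; exists h; split.
  by near: w; exact: induced_open (regular_at_near rh).
by near: w; exact: nbhs_interior fE.
Unshelve. all: by end_near. Qed.

Let induced_cst c (z : I) : induced_regular_at (fun=> c) z.
Proof.
exists (fun=> c); split; first exact: regular_at_cst.
by near=> w.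
Unshelve. all: by end_near. Qed.

Let inducedD f g (z : I) : induced_regular_at f z ->
  induced_regular_at g z -> induced_regular_at (fun y => f y + g y) z.
Proof.
move=> [a [ra fE]] [b [rb gE]]; exists (fun y => a y + b y).
by split; [exact: regular_atD | apply: filterS2 fE gE => w -> ->].
Qed.

Let inducedM f g (z : I) : induced_regular_at f z ->
  induced_regular_at g z -> induced_regular_at (fun y => f y * g y) z.
Proof.
move=> [a [ra fE]] [b [rb gE]]; exists (fun y => a y * b y).
by split; [exact: regular_atM | apply: filterS2 fE gE => w -> ->].
Qed.

Let induced_neq0 f (z : I) : induced_regular_at f z -> f z != 0 ->
  \forall y \near z, f y != 0.
Proof.
move=> [a [ra fE]]; rewrite (nbhs_singleton fE) => a0.
by apply: filterS2 fE (induced_open (regular_at_neq0 ra a0)) => w ->.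
Qed.

Let inducedV f (z : I) : induced_regular_at f z -> f z != 0 ->
  induced_regular_at (fun y => (f y)^-1) z.
Proof.
move=> [a [ra fE]]; rewrite (nbhs_singleton fE) => a0.
exists (fun y => (a y)^-1); split; first exact: regular_atV.
by apply: filterS fE => w ->.
Qed.

HB.instance Definition _ := isSpaceWithFunctions.Build k I
  induced_near_eq induced_near induced_cst inducedD inducedM induced_neq0
  inducedV.

Lemma morphism_at_induced (z : I) : morphism_at (j : I -> Y) z.
Proof.
split=> [A|g gz]; first exact: induced_open.
by exists g; split=> //; near=> w.
Unshelve. all: by end_near. Qed.

Lemma morphism_at_to_induced (W : swfType k) (f : W -> I) w :
  morphism_at (fun y => j (f y)) w -> morphism_at f w.
Proof.
move=> [cf rf]; have cf' : {for w, continuous f}.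
  move=> A /induced_nbhs[B [wB BA]].
  have : nbhs w ((fun y => j (f y)) @^-1` B) := cf _ wB.
  by apply: filterS => y /BA.
split=> // g [h [/rf rh gE]]; apply: near_eq_regular_at rh.
have : \forall y \near w, g (f y) = h (j (f y)) := cf' _ gE.
by apply: filterS => y /= ->.
Qed.

End Induced.

Section AffineMorphisms.
Context (k : fieldType) (n : nat).

Lemma regular_at_coord (v : affine k n) (i : 'I_n) :
  regular_at (fun w : affine k n => w 0 i) v.
Proof.
exists (mpoly.mpolyX k (mpoly.mnm1 i)), 1.
rewrite /polyval mpoly.meval1 oner_eq0; split=> //; near=> w.
by rewrite mpoly.mevalXU mpoly.meval1 divr1.
Unshelve. all: by end_near. Qed.

Lemma morphism_at_to_affine (Z : swfType k) (f : Z -> affine k n) z :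
  (forall i, regular_at (fun w => f w 0 i) z) -> morphism_at f z.
Proof.
move=> rf; have rp p : regular_at (fun w => polyval p (f w)) z.
  have -> : (fun w => polyval p (f w)) =
    (fun w => \sum_(m <- mpoly.msupp p)
       mpoly.mcoeff m p * \prod_i (f w 0 i) ^+ (m i)).
    by apply/funext => w; rewrite /polyval mpoly.mevalE.
  elim: (mpoly.msupp p) => [|m s IHs].
    by under eq_fun do rewrite big_nil; exact: regular_at_cst.
  under eq_fun do rewrite big_cons; apply: regular_atD IHs.
  apply: regular_atM (regular_at_cst _ _) _.
  elim: (index_enum _) => [|i t IHt].
    by under eq_fun do rewrite big_nil; exact: regular_at_cst.
  under eq_fun do rewrite big_cons; apply: regular_atM IHt.
  elim: (m i) => [|d IHd].
    by under eq_fun do rewrite expr0; exact: regular_at_cst.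
  by under eq_fun do rewrite exprS; exact: regular_atM (rf i) IHd.
have cf : {for z, continuous f}.
  move=> A [h [hz hA]].
  have : \forall w \near z, polyval h (f w) != 0 := regular_at_neq0 (rp h) hz.
  by apply: filterS => w /hA.
split=> // g [a [h [hz gE]]].
apply: near_eq_regular_at (regular_atM (rp a) (regular_atV (rp h) hz)).
have : \forall w \near z, g (f w) = polyval a (f w) / polyval h (f w) := cf _ gE.
by apply: filterS => w /= ->.
Qed.

Lemma morphism_at_coord (Z : swfType k) (f : Z -> affine k n) z :
  morphism_at f z -> forall i, regular_at (fun w => f w 0 i) z.
Proof.
move=> [_ rf] i.
exact: (rf (fun w : affine k n => w 0 i) (regular_at_coord (f z) i)).
Qed.

End AffineMorphisms.

(******************************************************************************)
(* Algebraic groups, tori and algebraic actions.                              *)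
(******************************************************************************)
HB.mixin Record isAlgebraicGroup (k : fieldType) G
    & SpaceWithFunctions k G & Group G := {
  mulg_morphism :
    morphism (fun q : zprod (G : swfType k) (G : swfType k) => (q.1 * q.2)%g : G);
  invg_morphism : morphism (fun g : G => (g^-1)%g)
}.

#[short(type="algGroupType")]
HB.structure Definition AlgebraicGroup (k : fieldType) :=
  {G of isAlgebraicGroup k G & SpaceWithFunctions k G & Group G}.

(* chi and psi are mutually inverse isomorphisms of algebraic groups between  *)
(* T and (k^* )^r, the open subset of affine r-space where no coordinate      *)
(* vanishes, with coordinatewise multiplication.                              *)
Definition is_torus (k : fieldType) (T : algGroupType k) : Prop :=
  exists (r : nat) (chi : T -> affine k r) (psi : affine k r -> T),
    let Gm_r := [set v : affine k r | forall i, v 0 i != 0] in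
    [/\ forall t, Gm_r (chi t),
        cancel chi psi /\ forall v, Gm_r v -> chi (psi v) = v,
        forall s t i, chi (s * t)%g 0 i = chi s 0 i * chi t 0 i,
        morphism chi & forall v, Gm_r v -> morphism_at psi v].

Definition algebraic_action (k : fieldType) (T : algGroupType k) (X : swfType k)
    (a : T -> X -> X) : Prop :=
  [/\ forall x, a 1%g x = x,
      forall s t x, a (s * t)%g x = a s (a t x) &
      morphism (fun q : zprod (T : swfType k) X => a q.1 q.2)].

(******************************************************************************)
(* Vector bundles.  A family of vector spaces has as total space the disjoint *)
(* union of its fibers, with a structure of space with functions.             *)
(******************************************************************************)
Record vspaceFamily (k : fieldType) (X : swfType k) := VspaceFamily {
  fiber : X -> vectType k;
  total_class : SpaceWithFunctions.axioms_ k {x : X & fiber x}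
}.

Section Bundles.
Context {k : fieldType} {X : swfType k}.

Definition total (E : vspaceFamily X) : swfType k :=
  SpaceWithFunctions.Pack (total_class E).

Definition point (E : vspaceFamily X) (x : X) (v : fiber E x) : total E :=
  Tagged (fiber E) v.

Definition proj (E : vspaceFamily X) (e : total E) : X := tag e.

Definition vec (E : vspaceFamily X) (e : total E) : fiber E (proj e) := tagged e.

(* An isomorphism, linear on the fibers, between the restriction of E to U    *)
(* and U x k^n; phi x and psi x are only relevant for x in U.                 *)
Definition trivialization (E : vspaceFamily X) (U : set X) (n : nat)
    (phi : forall x, {linear fiber E x -> 'rV[k]_n})
    (psi : forall x, {linear 'rV[k]_n -> fiber E x}) : Prop :=
  [/\ forall x, U x -> cancel (phi x) (psi x) /\ cancel (psi x) (phi x),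
      forall e : total E, U (proj e) ->
        morphism_at
          (fun e' : total E => (proj e', phi (proj e') (vec e')) :
             zprod X (affine k n)) e
    & forall q : zprod X (affine k n), U q.1 ->
        morphism_at
          (fun q' : zprod X (affine k n) => point (psi q'.1 q'.2)) q].

Definition locally_trivial (E : vspaceFamily X) : Prop :=
  forall x, exists (U : set X) (n : nat)
    (phi : forall y, {linear fiber E y -> 'rV[k]_n})
    (psi : forall y, {linear 'rV[k]_n -> fiber E y}),
    open_nbhs x U /\ trivialization U phi psi.

End Bundles.

Record vectorBundle (k : fieldType) (X : swfType k) := VectorBundle {
  family :> vspaceFamily X;
  bundle_locally_trivial : locally_trivial family
}.

Section LinearFacts.
Context {k : fieldType}.

Definition mk_linear (U V : lmodType k) (f : U -> V) (fl : linear f) :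
    {linear U -> V} :=
  HB.pack f (GRing.isLinear.Build k U V *:%R f fl).

Lemma morphism_at_lsubmx m n (Z : swfType k) (f : Z -> affine k (m + n)) z :
  morphism_at f z -> morphism_at (fun w => lsubmx (f w) : affine k m) z.
Proof.
move=> rf; apply: morphism_at_to_affine => i.
under eq_fun do rewrite mxE; exact: morphism_at_coord.
Qed.

Lemma morphism_at_rsubmx m n (Z : swfType k) (f : Z -> affine k (m + n)) z :
  morphism_at f z -> morphism_at (fun w => rsubmx (f w) : affine k n) z.
Proof.
move=> rf; apply: morphism_at_to_affine => i.
under eq_fun do rewrite mxE; exact: morphism_at_coord.
Qed.

Lemma morphism_at_row_mx m n (Z : swfType k) (f : Z -> affine k m)
    (g : Z -> affine k n) z :
  morphism_at f z -> morphism_at g z ->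
  morphism_at (fun w => row_mx (f w) (g w) : affine k (m + n)) z.
Proof.
move=> rf rg; apply: morphism_at_to_affine => i.
under eq_fun do rewrite mxE; case: (fintype.split i) => j; exact: morphism_at_coord.
Qed.

Lemma morphism_at_cst_affine n (Z : swfType k) (v : affine k n) (z : Z) :
  morphism_at (fun=> v) z.
Proof. by apply: morphism_at_to_affine => i; exact: regular_at_cst. Qed.

Lemma row_mx0_linear m n : linear (fun w : 'rV[k]_m => row_mx w (0 : 'rV[k]_n)).
Proof. by move=> c u v; rewrite scale_row_mx add_row_mx scaler0 addr0. Qed.

End LinearFacts.

Section BundleConstructions.
Context {k : fieldType} {X : swfType k}.

Lemma trivialization_fst (E : vspaceFamily X) U n
    (phi : forall x, {linear fiber E x -> 'rV[k]_n})
    (psi : forall x, {linear 'rV[k]_n -> fiber E x}) e :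
  trivialization U phi psi -> U (proj e) ->
  morphism_at (@proj _ _ E) e /\
  morphism_at (fun e' => phi (proj e') (vec e') : affine k n) e.
Proof.
move=> [_ mphi _] /mphi me.
split; first exact: (morphism_at_comp me (morphism_at_fst _)).
exact: (morphism_at_comp me (morphism_at_snd _)).
Qed.

Lemma point_inj (E : vspaceFamily X) (x : X) (v w : fiber E x) :
  point v = point w -> v = w.
Proof.
move=> vw; have /eqP : Tagged (fiber E) v = Tagged (fiber E) w := vw.
by rewrite eq_Tagged => /eqP.
Qed.

(* Subbundles of rank d: locally the first d coordinates of a trivialization. *)
Definition is_subbundle (E : vectorBundle X) (d : nat)
    (L : forall x, {vspace fiber E x}) : Prop :=
  forall x, exists (U : set X) (m : nat)
    (phi : forall y, {linear fiber E y -> 'rV[k]_(d + m)})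
    (psi : forall y, {linear 'rV[k]_(d + m) -> fiber E y}),
    [/\ open_nbhs x U, trivialization U phi psi &
        forall y, U y -> forall v, v \in L y <-> rsubmx (phi y v) = 0].

Section Subbundle.
Context (E : vectorBundle X) (d : nat) (L : forall x, {vspace fiber E x}).

Definition sub_inj (e : {x : X & subvs_of (L x)}) : total E :=
  point (vsval (tagged e)).

Definition sub_family : vspaceFamily X :=
  @VspaceFamily k X (fun x => subvs_of (L x))
    (SpaceWithFunctions.class (induced sub_inj)).

Lemma sub_locally_trivial : is_subbundle d L -> locally_trivial sub_family.
Proof.
move=> hL x; have [U [m [phi [psi [oU triv inL]]]]] := hL x.
have [can mphi mpsi] := triv.
have phi'l y : linear (fun v : subvs_of (L y) => lsubmx (phi y (vsval v))).
  by move=> c u v; rewrite !linearP.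
have psi'l y : linear (fun w => vsproj (L y) (psi y (row_mx w 0))).
  by move=> c u v; rewrite row_mx0_linear !linearP.
exists U, d, (fun y => mk_linear (phi'l y)), (fun y => mk_linear (psi'l y)).
have psiL y w : U y -> psi y (row_mx w 0) \in L y.
  by move=> Uy; apply/(inL y Uy); rewrite (can y Uy).2 row_mxKr.
split=> //; split.
- move=> y Uy; split=> [v|w] /=.
    have := inL y Uy (vsval v); rewrite subvsP => -[/(_ isT) v0 _].
    by rewrite -v0 hsubmxK (can y Uy).1 vsvalK.
  by rewrite vsprojK ?psiL// (can y Uy).2 row_mxKl.
- move=> e Ue; have mi := @morphism_at_induced _ _ _ sub_inj e.
  have [m1 m2] := @trivialization_fst _ _ _ _ _ (sub_inj e) triv Ue.
  apply: morphism_at_pair; first exact: (morphism_at_comp mi m1).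
  by apply: morphism_at_lsubmx; exact: (morphism_at_comp mi m2).
- move=> q Uq; apply: morphism_at_to_induced.
  have mq : morphism_at (fun r : zprod X (affine k d) =>
      (r.1, row_mx r.2 0) : zprod X (affine k (d + m))) q.
    apply: morphism_at_pair; first exact: morphism_at_fst.
    apply: morphism_at_row_mx; first exact: morphism_at_snd.
    exact: morphism_at_cst_affine.
  have := morphism_at_comp mq (mpsi (q.1, row_mx q.2 0) Uq).
  apply: near_eq_morphism_at.
  have nU : nbhs q.1 U by exact: open_nbhs_nbhs (conj (oU.1) Uq).
  have : \forall r \near q, U r.1 := (morphism_at_fst q).1 _ nU.
  by apply: filterS => r Ur; rewrite /sub_inj /= vsprojK ?psiL.
Qed.

End Subbundle.

Definition sub_bundle (E : vectorBundle X) d (L : forall x, {vspace fiber E x})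
  (hL : is_subbundle d L) : vectorBundle X :=
  VectorBundle (sub_locally_trivial hL).

(* The total space of the zero bundle is X. *)
Definition zero_family : vspaceFamily X :=
  @VspaceFamily k X (fun=> 'rV[k]_0)
    (SpaceWithFunctions.class (induced (fun e : {x : X & 'rV[k]_0} => tag e))).

Lemma zero_locally_trivial : locally_trivial zero_family.
Proof.
move=> x; exists setT, 0%N, (fun=> idfun), (fun=> idfun).
split; first by split=> //; exact: openT.
split=> // [e _|q _].
  apply: morphism_at_pair; first exact: morphism_at_induced.
  by apply: morphism_at_to_affine => -[].
by apply: morphism_at_to_induced; exact: morphism_at_fst.
Qed.

Definition zero_bundle : vectorBundle X := VectorBundle zero_locally_trivial.

Section Sum.
Context (E F : vectorBundle X).

(* The total space of E (+) F is the fibered product of those of E and F. *)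
Definition sum_inj (e : {x : X & (fiber E x * fiber F x)%type}) :
    zprod (total E) (total F) :=
  (point (tagged e).1, point (tagged e).2).

Definition sum_family : vspaceFamily X :=
  @VspaceFamily k X (fun x => (fiber E x * fiber F x)%type)
    (SpaceWithFunctions.class (induced sum_inj)).

Lemma sum_locally_trivial : locally_trivial sum_family.
Proof.
move=> x.
have [U [m [phi [psi [[oU Ux] triv]]]]] := bundle_locally_trivial E x.
have [U' [m' [phi' [psi' [[oU' U'x] triv']]]]] := bundle_locally_trivial F x.
have [can _ mpsi] := triv; have [can' _ mpsi'] := triv'.
have phil y : linear (fun v : fiber E y * fiber F y =>
    row_mx (phi y v.1) (phi' y v.2)).
  by move=> c u v; rewrite scale_row_mx add_row_mx !linearP.
have psil y : linear (fun w => (psi y (lsubmx w), psi' y (rsubmx w))).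
  by move=> c u v; rewrite !linearP.
exists (U `&` U'), (m + m')%N.
exists (fun y => mk_linear (phil y)), (fun y => mk_linear (psil y)).
split; first by split=> //; exact: openI.
split.
- move=> y [Uy U'y]; split=> [[u v]|w] /=.
    by rewrite row_mxKl row_mxKr (can y Uy).1 (can' y U'y).1.
  by rewrite (can y Uy).2 (can' y U'y).2 hsubmxK.
- move=> e [Ue U'e]; have mi := @morphism_at_induced _ _ _ sum_inj e.
  have [m1 m2] := @trivialization_fst _ _ _ _ _ (sum_inj e).1 triv Ue.
  have [_ m2'] := @trivialization_fst _ _ _ _ _ (sum_inj e).2 triv' U'e.
  have mi1 := morphism_at_comp mi (morphism_at_fst _).
  have mi2 := morphism_at_comp mi (morphism_at_snd _).
  apply: morphism_at_pair; first exact: (morphism_at_comp mi1 m1).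
  apply: morphism_at_row_mx; first exact: (morphism_at_comp mi1 m2).
  exact: (morphism_at_comp mi2 m2').
- move=> q [Uq U'q]; apply: morphism_at_to_induced; apply: morphism_at_pair.
    have mq : morphism_at (fun r : zprod X (affine k (m + m')) =>
        (r.1, lsubmx r.2) : zprod X (affine k m)) q.
      apply: morphism_at_pair; first exact: morphism_at_fst.
      by apply: morphism_at_lsubmx; exact: morphism_at_snd.
    exact: (morphism_at_comp mq (mpsi (q.1, lsubmx q.2) Uq)).
  have mq : morphism_at (fun r : zprod X (affine k (m + m')) =>
      (r.1, rsubmx r.2) : zprod X (affine k m')) q.
    apply: morphism_at_pair; first exact: morphism_at_fst.
    by apply: morphism_at_rsubmx; exact: morphism_at_snd.
  exact: (morphism_at_comp mq (mpsi' (q.1, rsubmx q.2) U'q)).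
Qed.

Definition sum_bundle : vectorBundle X := VectorBundle sum_locally_trivial.

End Sum.

End BundleConstructions.

(******************************************************************************)
(* T-equivariant vector bundles.                                              *)
(******************************************************************************)
Record algAction (k : fieldType) (T : algGroupType k) (X : swfType k) :=
  AlgAction {
    action_fun :> T -> X -> X;
    action_algebraic : algebraic_action action_fun
  }.

(* The typing of act says that the projection to X is equivariant and that    *)
(* every t maps E_x linearly to E_(tx).                                       *)
Record eqvBundle (k : fieldType) (T : algGroupType k) (X : swfType k)
    (a : algAction T X) := EqvBundle {
  eqv_bundle :> vectorBundle X;
  act : forall (t : T) (x : X),
    {linear fiber eqv_bundle x -> fiber eqv_bundle (a t x)};
  act_algebraic : algebraic_action
    (fun t (e : total eqv_bundle) => point (act t (proj e) (vec e)))
}.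

Arguments act {k T X a} e t x.

Section Equivariant.
Context {k : fieldType} {T : algGroupType k} {X : swfType k} {a : algAction T X}.

Definition total_act (E : eqvBundle a) (t : T) (e : total E) : total E :=
  point (act E t (proj e) (vec e)).

Record eqvLineSubbundle (E : eqvBundle a) := EqvLineSubbundle {
  line :> forall x, {vspace fiber E x};
  line_subbundle : is_subbundle 1 line;
  line_stable : forall t x v, v \in line x -> act E t x v \in line (a t x)
}.

Definition total_map (E F : vspaceFamily X)
    (f : forall x, {linear fiber E x -> fiber F x}) (e : total E) : total F :=
  point (f (proj e) (vec e)).

(* A vector bundle map over the identity of X is given by its restrictions to *)
(* the fibers.                                                                *)
Definition bundle_iso (E F : vectorBundle X)
    (f : forall x, {linear fiber E x -> fiber F x}) : Prop :=
  exists g : forall x, {linear fiber F x -> fiber E x},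
    [/\ forall x, cancel (f x) (g x), forall x, cancel (g x) (f x),
        morphism (total_map f) & morphism (total_map g)].

Definition eqv_bundle_iso (E F : eqvBundle a)
    (f : forall x, {linear fiber E x -> fiber F x}) : Prop :=
  bundle_iso f /\
  forall t x v, f (a t x) (act E t x v) = act F t x (f x v).

(* The induced equivariant structure on an invariant line subbundle.          *)
Section EqvSub.
Context (E : eqvBundle a) (L : eqvLineSubbundle E).

Let S := sub_bundle (line_subbundle L).

Lemma eqv_sub_act_linear t x :
  linear (fun v : subvs_of (L x) => vsproj (L (a t x)) (act E t x (vsval v))).
Proof. by move=> c u v; rewrite !linearP. Qed.

Definition eqv_sub_act t x : {linear fiber S x -> fiber S (a t x)} :=
  mk_linear (@eqv_sub_act_linear t x).

Lemma sub_inj_injective : injective (@sub_inj k X E L).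
Proof.
move=> [x v] [y w] vw; have xy : x = y := congr1 (@proj _ _ _) vw.
by case: y / xy w vw => w /point_inj /= /val_inj ->.
Qed.

Lemma eqv_sub_algebraic : algebraic_action
  (fun t (e : total S) => point (eqv_sub_act t (proj e) (vec e))).
Proof.
have [a1 aM ma] := act_algebraic E.
have subE t (e : total S) :
    sub_inj (point (eqv_sub_act t (proj e) (vec e)) : total S) =
    total_act t (sub_inj e).
  by rewrite /sub_inj /= vsprojK//; apply: line_stable; exact: subvsP.
split=> [e|s t e|q]; try apply: sub_inj_injective.
- by rewrite subE; exact: a1.
- by rewrite !subE; exact: aM.
apply: morphism_at_to_induced; under eq_fun do rewrite subE.
have mq : morphism_at (fun r : zprod T (total S) =>
    (r.1, sub_inj r.2) : zprod T (total E)) q.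
  apply: morphism_at_pair; first exact: morphism_at_fst.
  by apply: (morphism_at_comp (morphism_at_snd _)); exact: morphism_at_induced.
exact: (morphism_at_comp mq (ma _)).
Qed.

Definition eqv_sub : eqvBundle a := EqvBundle eqv_sub_algebraic.

End EqvSub.

Section EqvZero.

Let Z : vectorBundle X := zero_bundle.

Definition eqv_zero_act (t : T) x : {linear fiber Z x -> fiber Z (a t x)} :=
  idfun.

Lemma eqv_zero_algebraic : algebraic_action
  (fun t (e : total Z) => point (eqv_zero_act t (proj e) (vec e))).
Proof.
have [a1 aM ma] := action_algebraic a.
have tag_inj (e e' : total Z) : proj e = proj e' -> e = e'.
  case: e e' => [x v] [y w] xy; have {}xy : x = y := xy.
  by case: y / xy w => w; rewrite [v]thinmx0 [w]thinmx0.
split=> [e|s t e|q]; try apply: tag_inj.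
- exact: a1.
- exact: aM.
apply: morphism_at_to_induced.
have mq : morphism_at (fun r : zprod T (total Z) =>
    (r.1, proj r.2) : zprod T X) q.
  apply: morphism_at_pair; first exact: morphism_at_fst.
  by apply: (morphism_at_comp (morphism_at_snd _)); exact: morphism_at_induced.
exact: (morphism_at_comp mq (ma _)).
Qed.

Definition eqv_zero : eqvBundle a := EqvBundle eqv_zero_algebraic.

End EqvZero.

Section EqvSum.
Context (E F : eqvBundle a).

Let S := sum_bundle E F.

Lemma eqv_sum_act_linear t x :
  linear (fun v : fiber E x * fiber F x => (act E t x v.1, act F t x v.2)).
Proof. by move=> c u v; rewrite !linearP. Qed.

Definition eqv_sum_act t x : {linear fiber S x -> fiber S (a t x)} :=
  mk_linear (@eqv_sum_act_linear t x).

Lemma sum_inj_injective : injective (@sum_inj k X E F).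
Proof.
move=> [x [u u']] [y [v v']] uv; have xy : x = y := congr1 (fun q => proj q.1) uv.
case: y / xy v v' uv => v v' uv.
have /point_inj -> : point u = point v := congr1 fst uv.
by have /point_inj -> : point u' = point v' := congr1 snd uv.
Qed.

Lemma eqv_sum_algebraic : algebraic_action
  (fun t (e : total S) => point (eqv_sum_act t (proj e) (vec e))).
Proof.
have [a1 aM ma] := act_algebraic E; have [b1 bM mb] := act_algebraic F.
pose i (e : total S) : zprod (total E) (total F) := sum_inj e.
have sumE t (e : total S) :
    sum_inj (point (eqv_sum_act t (proj e) (vec e)) : total S) =
    (total_act t (i e).1, total_act t (i e).2) by [].
split=> [e|s t e|q]; try apply: sum_inj_injective.
- rewrite sumE; congr pair; [exact: a1 | exact: b1].
- by rewrite !sumE; congr pair; [exact: aM | exact: bM].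
have mi : morphism_at (fun r : zprod T (total S) => i r.2) q.
  by apply: (morphism_at_comp (morphism_at_snd _)); exact: morphism_at_induced.
apply: morphism_at_to_induced; apply: morphism_at_pair.
  have mq : morphism_at (fun r : zprod T (total S) =>
      (r.1, (i r.2).1) : zprod T (total E)) q.
    apply: morphism_at_pair; first exact: morphism_at_fst.
    exact: (morphism_at_comp mi (morphism_at_fst _)).
  exact: (morphism_at_comp mq (ma _)).
have mq : morphism_at (fun r : zprod T (total S) =>
    (r.1, (i r.2).2) : zprod T (total F)) q.
  apply: morphism_at_pair; first exact: morphism_at_fst.
  exact: (morphism_at_comp mi (morphism_at_snd _)).
exact: (morphism_at_comp mq (mb _)).
Qed.

Definition eqv_sum : eqvBundle a := EqvBundle eqv_sum_algebraic.

End EqvSum.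

Section DirectSum.
Context (E : eqvBundle a).

(* L_1 (+) (L_2 (+) ... (L_m (+) 0)) *)
Fixpoint direct_sum (Ls : seq (eqvLineSubbundle E)) : eqvBundle a :=
  if Ls is L :: Ls' then eqv_sum (eqv_sub L) (direct_sum Ls') else eqv_zero.

Lemma sum_map0_linear x : linear (fun _ : fiber eqv_zero x => 0 : fiber E x).
Proof. by move=> c u v; rewrite scaler0 addr0. Qed.

Lemma sum_mapS_linear (L : eqvLineSubbundle E) (F : eqvBundle a) x
    (f : {linear fiber F x -> fiber E x}) :
  linear (fun v : fiber (eqv_sum (eqv_sub L) F) x => vsval v.1 + f v.2).
Proof. by move=> c u v; rewrite !linearP scalerDr addrACA. Qed.

(* (v_1, ..., v_m) |-> v_1 + ... + v_m on the fibers over x *)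
Fixpoint sum_map (Ls : seq (eqvLineSubbundle E)) (x : X) :
    {linear fiber (direct_sum Ls) x -> fiber E x} :=
  if Ls is L :: Ls' then mk_linear (@sum_mapS_linear L _ _ (sum_map Ls' x))
  else mk_linear (@sum_map0_linear x).

End DirectSum.

End Equivariant.

(* Main.v *)
Require Import Defs.
From mathcomp Require Import all_boot all_order all_algebra.
From mathcomp Require Import all_classical all_reals topology complex.
From HB Require Import structures.
From mathcomp Require Import perm cyclic separable cyclotomic.
From mathcomp Require Import ring zify.
From mathcomp Require mpoly.
Import (canonicals, coercions) mpoly.
Import Defs.

(* T has a fixed point on P^1: if t in T does not act trivially, its fixed points
   form a finite nonempty set permuted by T, and a divisible group acts trivially
   on a finite set.  Take this point as the point at infinity.  Let H_d be the
   space of sections of E over the affine line with a pole of order at most d at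
   infinity.  It is finite dimensional, it vanishes for d << 0, and its elements
   span each fiber of E as d varies; it is spanned by eigensections of the
   torsion subgroup of T, since the torsion points act through commuting
   operators of finite order.
   Choose eigensections e_1, e_2, ... greedily: d_j is the least d such that H_d
   is not generated by e_1, ..., e_(j-1) with homogeneous forms as coefficients,
   and e_j in H_(d_j) is an eigensection not so generated.  The values of the e_j
   are linearly independent at every point x: if the value of e_j at x were that
   of a combination of e_1, ..., e_(j-1) in H_(d_j), the difference would be the
   product of a linear form vanishing at x by a section in H_(d_j - 1), which is
   generated by e_1, ..., e_(j-1), and so would be e_j.  Hence the process stops,
   with a frame of E over P^1.  The lines spanned by the e_j are stable under the
   torsion points of T, which are dense, hence under T. *)

(** Torsion points stand in for characters. Splitting H_d into weight spaces would require T to act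
    on it algebraically; an operator of finite order is diagonalizable in characteristic zero with
    no regularity in t. The density of torsion is then used only once, through the closedness of
    subbundles. The fixed point makes pole orders meaningful for T: the action preserves the affine
    line, and the order of a pole at infinity. Still, O(d) is given no action of T: the value at
    infinity of an element of H_d is recorded in a frame of O(d) that T rescales. The action is
    therefore studied after multiplication by the linear form vanishing at infinity, which forgets
    this value; continuity restores it. The greedy choice is that of minimal homogeneous generators
    of the graded module of all H_d over the polynomial ring in two variables; that their values are
    independent everywhere is the freeness of this module, as in the Birkhoff-Grothendieck theorem.
    Finite dimension is used in the form of an injective evaluation into matrices whose size is
    controlled by d. *)

Set Implicit Arguments.
Unset Strict Implicit.
Unset Printing Implicit Defensive.

Import Order.TTheory GRing.Theory Num.Theory.
Local Open Scope classical_set_scope.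
Local Open Scope ring_scope.

(** * Charts of the projective line *)

(** One polynomial serves both as denominator and as equation of the locus where the formula fails.
    Through [is_P1] this is all that the sequel knows of the projective line, so that any point can
    be put at infinity. *)
Record open_chart (k : fieldType) (X : swfType k) (c : k -> X) : Prop := OpenChart {
  chart_inj : injective c;
  chart_nbhs : forall u P, nbhs (c u) P <->
    exists g : {poly k}, g.[u] != 0 /\ forall v, g.[v] != 0 -> P (c v);
  chart_regular : forall u f, regular_at f (c u) <->
    exists a h : {poly k}, h.[u] != 0 /\
      forall v, h.[v] != 0 -> f (c v) = a.[v] / h.[v] }.

(* A is the parametrization by the affine coordinate z and B the one by 1/z, so
   that B 0 is the point at infinity. *)
Record is_P1 (k : fieldType) (X : swfType k) (A B : k -> X) : Prop := IsP1 {
  P1_cover : forall x, (exists v, x = A v) \/ x = B 0;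
  P1_flip : forall v, v != 0 -> B v = A v^-1;
  P1_infty : forall v, A v <> B 0;
  P1_chartA : open_chart A;
  P1_chartB : open_chart B }.

Section ProjectiveLine.
Context (k : fieldType).
Implicit Types (e f w : 'rV[k]_2) (L M : projective k 1).

Lemma polyvalZ d (h : mpoly.mpoly 2 k) c v : homogeneous d h ->
  polyval h (c *: v) = c ^+ d * polyval h v.
Proof.
move=> /mpoly.dhomogP hd; rewrite /polyval !mpoly.mevalE big_distrr /=.
apply: eq_big_seq => m /hd /= <-; rewrite mulrCA; congr (_ * _).
rewrite mpoly.mdegE -prodrXr -big_split /=; apply: eq_bigr => i _.
by rewrite mxE exprMn.
Qed.

Definition det2 e f := e 0 0 * f 0 1 - e 0 1 * f 0 0.

Lemma det2C e f : det2 f e = - det2 e f.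
Proof. by rewrite /det2 opprB mulrC [f 0 1 * _]mulrC. Qed.

Lemma row2E (R : Type) (v w : 'rV[R]_2) : v 0 0 = w 0 0 -> v 0 1 = w 0 1 -> v = w.
Proof.
move=> v0 v1; apply/rowP => i; case: (unliftP 0 i) => [j ->|-> //].
by have -> : lift 0 j = 1 by apply/val_inj; case: j => -[].
Qed.

Lemma det2_comb e f w : det2 e f != 0 ->
  w = (det2 w f / det2 e f) *: e + (det2 e w / det2 e f) *: f.
Proof. by move=> ef; apply: row2E; rewrite !mxE; move: ef; rewrite /det2 => ef; field. Qed.

Lemma det2_neq0 e f (ef : det2 e f != 0) s t :
  s *: e + t *: f = 0 -> s = 0 /\ t = 0.
Proof.
move=> st; split; apply: (mulIf ef); rewrite mul0r.
  transitivity (det2 (s *: e + t *: f) f); first by rewrite /det2 !mxE; ring.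
  by rewrite st /det2 !mxE; ring.
transitivity (det2 e (s *: e + t *: f)); first by rewrite /det2 !mxE; ring.
by rewrite st /det2 !mxE; ring.
Qed.

Definition proj_line (v : 'rV[k]_2) (v0 : v != 0) : projective k 1 :=
  exist (fun L : {vspace 'rV[k]_2} => \dim L == 1%N) <[v]>%VS
    (introT eqP (etrans (dim_vline v) (congr1 nat_of_bool v0))).

Lemma coords_line (v : 'rV[k]_2) (v0 : v != 0) w :
  coords (proj_line v0) w <-> exists2 c, c != 0 & w = c *: v.
Proof.
rewrite /coords /=; split=> [[/vlineP[c ->]]|[c c0 ->]].
  by rewrite scaler_eq0 negb_or => /andP[c0 _]; exists c.
by rewrite memvZ ?memv_line// scaler_eq0 negb_or c0.
Qed.

Lemma proj_lineP L (v : 'rV[k]_2) (v0 : v != 0) : coords L v -> L = proj_line v0.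
Proof.
move=> [vL _]; apply/val_inj/eqP => /=; rewrite eq_sym eqEdim.
by rewrite -memvE vL dim_vline v0 (eqP (valP L)).
Qed.

Lemma proj_line_eq (v w : 'rV[k]_2) (v0 : v != 0) (w0 : w != 0) c : v = c *: w ->
  proj_line v0 = proj_line w0.
Proof.
move=> vw; apply/proj_lineP/coords_line; have c0 : c != 0.
  by apply: contraNneq v0 => c0; rewrite vw c0 scale0r.
by exists c^-1; rewrite ?invr_eq0// vw scalerA mulVf ?scale1r.
Qed.

Section Chart.
Context e f (ef : det2 e f != 0).

Lemma affine_vec_neq0 v : v *: e + f != 0.
Proof.
apply/eqP; rewrite -[f]scale1r => /(det2_neq0 ef)[_ /eqP].
by rewrite oner_eq0.
Qed.

(** The line of [e] is the missing point; exchanging [e] and [f] gives the chart around it, where it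
    has coordinate 0. *)
Definition affine_line (v : k) : projective k 1 := proj_line (affine_vec_neq0 v).

Lemma coords_affine_line v w :
  coords (affine_line v) w <-> exists2 c, c != 0 & w = c *: (v *: e + f).
Proof. exact: coords_line. Qed.

Lemma affine_line_inj : injective affine_line.
Proof.
move=> u v uv.
have : coords (affine_line u) (v *: e + f).
  by rewrite uv; apply/coords_affine_line; exists 1; rewrite ?oner_eq0 ?scale1r.
move=> /coords_affine_line[c _] /eqP; rewrite -subr_eq0 scalerDr scalerA => /eqP vf.
have : (v - c * u) *: e + (1 - c) *: f = 0.
  by rewrite -vf !scalerBl scale1r opprD addrACA.
by move=> /(det2_neq0 ef)[/eqP + /eqP]; rewrite !subr_eq0 => /eqP -> /eqP <-; rewrite mul1r.
Qed.

Lemma restrict_poly (h : mpoly.mpoly 2 k) :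
  exists p : {poly k}, forall v, p.[v] = polyval h (v *: e + f).
Proof.
exists (\sum_(m <- mpoly.msupp h) (mpoly.mcoeff m h)%:P *
  \prod_i ((e 0 i)%:P * 'X + (f 0 i)%:P) ^+ (m i)) => v.
rewrite /polyval mpoly.mevalE horner_sum; apply: eq_bigr => m _.
rewrite hornerM hornerC horner_prod; congr (_ * _); apply: eq_bigr => i _.
by rewrite horner_exp !hornerE !mxE mulrC.
Qed.

Lemma homogenize (p : {poly k}) d : (size p <= d.+1)%N ->
  exists h : mpoly.mpoly 2 k, [/\ homogeneous d h,
    forall v, polyval h (v *: e + f) = p.[v] & polyval h e = p`_d].
Proof.
move=> pd.
pose lin (a b : k) : mpoly.mpoly 2 k :=
  a *: mpoly.mpolyX k (mpoly.mnm1 0) + b *: mpoly.mpolyX k (mpoly.mnm1 1).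
have lin_homog a b : homogeneous 1 (lin a b).
  by apply: rpredD; apply: rpredZ; rewrite mpoly.dhomogX /= mpoly.mdeg1.
have lin_val a b v : polyval (lin a b) v = a * v 0 0 + b * v 0 1.
  by rewrite /polyval mpoly.mevalD !mpoly.mevalZ !mpoly.mevalXU.
(* [x] and [y] are the linear forms dual to the basis [e], [f]. *)
pose D := det2 e f; pose x := lin (f 0 1 / D) (- f 0 0 / D).
pose y := lin (- e 0 1 / D) (e 0 0 / D).
have xE s t : polyval x (s *: e + t *: f) = s.
  by rewrite lin_val !mxE; move: ef; rewrite /D /det2 => ?; field.
have yE s t : polyval y (s *: e + t *: f) = t.
  by rewrite lin_val !mxE; move: ef; rewrite /D /det2 => ?; field.
exists (\sum_(i < d.+1) p`_i *: (x ^+ i * y ^+ (d - i))).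
have hE s t : polyval (\sum_(i < d.+1) p`_i *: (x ^+ i * y ^+ (d - i)))
    (s *: e + t *: f) = \sum_(i < d.+1) p`_i * (s ^+ i * t ^+ (d - i)).
  rewrite /polyval raddf_sum /=; apply: eq_bigr => i _.
  by rewrite mpoly.mevalZ mpoly.mevalM !rmorphXn /= -!/(polyval _ _) xE yE.
split.
- apply: rpred_sum => i _; apply: rpredZ.
  have := mpoly.dhomogM (mpoly.dhomogMn i (lin_homog (f 0 1 / D) (- f 0 0 / D)))
    (mpoly.dhomogMn (d - i) (lin_homog (- e 0 1 / D) (e 0 0 / D))).
  by rewrite !mul1n subnKC// -ltnS.
- move=> v; rewrite -[f]scale1r hE (horner_coef_wide _ pd).
  by apply: eq_bigr => i _; rewrite expr1n mulr1.
- rewrite -[X in polyval _ X]addr0 -(scale0r f) -[in e + _](scale1r e) hE big_ord_recr /=.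
  rewrite big1 => [|i _]; first by rewrite add0r subnn expr1n expr0 !mulr1.
  by rewrite expr0n subn_eq0 leqNgt ltn_ord !mulr0.
Qed.

Lemma nonvanishing_affine_line d h v : homogeneous d h ->
  polyval h (v *: e + f) != 0 -> nonvanishing h (affine_line v).
Proof.
move=> hd hv w /coords_affine_line[c c0 ->].
by rewrite (polyvalZ _ _ hd) mulf_neq0// expf_neq0.
Qed.

Lemma nbhs_affine_line u P : nbhs (affine_line u) P <->
  exists g : {poly k}, g.[u] != 0 /\ forall v, g.[v] != 0 -> P (affine_line v).
Proof.
split=> [[d [h [hd hu hP]]]|[g [gu gP]]].
  have [g gE] := restrict_poly h; exists g; split=> [|v].
    rewrite gE; apply: hu; apply/coords_affine_line.
    by exists 1; rewrite ?oner_eq0 ?scale1r.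
  by rewrite gE => hv; exact/hP/(nonvanishing_affine_line hd).
(* The degree [size g] exceeds that of [g] by one, so the form vanishes at [e] and its nonvanishing
   locus lies inside the chart. *)
have [h [hd hE he]] := homogenize (leqnSn (size g)).
exists (size g), h; split=> //.
  by apply: (nonvanishing_affine_line hd); rewrite hE.
move=> M hM; have [w Mw] := coords_ex M.
have wE := det2_comb w ef; set s := _ / _ in wE; set t := _ / _ in wE.
have t0 : t != 0.
  apply: contra_neq (hM w Mw) => t0.
  by rewrite wE t0 scale0r addr0 (polyvalZ _ _ hd) he nth_default ?mulr0.
have wst : w = t *: ((s / t) *: e + f).
  by rewrite scalerDr scalerA mulrCA divff// mulr1.
have -> : M = affine_line (s / t).
  have -> : M = proj_line (proj2 Mw) by exact: proj_lineP.
  exact: (proj_line_eq _ _ wst).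
apply: gP; rewrite -hE; move: (hM w Mw); rewrite wst (polyvalZ _ _ hd).
by rewrite mulf_eq0 negb_or => /andP[].
Qed.

Lemma regular_affine_line u (F : projective k 1 -> k) :
  regular_at F (affine_line u) <->
  exists a h : {poly k}, h.[u] != 0 /\
    forall v, h.[v] != 0 -> F (affine_line v) = a.[v] / h.[v].
Proof.
have co v : coords (affine_line v) (v *: e + f).
  by apply/coords_affine_line; exists 1; rewrite ?oner_eq0 ?scale1r.
split=> [[d [a [h [ad hd hu FE]]]]|[a [h [hu FE]]]].
  have [p pE] := restrict_poly a; have [q qE] := restrict_poly h.
  move/nbhs_affine_line : FE => [g [gu gE]].
  (* The factor [g] restricts the denominator to the open set where the quotient of forms computes
     [F]. *)
  exists (p * g), (q * g); rewrite hornerM mulf_neq0// ?qE ?hu//; split=> // v.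
  rewrite hornerM mulf_eq0 negb_or => /andP[qv gv].
  by rewrite (gE v gv _ (co v)) -pE -qE hornerM -mulf_div divff// mulr1.
pose d := maxn (size a) (size h).
have [a' [ad aE _]] := homogenize (leqW (leq_maxl (size a) (size h))).
have [h' [hd hE _]] := homogenize (leqW (leq_maxr (size a) (size h))).
exists d, a', h'; split=> //.
  by apply: (nonvanishing_affine_line hd); rewrite hE.
apply/nbhs_affine_line; exists h; split=> // v hv w /coords_affine_line[c c0 ->].
rewrite (polyvalZ _ _ ad) (polyvalZ _ _ hd) aE hE FE// -mulf_div divff ?mul1r//.
by rewrite expf_neq0.
Qed.

Lemma open_chart_affine_line : open_chart affine_line.
Proof.
split; [exact: affine_line_inj | exact: nbhs_affine_line |].
exact: regular_affine_line.
Qed.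

End Chart.

Lemma projective_is_P1 e f (ef : det2 e f != 0) (fe : det2 f e != 0) :
  is_P1 (affine_line ef) (affine_line fe).
Proof.
split.
- move=> L; have [w Lw] := coords_ex L; have wE := det2_comb w ef.
  set s := _ / _ in wE; set t := _ / _ in wE.
  have -> : L = proj_line (proj2 Lw) by exact: proj_lineP.
  have [t0|t0] := eqVneq t 0; [right | left; exists (s / t)].
    by apply: (@proj_line_eq _ _ _ _ s); rewrite wE t0 !scale0r addr0 add0r.
  apply: (@proj_line_eq _ _ _ _ t).
  by rewrite {1}wE scalerDr scalerA mulrCA divff// mulr1.
- move=> v v0; apply: (@proj_line_eq _ _ _ _ v).
  by rewrite scalerDr scalerA divff// scale1r addrC.
- move=> v vB; have : coords (affine_line ef v) e.
    rewrite vB; apply/coords_affine_line.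
    by exists 1; rewrite ?oner_eq0// scale0r add0r scale1r.
  move=> /coords_affine_line[c c0] /eqP; rewrite -subr_eq0 scalerDr scalerA => /eqP vf.
  have : (1 - c * v) *: e + (- c) *: f = 0.
    by rewrite -vf scalerBl scale1r scaleNr opprD addrA.
  by move=> /(det2_neq0 ef)[_ /eqP]; rewrite oppr_eq0 (negbTE c0).
- exact: open_chart_affine_line.
- exact: open_chart_affine_line.
Qed.

Lemma projective_chart_at (x : projective k 1) :
  exists A B : k -> projective k 1, is_P1 A B /\ B 0 = x.
Proof.
have [e [ex e0]] := coords_ex x.
have [f ef] : exists f, det2 e f != 0.
  have [e00|e00] := eqVneq (e 0 0) 0; last first.
    exists (delta_mx 0 1); rewrite /det2 !mxE /= mulr0 subr0 mulr1 //.
  exists (delta_mx 0 0); rewrite /det2 !mxE /= e00 mul0r sub0r mulr1 oppr_eq0.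
  by apply: contraNneq e0 => e01; apply/eqP/row2E; rewrite !mxE.
have fe : det2 f e != 0 by rewrite det2C oppr_eq0.
exists (affine_line ef), (affine_line fe); split; first exact: projective_is_P1.
apply/esym/proj_lineP; split; last by rewrite scale0r add0r.
by rewrite scale0r add0r.
Qed.

End ProjectiveLine.

(** * Regular functions on the projective line *)

(** The change of coordinate from z to 1/z. The value at 0 is the leading coefficient when [d] is
    the degree, which detects the pole of [p] at infinity. *)
Lemma reverse_poly (k : fieldType) (p : {poly k}) d : (size p <= d.+1)%N ->
  exists q : {poly k}, q.[0] = p`_d /\
    forall v, v != 0 -> q.[v] = v ^+ d * p.[v^-1].
Proof.
move=> pd; exists (\poly_(i < d.+1) p`_(d - i)); split=> [|v v0].
  by rewrite horner_coef0 coef_poly subn0.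
rewrite horner_poly (horner_coef_wide _ pd) big_distrr (reindex_inj rev_ord_inj) /=.
apply: eq_bigr => i _; have id : (i <= d)%N by rewrite -ltnS.
rewrite subSS (subKn id) exprB ?unitfE// exprVn; ring.
Qed.

Section P1Symmetry.
Context (k : closedFieldType) (X : swfType k) (A B : k -> X).
Hypothesis hP : is_P1 A B.

Lemma P1_flop v : v != 0 -> A v = B v^-1.
Proof. by move=> v0; rewrite (P1_flip hP) ?invr_eq0// invrK. Qed.

Lemma is_P1_sym : is_P1 B A.
Proof.
split; [|exact: P1_flop| |exact: P1_chartB hP|exact: P1_chartA hP].
- move=> x; have [[v ->]|->] := P1_cover hP x; last by left; exists 0.
  have [->|v0] := eqVneq v 0; first by right.
  by left; exists v^-1; rewrite P1_flop.
- move=> v; have [->|v0] := eqVneq v 0; first by move/esym/(P1_infty hP).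
  by rewrite (P1_flip hP)// => /(chart_inj (P1_chartA hP))/eqP; rewrite invr_eq0 (negbTE v0).
Qed.

(** Cofiniteness in the affine line. Over an algebraically closed field such sets are nonempty and
    any two of them meet, which is the irreducibility of the line. *)
Definition generically (P : X -> Prop) : Prop :=
  exists g : {poly k}, g != 0 /\ forall v, g.[v] != 0 -> P (A v).

Lemma polyF_neq0 (p : {poly k}) : p != 0 -> exists v, p.[v] != 0.
Proof. by move/closed_nonrootP. Qed.

Lemma poly_eq_generic (g p q : {poly k}) : g != 0 ->
  (forall v, g.[v] != 0 -> p.[v] = q.[v]) -> p = q.
Proof.
move=> g0 pq; apply/eqP; rewrite -subr_eq0; apply: contraT => pq0.
have [v] := polyF_neq0 (mulf_neq0 g0 pq0).
rewrite hornerM mulf_eq0 negb_or => /andP[/pq pqv].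
by rewrite hornerD hornerN pqv subrr eqxx.
Qed.

Lemma generically_ex P : generically P -> exists v, P (A v).
Proof. by move=> [g [/polyF_neq0[v gv] gP]]; exists v; exact: gP. Qed.

Lemma genericallyS P Q : (forall x, P x -> Q x) -> generically P -> generically Q.
Proof. by move=> PQ [g [g0 gP]]; exists g; split=> // v /gP/PQ. Qed.

Lemma generically2 P Q S : (forall x, P x -> Q x -> S x) ->
  generically P -> generically Q -> generically S.
Proof.
move=> PQS [g [g0 gP]] [h [h0 hQ]]; exists (g * h); split; first exact: mulf_neq0.
by move=> v; rewrite hornerM mulf_eq0 negb_or => /andP[/gP ? /hQ]; exact: PQS.
Qed.

Lemma generically_neqA u : generically (fun x => x <> A u).
Proof.
exists ('X - u%:P); split=> [|v]; first by rewrite polyXsubC_eq0.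
rewrite !hornerE subr_eq0 => /eqP vu /(chart_inj (P1_chartA hP)); exact: vu.
Qed.

Lemma generically_finite : generically (fun x => x <> B 0).
Proof. by exists 1; rewrite oner_eq0; split=> // v _; exact: (P1_infty hP). Qed.

Lemma horner_neq0 (g : {poly k}) u : g.[u] != 0 -> g != 0.
Proof. by apply: contraNneq => ->; rewrite horner0. Qed.

End P1Symmetry.

Section P1Generic.
Context (k : closedFieldType) (X : swfType k).

Lemma generically_flip (A B : k -> X) P :
  is_P1 A B -> generically A P -> generically B P.
Proof.
move=> hP [g [g0 gP]]; have [h [h0 hE]] := reverse_poly (leqSpred (size g)).
have hn : h != 0 by apply: (@horner_neq0 _ _ 0); rewrite h0 -lead_coefE lead_coef_eq0.
exists (h * 'X); split=> [|v]; first by rewrite mulf_neq0 ?polyX_eq0.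
rewrite !hornerE mulf_eq0 negb_or => /andP[hv v0].
rewrite (P1_flip hP)//; apply: gP; move: hv; rewrite hE//.
by rewrite mulf_eq0 negb_or => /andP[].
Qed.

Lemma nbhs_generic (A B : k -> X) (hP : is_P1 A B) (x : X) P : nbhs x P -> generically A P.
Proof.
have nC (C : k -> X) (hC : open_chart C) u : nbhs (C u) P -> generically C P.
  by move/(chart_nbhs hC) => [g [gu gP]]; exists g; split=> //; exact: horner_neq0 gu.
have [[v ->]|->] := P1_cover hP x; first exact/nC/(P1_chartA hP).
move/(nC _ (P1_chartB hP)); exact: generically_flip (is_P1_sym hP).
Qed.

(** Dimension one: a cofinite set becomes a neighborhood of any point once this point is added,
    because the factor vanishing there can be divided out of the equation. *)
Lemma generic_near (A B : k -> X) (hP : is_P1 A B) (x : X) P : generically A P ->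
  \forall y \near x, y = x \/ P y.
Proof.
have gC (C : k -> X) (hC : open_chart C) u : generically C P ->
    \forall y \near C u, y = C u \/ P y.
  move=> [g [g0 gP]]; apply/(chart_nbhs hC).
  have [m [q]] := multiplicity_XsubC g u; rewrite g0 /= => qu gE.
  exists q; split=> // v qv; have [->|vu] := eqVneq v u; [by left|right].
  by apply: gP; rewrite gE hornerM mulf_neq0// horner_exp expf_neq0// !hornerE subr_eq0.
have [[v ->]|->] := P1_cover hP x; first exact/gC/(P1_chartA hP).
by move/(generically_flip hP); exact/gC/(P1_chartB hP).
Qed.

Definition ratfun (A : k -> X) (f : X -> k) := exists a h : {poly k},
  h != 0 /\ forall v, h.[v] != 0 -> f (A v) = a.[v] / h.[v].

Lemma ratfun_flip (A B : k -> X) f : is_P1 A B -> ratfun A f -> ratfun B f.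
Proof.
move=> hP [a [h [h0 fE]]]; pose d := maxn (size a) (size h).
have [a' [_ aE]] := reverse_poly (leqW (leq_maxl (size a) (size h))).
have [h' [_ hE]] := reverse_poly (leqW (leq_maxr (size a) (size h))).
have h'0 : h' != 0.
  have [v] := polyF_neq0 (mulf_neq0 h0 (negbT (polyX_eq0 k))).
  rewrite !hornerE mulf_eq0 negb_or => /andP[hv v0].
  apply: (@horner_neq0 _ _ v^-1); rewrite hE ?invr_eq0// invrK.
  by rewrite mulf_neq0// expf_neq0// invr_eq0.
exists (a' * 'X), (h' * 'X); split=> [|v]; first by rewrite mulf_neq0 ?polyX_eq0.
rewrite !hornerE mulf_eq0 negb_or => /andP[hv v0].
rewrite -mulf_div divff// mulr1 (P1_flip hP)// aE// hE// -mulf_div divff ?expf_neq0//.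
rewrite mul1r fE//; move: hv; rewrite hE//.
by rewrite mulf_eq0 negb_or => /andP[].
Qed.

Lemma regular_ratfun (A B : k -> X) (hP : is_P1 A B) f (x : X) :
  regular_at f x -> ratfun A f.
Proof.
have nC (C : k -> X) (hC : open_chart C) u : regular_at f (C u) -> ratfun C f.
  move/(chart_regular hC) => [a [h [hu fE]]]; exists a, h; split=> //.
  exact: horner_neq0 hu.
have [[v ->]|->] := P1_cover hP x; first exact/nC/(P1_chartA hP).
move/(nC _ (P1_chartB hP)); exact: ratfun_flip (is_P1_sym hP).
Qed.

(** If the difference were nonzero at [x], it would be nonzero near [x], hence generically. *)
Lemma removable (A B : k -> X) (hP : is_P1 A B) f g (x : X) :
  regular_at f x -> regular_at g x -> generically A (fun y => f y = g y) -> f x = g x.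
Proof.
move=> fx gx fg; apply/eqP; rewrite -subr_eq0; apply: contraT => fg0.
have rfg := regular_atD fx (regular_atM (regular_at_cst (-1) x) gx).
have := regular_at_neq0 rfg; rewrite mulN1r => /(_ fg0) /(nbhs_generic hP) nfg.
have : generically A (fun=> False).
  by apply: generically2 fg nfg => y ->; rewrite mulN1r subrr eqxx.
by move/generically_ex => -[].
Qed.

End P1Generic.

(** * Affine coordinate, uniformizers, poles and zeros of functions *)

Section P1Coordinates.
Context (k : closedFieldType) (X : swfType k) (A B : k -> X).
Hypothesis hP : is_P1 A B.
Local Notation oo := (B 0).
Local Notation gen := (generically A).

(** The default value 0 at infinity, together with 0^-1 = 0, makes [(zcoord x)^-1] the coordinate
    1/z of the second chart at all its points, infinity included. *)
Definition zcoord (x : X) : k := xget 0 [set v | A v = x].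

Lemma zcoordA v : zcoord (A v) = v.
Proof.
by apply: (chart_inj (P1_chartA hP)); rewrite /zcoord; case: xgetP => [w _ //|/(_ v)/(_ erefl)].
Qed.

Lemma zcoord_oo : zcoord oo = 0.
Proof. by rewrite /zcoord; case: xgetP => // v _ /(P1_infty hP). Qed.

Lemma zcoordB v : (zcoord (B v))^-1 = v.
Proof.
have [->|v0] := eqVneq v 0; first by rewrite zcoord_oo invr0.
by rewrite (P1_flip hP)// zcoordA invrK.
Qed.

Lemma zcoordK x : x <> oo -> A (zcoord x) = x.
Proof. by have [[v ->] _|->] := P1_cover hP x; rewrite ?zcoordA. Qed.

Lemma chart_coord (C : k -> X) (w : X -> k) u : open_chart C -> cancel C w ->
  regular_at w (C u).
Proof.
move=> hC wC; apply/(chart_regular hC); exists 'X, 1; rewrite hornerC oner_eq0.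
by split=> // v _; rewrite wC hornerX hornerC divr1.
Qed.

Lemma regular_zcoord u : regular_at zcoord (A u).
Proof. by apply: chart_coord; [exact: P1_chartA hP|exact: zcoordA]. Qed.

Lemma regular_wcoord u : regular_at (fun x => (zcoord x)^-1) (B u).
Proof.
by apply: chart_coord (P1_chartB hP) _; exact: zcoordB.
Qed.

Lemma near_oo : \forall y \near oo, y = oo \/ (zcoord y != 0 /\ y <> oo).
Proof.
apply: (generic_near hP); exists 'X; rewrite polyX_eq0; split=> // v.
by rewrite hornerX zcoordA => v0; split=> //; exact: (P1_infty hP).
Qed.

Lemma near_A u : \forall y \near A u, y <> oo.
Proof.
apply/(chart_nbhs (P1_chartA hP)); exists 1.
by rewrite hornerC oner_eq0; split=> // v _; exact: (P1_infty hP).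
Qed.

Definition uniformizer (x y : X) : k :=
  if x == oo then (zcoord y)^-1 else zcoord y - zcoord x.

Lemma uniformizerA u v : uniformizer (A u) (A v) = v - u.
Proof. by rewrite /uniformizer !zcoordA; case: eqP => // /(P1_infty hP). Qed.

Lemma regular_uniformizer x : regular_at (uniformizer x) x.
Proof.
have [[u ->]|->] := P1_cover hP x; last first.
  by rewrite /uniformizer eqxx; exact: regular_wcoord.
rewrite /uniformizer; case: eqP => [/(P1_infty hP)//|_].
exact: regular_atD (regular_zcoord u) (regular_at_cst _ _).
Qed.

Lemma uniformizer0 x : uniformizer x x = 0.
Proof.
by rewrite /uniformizer; case: eqP => [->|_]; rewrite ?zcoord_oo ?invr0 ?subrr.
Qed.

Lemma generic_uniformizer x : gen (fun y => uniformizer x y != 0).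
Proof.
have [[u ->]|->] := P1_cover hP x; last first.
  exists 'X; rewrite polyX_eq0 /uniformizer eqxx; split=> // v.
  by rewrite hornerX zcoordA invr_eq0.
exists ('X - u%:P); rewrite polyXsubC_eq0; split=> // v.
by rewrite !hornerE uniformizerA.
Qed.

Lemma regular_atX (Y : swfType k) (f : Y -> k) x n :
  regular_at f x -> regular_at (fun y => f y ^+ n) x.
Proof.
move=> fx; elim: n => [|n IHn].
  by under eq_fun do rewrite expr0; exact: regular_at_cst.
by under eq_fun do rewrite exprS; exact: regular_atM.
Qed.

Lemma clear_pole x f : ratfun A f ->
  exists M g, regular_at g x /\ gen (fun y => g y = uniformizer x y ^+ M * f y).
Proof.
have main (C : k -> X) (hC : open_chart C) w u (wC : forall v, w (C v) = v - u) :
    ratfun C f -> exists M g, regular_at g (C u) /\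
    generically C (fun y => g y = w y ^+ M * f y).
  move=> [a [h [h0 fE]]].
  have [m [q]] := multiplicity_XsubC h u; rewrite h0 /= => qu hE.
  have rq : regular_at (fun y => q.[w y + u]) (C u).
    apply/(chart_regular hC); exists q, 1; rewrite hornerC oner_eq0; split=> // v _.
    by rewrite wC subrK hornerC divr1.
  have ra : regular_at (fun y => a.[w y + u]) (C u).
    apply/(chart_regular hC); exists a, 1; rewrite hornerC oner_eq0; split=> // v _.
    by rewrite wC subrK hornerC divr1.
  exists m, (fun y => a.[w y + u] / q.[w y + u]); split.
    by apply: regular_atM ra (regular_atV rq _); rewrite wC subrr add0r.
  exists h; split=> // v hv; rewrite fE// wC subrK.
  move: hv; rewrite hE hornerM horner_exp !hornerXsubC; move: ((v - u) ^+ m) => t.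
  by rewrite mulf_eq0 negb_or => /andP[qv t0]; field; exact/andP.
move=> fr; have [[u ->]|->] := P1_cover hP x.
  exact: (main _ (P1_chartA hP) (uniformizer (A u)) u (uniformizerA u) fr).
have [||M [g [gr gE]]] := main _ (P1_chartB hP) (uniformizer oo) 0.
- by move=> v; rewrite /uniformizer eqxx zcoordB subr0.
- exact: ratfun_flip hP fr.
by exists M, g; split=> //; exact: (generically_flip (is_P1_sym hP) gE).
Qed.

Lemma divide_uniformizer x f : regular_at f x -> f x = 0 ->
  exists g, regular_at g x /\ gen (fun y => f y = uniformizer x y * g y).
Proof.
have main (C : k -> X) (hC : open_chart C) w u (wC : forall v, w (C v) = v - u) :
    regular_at f (C u) -> f (C u) = 0 -> exists g, regular_at g (C u) /\
    generically C (fun y => f y = w y * g y).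
  move=> /(chart_regular hC)[a [h [hu fE]]]; rewrite fE// => /eqP.
  rewrite mulf_eq0 invr_eq0 (negbTE hu) orbF => /factor_theorem[q aE].
  exists (fun y => q.[w y + u] / h.[w y + u]); split.
    apply/(chart_regular hC); exists q, h; split=> // v _.
    by rewrite wC subrK.
  exists h; split=> [|v hv]; first exact: horner_neq0 hu.
  by rewrite fE// aE wC subrK hornerM hornerXsubC mulrAC mulrC.
move=> fx f0; have [[u xE]|xE] := P1_cover hP x; subst x.
  exact: (main _ (P1_chartA hP) (uniformizer (A u)) u (uniformizerA u) fx f0).
have [v|g [gr gE]] := main _ (P1_chartB hP) (uniformizer oo) 0 _ fx f0.
  by rewrite /uniformizer eqxx zcoordB subr0.
by exists g; split=> //; exact: (generically_flip (is_P1_sym hP) gE).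
Qed.

End P1Coordinates.

(** * Sections and twists *)

Section Sections.
Context (k : fieldType) (X : Type) (V : X -> lmodType k).

Definition dsect : Type := forall x, V x.

HB.instance Definition _ := gen_eqMixin dsect.
HB.instance Definition _ := gen_choiceMixin dsect.

Implicit Types s t r : dsect.

Lemma dsectP s t : (forall x, s x = t x) -> s = t.
Proof. exact: functional_extensionality_dep. Qed.

Let dadd s t : dsect := fun x => s x + t x.
Let dzero : dsect := fun x => 0.
Let dopp s : dsect := fun x => - s x.
Let dscale (c : k) s : dsect := fun x => c *: s x.

Let daddA : associative dadd. Proof. by move=> s t r; apply: dsectP => x; exact: addrA. Qed.
Let daddC : commutative dadd. Proof. by move=> s t; apply: dsectP => x; exact: addrC. Qed.
Let dadd0 : left_id dzero dadd. Proof. by move=> s; apply: dsectP => x; exact: add0r. Qed.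
Let daddN : left_inverse dzero dopp dadd.
Proof. by move=> s; apply: dsectP => x; exact: addNr. Qed.

HB.instance Definition _ := GRing.isZmodule.Build dsect daddA daddC dadd0 daddN.

Let dscaleA a b s : dscale a (dscale b s) = dscale (a * b) s.
Proof. by apply: dsectP => x; exact: scalerA. Qed.
Let dscale1 : left_id 1 dscale. Proof. by move=> s; apply: dsectP => x; exact: scale1r. Qed.
Let dscaleDr : right_distributive dscale +%R.
Proof. by move=> c s t; apply: dsectP => x; exact: scalerDr. Qed.
Let dscaleDl s : {morph dscale^~ s : a b / a + b}.
Proof. by move=> a b; apply: dsectP => x; exact: scalerDl. Qed.

HB.instance Definition _ := GRing.Zmodule_isLmodule.Build k dsect
  dscaleA dscale1 dscaleDr dscaleDl.

Definition fmul (f : X -> k) s : dsect := fun x => f x *: s x.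

Lemma dsectDE s t x : (s + t) x = s x + t x. Proof. by []. Qed.
Lemma dsectNE s x : (- s) x = - s x. Proof. by []. Qed.
Lemma dsectZE c s x : (c *: s) x = c *: s x. Proof. by []. Qed.

End Sections.

Section Twists.
Context (k : closedFieldType) (X : swfType k) (A B : k -> X).
Hypothesis hP : is_P1 A B.
Local Notation oo := (B 0).
Local Notation gen := (generically A).
Local Notation zc := (zcoord A).

(* The frame of O(m) near infinity, in terms of the frame used on the affine
   line: a section of a bundle twisted by O(m) is a section s over the affine
   line such that z^(-m) s extends to infinity, and the value of s at infinity
   is that of this extension. *)
Definition theta (m : int) (x : X) : k := if x == oo then 1 else zc x ^ (- m).

Lemma theta_oo m : theta m oo = 1. Proof. by rewrite /theta eqxx. Qed.

Lemma thetaD_near m n : \forall y \near oo, theta (m + n) y = theta m y * theta n y.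
Proof.
apply: filterS (near_oo hP) => y [->|[z0 /eqP/negbTE yoo]].
  by rewrite !theta_oo mulr1.
by rewrite /theta yoo opprD expfzDr.
Qed.

Lemma theta_neq0_near m : \forall y \near oo, theta m y != 0.
Proof.
apply: filterS (near_oo hP) => y [->|[z0 /eqP/negbTE yoo]].
  by rewrite theta_oo oner_eq0.
by rewrite /theta yoo expfz_neq0.
Qed.

Lemma thetaB m v : v != 0 -> theta m (B v) = v ^ m.
Proof.
move=> v0; rewrite /theta; case: eqP => [/(chart_inj (P1_chartB hP)) vE|_].
  by rewrite vE eqxx in v0.
by rewrite (P1_flip hP)// (zcoordA hP)// exprz_inv opprK.
Qed.

Definition hform (m : int) (f : X -> k) : Prop :=
  (forall u, regular_at f (A u)) /\ regular_at (fun x => theta m x * f x) oo.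

Lemma form_mul m n f g : hform m f -> hform n g -> hform (m + n) (fun x => f x * g x).
Proof.
move=> [fA foo] [gA goo]; split=> [u|]; first exact: regular_atM.
apply: near_eq_regular_at (regular_atM foo goo).
by apply: filterS (thetaD_near m n) => y ->; rewrite mulrACA.
Qed.

Lemma form_cst c : hform 0 (fun=> c).
Proof.
split=> [u|]; first exact: regular_at_cst.
apply: near_eq_regular_at (regular_at_cst c oo).
by apply: nearW => y; rewrite /theta oppr0 expr0z if_same mul1r.
Qed.

(* The linear form vanishing at x, as a section of O(1): its value at infinity is
   taken in the frame theta 1. *)
Definition linform (x y : X) : k :=
  if x == oo then (y != oo)%:R else if y == oo then 1 else zc y - zc x.

Lemma linformA u v : linform (A u) (A v) = v - u.
Proof. by rewrite /linform !(zcoordA hP); do 2 case: eqP => [/(P1_infty hP)//|_]. Qed.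

Lemma linformA_oo u : linform (A u) oo = 1.
Proof. by rewrite /linform eqxx; case: eqP => // /(P1_infty hP). Qed.

Lemma linform_ooA v : linform oo (A v) = 1.
Proof. by rewrite /linform eqxx; case: eqP => // /(P1_infty hP). Qed.

Lemma linform0 x : linform x x = 0.
Proof. by rewrite /linform; case: eqP => _; rewrite ?subrr. Qed.

Lemma linform_neq0 x y : x <> y -> linform x y != 0.
Proof.
have [[u ->]|->] := P1_cover hP x; have [[v ->]|->] := P1_cover hP y => xy.
- by rewrite linformA subr_eq0; apply: contra_not_neq xy => ->.
- by rewrite linformA_oo oner_eq0.
- by rewrite linform_ooA oner_eq0.
- by case: xy.
Qed.

Lemma form_linform x : hform 1 (linform x).
Proof.
split=> [v|].
  apply/(chart_regular (P1_chartA hP)).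
  have [[u ->]|->] := P1_cover hP x.
    exists ('X - u%:P), 1; rewrite hornerC oner_eq0; split=> // w _.
    by rewrite linformA !hornerE divr1.
  exists 1, 1; rewrite hornerC oner_eq0; split=> // w _.
  by rewrite linform_ooA !hornerC divr1.
apply/(chart_regular (P1_chartB hP)).
have [[u ->]|->] := P1_cover hP x.
  exists (1 - u *: 'X), 1; rewrite hornerC oner_eq0; split=> // w _.
  rewrite !hornerE divr1; have [->|w0] := eqVneq w 0.
    by rewrite linformA_oo theta_oo !mulr0 subr0 mulr1.
  rewrite thetaB// expr1z (P1_flip hP w0) linformA mulrBr divff//.
  by rewrite [w * u]mulrC.
exists 'X, 1; rewrite hornerC oner_eq0; split=> // w _.
rewrite !hornerE divr1; have [->|w0] := eqVneq w 0.
  by rewrite linform0 mulr0.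
by rewrite thetaB// expr1z (P1_flip hP w0) linform_ooA mulr1.
Qed.

Lemma form_exp m f n : hform m f -> hform (m * n%:Z) (fun x => f x ^+ n).
Proof.
move=> mf; elim: n => [|n IHn].
  by rewrite mulr0; under eq_fun do rewrite expr0; exact: form_cst.
rewrite -addn1 PoszD mulrDr mulr1 addrC; under eq_fun do rewrite addn1 exprS.
exact: form_mul.
Qed.

Lemma form_eq1 x (m : nat) : exists q, hform m%:Z q /\ q x = 1.
Proof.
have [y xy] : exists y, y <> x.
  have [[u ->]|->] := P1_cover hP x; first by exists oo => /esym/(P1_infty hP).
  by exists (A 0) => /(P1_infty hP).
have yx := linform_neq0 xy.
exists (fun z => ((linform y x)^-1 * linform y z) ^+ m).
split; last by rewrite mulVf// expr1n.
have f1 : hform 1 (fun z => (linform y x)^-1 * linform y z).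
  by have := form_mul (form_cst (linform y x)^-1) (form_linform y); rewrite add0r.
by have := form_exp m f1; rewrite mul1r.
Qed.

(** The denominator loses its roots one by one: at a root [u], the regularity of [f] forces the
    numerator to vanish too, and the common factor cancels. *)
Lemma form_polynomial m f : hform m f -> exists p : {poly k}, forall v, f (A v) = p.[v].
Proof.
move=> [fA _].
have [a [h [h0 fE]]] := regular_ratfun hP (fA 0).
have : gen (fun x => f x * h.[zc x] = a.[zc x]).
  by exists h; split=> // v hv; rewrite fE// (zcoordA hP)// mulfVK.
have [n] := ubnP (size h); elim: n a h h0 {fE} => // n IHn a h h0 hn fE.
have [/size_poly1P[c c0 hc]|] := boolP (size h == 1).
  exists (c^-1 *: a) => v.
  pose g x := (c^-1 *: a).[zc x].
  have rg : regular_at g (A v).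
    apply/(chart_regular (P1_chartA hP)); exists (c^-1 *: a), 1.
    by rewrite hornerC oner_eq0; split=> // w _; rewrite /g (zcoordA hP)// hornerC divr1.
  rewrite (removable hP (fA v) rg) /g ?(zcoordA hP)//.
  apply: genericallyS fE => x; rewrite hc hornerC hornerZ => <-.
  by rewrite mulrCA mulVf ?mulr1.
move=> /closed_rootP[u /factor_theorem[h1 hE]].
have [b [j [ju fuE]]] := (chart_regular (P1_chartA hP) u f).1 (fA u).
have e : b * h = a * j.
  have [g [g0 gE]] := fE; apply: (@poly_eq_generic _ (g * j)) => [|v].
    by rewrite mulf_neq0// (horner_neq0 ju).
  rewrite hornerM mulf_eq0 negb_or => /andP[/gE + jv].
  by rewrite (zcoordA hP)// fuE// !hornerM => <-; field.
have /factor_theorem[a1 aE] : root a u.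
  have /eqP := congr1 (fun p : {poly k} => p.[u]) e.
  rewrite hE !hornerM hornerXsubC subrr !mulr0 eq_sym mulf_eq0 (negbTE ju) orbF.
  by [].
have h10 : h1 != 0 by apply: contraNneq h0 => h10; rewrite hE h10 mul0r.
apply: (IHn a1 h1 h10).
  by move: hn; rewrite hE size_Mmonic ?monicXsubC// size_XsubC addn2.
have := generically2 (fun x => @conj _ _) (generically_finite hP) fE.
apply: generically2 (generically_neqA hP u) => x xu [xoo].
rewrite hE aE !hornerM hornerXsubC mulrA; apply: mulIf; rewrite subr_eq0.
by apply/eqP => zu; apply: xu; rewrite -zu (zcoordK hP).
Qed.

Lemma form_zero m f (us : seq k) : hform m f -> uniq us ->
  (forall u, u \in us -> f (A u) = 0) -> m < (size us)%:Z -> forall x, f x = 0.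
Proof.
move=> mf uus f0 ltm; have [p pE] := form_polynomial mf; have [fA foo] := mf.
have p0 : p = 0.
  apply/eqP; apply: contraT => p0; have ltus : (size us < size p)%N.
    by apply: max_poly_roots => //; apply/allP => u /f0; rewrite pE => /eqP.
  pose n := (size p).-1; have sp : size p = n.+1 by rewrite prednK// size_poly_gt0.
  have [q [q0 qE]] := reverse_poly (eq_leq sp).
  have ltmn : m < n%:Z by apply: (lt_le_trans ltm); rewrite lez_nat -ltnS -sp.
  have [a [h [h0 aE]]] := (chart_regular (P1_chartB hP) 0 _).1 foo.
  have [j jE] : exists j : nat, n%:Z = m + j.+1%:Z.
    exists (absz (n%:Z - m - 1)%R); rewrite -addn1 PoszD gez0_abs; first by ring.
    by move: ltmn; lia.
  (* If the degree n of [p] exceeds [m], regularity at infinity, written in v = 1/z, gives this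
     identity with j + 1 = n - m. At v = 0 its right side vanishes, while [q] takes there the
     leading coefficient of [p]. *)
  have e : q * h = a * 'X^(j.+1).
    apply: (@poly_eq_generic _ (h * 'X)) => [|v].
      by rewrite mulf_neq0 ?polyX_eq0// (horner_neq0 h0).
    rewrite hornerM hornerX mulf_eq0 negb_or => /andP[hv v0].
    have := aE v hv; rewrite (thetaB _ v0) (P1_flip hP v0) pE => e.
    have vn : v ^+ n = v ^ m * v ^+ j.+1.
      by rewrite -[v ^+ n]/(v ^ n%:Z) jE expfzDr.
    have -> : (q * h).[v] = v ^ m * v ^+ j.+1 * p.[v^-1] * h.[v] by rewrite hornerM qE// vn.
    have -> : (a * 'X^(j.+1)).[v] = a.[v] * v ^+ j.+1 by rewrite hornerM hornerXn.
    have -> : a.[v] = v ^ m * p.[v^-1] * h.[v] by rewrite e divfK.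
    by ring.
  have /eqP := congr1 (fun p : {poly k} => p.[0]) e.
  rewrite !hornerM hornerXn expr0n mulr0 mulf_eq0 (negbTE h0) orbF q0.
  by rewrite -[n]/(n.+1.-1) -sp -lead_coefE lead_coef_eq0 (negbTE p0).
have fA0 v : f (A v) = 0 by rewrite pE p0 horner0.
move=> x; have [[v ->]//|->] := P1_cover hP x.
have := removable hP foo (regular_at_cst 0 oo).
rewrite theta_oo mul1r; apply; exists 1; rewrite oner_eq0; split=> // v _.
by rewrite fA0 mulr0.
Qed.

End Twists.

(* R s x means that the section s of V is regular at x: this covers the regular
   functions and the regular sections of a vector bundle. *)
Record regularity (k : fieldType) (X : swfType k) (V : X -> lmodType k)
    (R : dsect V -> X -> Prop) : Prop := Regularity {
  reg_near : forall s t x, (\forall y \near x, s y = t y) -> R s x -> R t x;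
  regD : forall s t x, R s x -> R t x -> R (s + t) x;
  regM : forall f s x, regular_at f x -> R s x -> R (fmul f s) x }.

(** * Clearing poles by twisting, and dividing by linear forms *)

Section Twisted.
Context (k : closedFieldType) (X : swfType k) (A B : k -> X).
Hypothesis hP : is_P1 A B.
Local Notation oo := (B 0).
Local Notation gen := (generically A).
Local Notation th := (theta A B).
Context (V : X -> lmodType k) (R : dsect V -> X -> Prop).
Hypothesis hR : regularity R.
Implicit Types (s t : dsect V) (m d : int).

Definition twisted d s : Prop := (forall u, R s (A u)) /\ R (fmul (th d) s) oo.

Lemma twistedD d s t : twisted d s -> twisted d t -> twisted d (s + t).
Proof.
move=> [sA soo] [tA too]; split=> [u|]; first exact: regD.
apply: (reg_near hR _ (regD hR soo too)).
by apply: nearW => y; rewrite dsectDE /fmul dsectDE scalerDr.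
Qed.

Lemma twisted_form m d f s : hform A B m f -> twisted d s ->
  twisted (m + d) (fmul f s).
Proof.
move=> [fA foo] [sA soo]; split=> [u|]; first exact: regM.
apply: (reg_near hR _ (regM hR foo soo)).
apply: filterS (thetaD_near hP m d) => y yE.
by rewrite /fmul !scalerA yE mulrAC.
Qed.

Lemma twistedZ d c s : twisted d s -> twisted d (c *: s).
Proof. by move/(twisted_form (form_cst A B c)); rewrite add0r. Qed.

Lemma twistedN d s : twisted d s -> twisted d (- s).
Proof. by rewrite -scaleN1r; exact: twistedZ. Qed.

Lemma near_neqA u v : u != v -> \forall y \near A u, y <> A v.
Proof.
move=> uv; apply: filterS (generic_near hP (A u) (generically_neqA hP v)) => y.
by case=> [->|//] /(chart_inj (P1_chartA hP))/eqP; rewrite (negbTE uv).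
Qed.

Lemma near_oo_neqA u : \forall y \near oo, y <> A u.
Proof.
apply: filterS (generic_near hP oo (generically_neqA hP u)) => y.
by case=> [-> /esym/(P1_infty hP)|//].
Qed.

Lemma reg_gen s t x : gen (fun y => s y = t y) -> s x = t x -> R s x -> R t x.
Proof.
move=> st sx; apply: (reg_near hR).
by apply: filterS (generic_near hP x st) => y [->|].
Qed.

Lemma uniformizer_linform u y : y <> oo ->
  uniformizer A B (A u) y = linform A B (A u) y.
Proof.
move=> yoo; have [[v ->]|//] := P1_cover hP y.
by rewrite (uniformizerA hP) (linformA hP).
Qed.

(** Each pole is killed by the [M]-th power of the linear form vanishing there, which raises the
    twist by [M]. These forms take the value 1 at infinity, so nothing changes there; [Q] is their
    product. *)
Lemma clear_poles (us : seq k) M m s : uniq us ->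
  (forall u, u \notin us -> R s (A u)) -> R (fmul (th m) s) oo ->
  (forall u, u \in us -> exists t, R t (A u) /\
     gen (fun y => t y = uniformizer A B (A u) y ^+ M *: s y)) ->
  exists t (Q : X -> k), [/\ twisted (m + (M * size us)%:Z) t,
    Q oo = 1, forall u, u \notin us -> Q (A u) != 0 &
    forall x, (forall u, u \in us -> x <> A u) -> t x = Q x *: s x].
Proof.
elim: us m s => [|u us IHus] m s.
  move=> _ sA soo _; exists s, (fun=> 1); rewrite muln0 addr0.
  split=> [|||x _]; [|by []|by move=> u _; exact: oner_neq0|by rewrite scale1r].
  by split=> // u; exact: sA.
move=> /= /andP[uus uniq_us] sA soo sE.
have [r [rA rE]] := sE u (mem_head _ _).
pose L y := linform A B (A u) y ^+ M.
have formL : hform A B M%:Z L.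
  by have := form_exp hP M (form_linform hP (A u)); rewrite mul1r.
(* At the pole the value of [s] carries no information; it is replaced by that of the regular
   extension [r]. *)
pose s1 : dsect V := fun y => if y == A u then r y else fmul L s y.
have s1E y : y <> A u -> s1 y = fmul L s y by rewrite /s1; case: eqP.
have s1r : R s1 (A u).
  apply: reg_gen rA; last by rewrite /s1 eqxx.
  have := generically2 (fun x => @conj _ _) (generically_neqA hP u) (generically_finite hP).
  by apply: generically2 rE => y -> [/s1E -> yoo]; rewrite (uniformizer_linform _ yoo).
have [||||t [Q [tH Qoo QA tE]]] := IHus (m + M%:Z) s1.
- by [].
- move=> v vus; have [->//|vu] := eqVneq v u.
  apply: (reg_near hR _ (regM hR (formL.1 v) (sA v _))).
    by apply: filterS (near_neqA vu) => y /s1E.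
  by rewrite inE negb_or vu.
- apply: (reg_near hR _ (regM hR formL.2 soo)).
  apply: filterS2 (near_oo_neqA u) (thetaD_near hP m M%:Z) => y yu yE.
  by rewrite /fmul (s1E y yu) /fmul !scalerA yE [th m y * _]mulrC mulrAC.
- move=> v vus; have [|r' [r'A r'E]] := sE v; first by rewrite inE vus orbT.
  exists (fmul L r'); split; first exact: regM (formL.1 v) r'A.
  apply: generically2 (generically_neqA hP u) r'E => y /s1E s1y ry.
  by rewrite s1y /fmul ry !scalerA mulrC.
exists t, (fun y => Q y * L y); split.
- by rewrite mulnS PoszD addrA.
- by rewrite Qoo mul1r /L (linformA_oo hP) expr1n.
- move=> v; rewrite inE negb_or => /andP[vu /QA Qv]; rewrite mulf_neq0//.
  by rewrite expf_neq0// linformA// subr_eq0.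
- move=> x xus; rewrite tE => [|v vus]; last by apply: xus; rewrite inE vus orbT.
  by rewrite s1E /fmul ?scalerA//; apply: xus; exact: mem_head.
Qed.

Lemma twisted_divide d s x t : twisted d s -> s x = 0 -> R t x ->
  gen (fun y => (if x == oo then th d y else 1) *: s y = uniformizer A B x y *: t y) ->
  exists2 s', twisted (d - 1) s' & s = fmul (linform A B x) s'.
Proof.
have [[u ->]|->] := P1_cover hP x; last first.
  move=> [sA soo] s0 too; rewrite eqxx => tE.
  (* The form [linform oo] is 1 on the affine line, so the quotient is [s] itself there; only its
     value at infinity, now read in the frame [theta (d - 1)], has to be supplied. *)
  pose s' : dsect V := fun y => if y == oo then t y else s y.
  have s'E y : y <> oo -> s' y = s y by rewrite /s'; case: eqP.
  exists s'; last first.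
    apply: dsectP => y; rewrite /fmul /s' /linform eqxx.
    by case: eqP => [->|_]; rewrite ?scale0r ?scale1r.
  split=> [v|].
    by apply: (reg_near hR _ (sA v)); apply: filterS (near_A hP v) => y /s'E.
  apply: reg_gen too; last by rewrite /fmul /s' eqxx (theta_oo _ B) scale1r.
  have := generically2 (fun x => @conj _ _) (generic_uniformizer hP oo) (generically_finite hP).
  apply: generically2 tE => y tE [u0 yoo]; rewrite /fmul (s'E _ yoo).
  apply: (scalerI u0); rewrite -tE scalerA; congr (_ *: _).
  move: u0; rewrite /uniformizer eqxx invr_eq0 => z0.
  rewrite /theta; case: eqP => // _; rewrite opprB addrC expfzDr// expr1z.
  by rewrite mulrCA mulVf// mulr1.
case: eqP => [/(P1_infty hP)//|_] [sA soo] s0 tu tE.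
pose L := linform A B (A u).
have [LA Loo] := form_linform hP (A u).
pose s' : dsect V := fun y => if y == A u then t y else fmul (fun y => (L y)^-1) s y.
have s'E y : y <> A u -> s' y = fmul (fun y => (L y)^-1) s y.
  by rewrite /s'; case: eqP.
exists s'; last first.
  apply: dsectP => y; have [->|/eqP yu] := eqVneq y (A u).
    by rewrite s0 /fmul linform0 scale0r.
  rewrite /fmul (s'E _ yu) /fmul scalerA divff ?scale1r//.
  by apply: (linform_neq0 hP) => e; apply: yu.
have invL v : v != u -> regular_at (fun y => (L y)^-1) (A v).
  by move=> vu; apply: regular_atV (LA v) _; rewrite /L linformA// subr_eq0.
split=> [v|].
  have [->|vu] := eqVneq v u.
    apply: reg_gen tu; last by rewrite /s' eqxx.
    have := generically2 (fun x => @conj _ _) (generically_neqA hP u) (generically_finite hP).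
    apply: generically2 tE => y; rewrite scale1r => tE [yu yoo].
    rewrite (s'E _ yu) /fmul tE uniformizer_linform// scalerA mulVf ?scale1r//.
    by apply: (linform_neq0 hP) => e; apply: yu.
  apply: (reg_near hR _ (regM hR (invL v vu) (sA v))).
  by apply: filterS (near_neqA vu) => y /s'E.
have L1 : th 1 oo * L oo != 0.
  by rewrite (theta_oo _ B) /L linformA_oo// mulr1 oner_neq0.
apply: (reg_near hR _ (regM hR (regular_atV Loo L1) soo)).
near=> y.
have yu : y <> A u by near: y; exact: near_oo_neqA.
have yE : th d y = th (d - 1) y * th 1 y.
  by rewrite -[d in LHS](subrK 1); near: y; exact: thetaD_near.
have t0 : th 1 y != 0 by near: y; exact: theta_neq0_near.
rewrite /fmul (s'E _ yu) /fmul !scalerA yE invfM; congr (_ *: _).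
rewrite -/(L y); move: (L y)^-1 (th (d - 1) y) t0 => l c t0; field. exact: t0.
Unshelve. all: by end_near. Qed.

End Twisted.

(** * Sections of a vector bundle on the projective line *)

Section BundleSections.
Context (k : fieldType) (X : swfType k) (E : vectorBundle X).

Definition bsect := dsect (fun x => fiber E x : lmodType k).
Implicit Types s t : bsect.

Definition sreg s (x : X) : Prop := morphism_at (fun y => point (s y) : total E) x.

Lemma regular_at_sum (Y : swfType k) (y : Y) (I : Type) (r : seq I) (P : pred I)
    (f : I -> Y -> k) : (forall i, regular_at (f i) y) ->
  regular_at (fun z => \sum_(i <- r | P i) f i z) y.
Proof.
move=> rf; elim: r => [|i r IHr].
  by under eq_fun do rewrite big_nil; exact: regular_at_cst.
under eq_fun do rewrite big_cons; case: (P i) => //.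
exact: regular_atD.
Qed.

Section Trivialized.
Context (U : set X) (n : nat) (phi : forall x, {linear fiber E x -> 'rV[k]_n})
  (psi : forall x, {linear 'rV[k]_n -> fiber E x}).
Hypothesis triv : trivialization U phi psi.

Lemma trivKl x v : U x -> psi x (phi x v) = v.
Proof. by case: triv => can _ _ /can[->]. Qed.

Lemma trivKr x v : U x -> phi x (psi x v) = v.
Proof. by case: triv => can _ _ /can[_ ->]. Qed.

Lemma sreg_psi (f : X -> 'rV[k]_n) x : U x ->
  (forall i, regular_at (fun y => f y 0 i) x) -> sreg (fun y => psi y (f y)) x.
Proof.
move=> Ux rf; have [_ _ mpsi] := triv.
have mf : morphism_at (fun y => (y, f y) : zprod X (affine k n)) x.
  apply: morphism_at_pair; first exact: morphism_at_id.
  exact: morphism_at_to_affine.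
exact: morphism_at_comp mf (mpsi (x, f x) Ux).
Qed.

Lemma sreg_coord s x i : U x -> sreg s x -> regular_at (fun y => phi y (s y) 0 i) x.
Proof.
move=> Ux sx; have [_ m2] := @trivialization_fst _ _ _ _ _ _ _ (point (s x)) triv Ux.
exact: morphism_at_coord (morphism_at_comp sx m2) i.
Qed.

Lemma sreg_from_coord s x : nbhs x U ->
  (forall i, regular_at (fun y => phi y (s y) 0 i) x) -> sreg s x.
Proof.
move=> nU rs; have := sreg_psi (nbhs_singleton nU) rs.
by apply: near_eq_morphism_at; apply: filterS nU => y Uy; rewrite trivKl.
Qed.

End Trivialized.

Lemma sreg_regularity : regularity sreg.
Proof.
split.
- move=> s t x st; apply: near_eq_morphism_at.
  by apply: filterS st => y ->.
- move=> s t x sx tx.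
  have [U [n [phi [psi [oU triv]]]]] := bundle_locally_trivial E x.
  have nU := open_nbhs_nbhs oU; have Ux := nbhs_singleton nU.
  apply: (sreg_from_coord triv nU) => i.
  apply: near_eq_regular_at (regular_atD (sreg_coord triv i Ux sx) (sreg_coord triv i Ux tx)).
  by apply: nearW => y; rewrite dsectDE linearD mxE.
- move=> f s x fx sx.
  have [U [n [phi [psi [oU triv]]]]] := bundle_locally_trivial E x.
  have nU := open_nbhs_nbhs oU; have Ux := nbhs_singleton nU.
  apply: (sreg_from_coord triv nU) => i.
  apply: near_eq_regular_at (regular_atM fx (sreg_coord triv i Ux sx)).
  by apply: nearW => y; rewrite /fmul linearZ mxE.
Qed.

Lemma sreg0 x : sreg (0 : bsect) x.
Proof.
have [U [n [phi [psi [oU triv]]]]] := bundle_locally_trivial E x.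
apply: (sreg_from_coord triv (open_nbhs_nbhs oU)) => i.
by under eq_fun do rewrite linear0 mxE; exact: regular_at_cst.
Qed.

End BundleSections.

Section BundleOnP1.
Context (k : closedFieldType) (X : swfType k) (A B : k -> X).
Hypothesis hP : is_P1 A B.
Local Notation oo := (B 0).
Local Notation gen := (generically A).
Context (E : vectorBundle X).
Implicit Types s t : bsect E.

Lemma gen_all (I : finType) (P : I -> X -> Prop) : (forall i, gen (P i)) ->
  gen (fun x => forall i, P i x).
Proof.
move=> /choice[g gP]; exists (\prod_i g i); split.
  by apply/prodf_neq0 => i _; have [] := gP i.
move=> v; rewrite horner_prod => /prodf_neq0 gv i.
by have [_] := gP i; apply; exact: gv.
Qed.

Lemma sreg_removable s t x : sreg s x -> sreg t x ->
  gen (fun y => s y = t y) -> s x = t x.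
Proof.
move=> sx tx st.
have [U [n [phi [psi [oU triv]]]]] := bundle_locally_trivial E x.
have Ux := nbhs_singleton (open_nbhs_nbhs oU).
rewrite -(trivKl triv (s x) Ux) -(trivKl triv (t x) Ux); congr (psi x _).
apply/rowP => i.
apply: (removable hP (sreg_coord triv i Ux sx) (sreg_coord triv i Ux tx)).
by apply: genericallyS st => y ->.
Qed.

Lemma sreg_divide s x : sreg s x -> s x = 0 ->
  exists t, sreg t x /\ gen (fun y => s y = uniformizer A B x y *: t y).
Proof.
move=> sx s0.
have [U [n [phi [psi [oU triv]]]]] := bundle_locally_trivial E x.
have nU := open_nbhs_nbhs oU; have Ux := nbhs_singleton nU.
have /choice[f fE] i := divide_uniformizer hP (sreg_coord triv i Ux sx)
  (etrans (congr1 (fun v => phi x v 0 i) s0)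
    (etrans (congr1 (fun v : 'rV_n => v 0 i) (linear0 _)) (mxE _ _ _ _))).
exists (fun y => psi y (\row_i f i y)); split.
  apply: (sreg_psi triv Ux) => i; under eq_fun do rewrite mxE.
  by have [] := fE i.
have := gen_all (fun i => (fE i).2).
apply: generically2 (nbhs_generic hP nU) => y Uy fy.
rewrite -(trivKl triv (s y) Uy) -linearZ; congr (psi y _).
by apply/rowP => i; rewrite !mxE fy.
Qed.

(** Stated for every exponent above a bound, so that one exponent can later serve at finitely many
    points. *)
Lemma common_pole (I : finType) (f : I -> X -> k) x : (forall i, ratfun A (f i)) ->
  exists M, forall N, (M <= N)%N -> exists g : I -> X -> k, forall i,
    regular_at (g i) x /\ gen (fun y => g i y = uniformizer A B x y ^+ N * f i y).
Proof.
move=> rf; have /choice[M /choice[g gE]] i := clear_pole hP x (rf i).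
exists (\max_i M i)%N => N mN.
exists (fun i y => uniformizer A B x y ^+ (N - M i) * g i y) => i.
have [gr ge] := gE i; have ru := regular_uniformizer hP x.
split; first exact: regular_atM (regular_atX _ ru) gr.
apply: genericallyS ge => y ->; rewrite !mulrA -!exprD; congr (_ ^+ _ * _).
by have := leq_bigmax i : (M i <= _)%N; lia.
Qed.

(** Two trivializing open sets always meet, so the entries of the transition matrix are rational
    functions; hence the sections constant over [U] have poles at [x] of order bounded independently
    of [w]. *)
Lemma transition_pole (U : set X) n (phi : forall x, {linear fiber E x -> 'rV[k]_n})
    (psi : forall x, {linear 'rV[k]_n -> fiber E x}) (triv : trivialization U phi psi)
    (x0 : X) (nU : nbhs x0 U) x : exists M, forall N, (M <= N)%N -> forall w,
  exists t, sreg t x /\ gen (fun y => t y = uniformizer A B x y ^+ N *: psi y w).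
Proof.
have [U' [m [phi' [psi' [oU' triv']]]]] := bundle_locally_trivial E x.
have nU' := open_nbhs_nbhs oU'; have U'x := nbhs_singleton nU'.
have [v [Uv U'v]] := generically_ex (generically2 (fun x => @conj _ _)
  (nbhs_generic hP nU) (nbhs_generic hP nU')).
have rf (ij : 'I_n * 'I_m) :
    ratfun A (fun y => phi' y (psi y (delta_mx 0 ij.1)) 0 ij.2).
  apply: (regular_ratfun hP (x := A v)).
  apply: (sreg_coord (s := fun y => psi y (delta_mx 0 ij.1)) triv' _ U'v).
  by apply: (sreg_psi triv Uv) => i; exact: regular_at_cst.
have [M gM] := common_pole x rf; exists M => N /gM[g gE] w.
exists (fun y => psi' y (\row_j \sum_i w 0 i * g (i, j) y)); split.
  apply: (sreg_psi triv' U'x) => j; under eq_fun do rewrite mxE.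
  apply: regular_at_sum => i; apply: regular_atM (regular_at_cst _ _) _.
  by have [] := gE (i, j).
have := gen_all (fun i => (gE i).2).
apply: generically2 (nbhs_generic hP nU') => y U'y gy.
rewrite -[psi y w](trivKl triv' _ U'y) -linearZ; congr (psi' y _).
apply/rowP => j; rewrite !mxE [in RHS](row_sum_delta w) !linear_sum !summxE mulr_sumr.
by apply: eq_bigr => i _; rewrite gy !linearZ !mxE mulrCA.
Qed.

(** The other direction of the transition matrix. The bound does not depend on [s], which is what
    allows a dimension bound for whole spaces of sections. *)
Lemma coord_pole (U : set X) n (phi : forall x, {linear fiber E x -> 'rV[k]_n})
    (psi : forall x, {linear 'rV[k]_n -> fiber E x}) (triv : trivialization U phi psi)
    (x0 : X) (nU : nbhs x0 U) x : exists M, forall N, (M <= N)%N ->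
  forall s, sreg s x -> forall i, exists g, regular_at g x /\
    gen (fun y => g y = uniformizer A B x y ^+ N * phi y (s y) 0 i).
Proof.
have [U' [m [phi' [psi' [oU' triv']]]]] := bundle_locally_trivial E x.
have nU' := open_nbhs_nbhs oU'; have U'x := nbhs_singleton nU'.
have [v [Uv U'v]] := generically_ex (generically2 (fun x => @conj _ _)
  (nbhs_generic hP nU) (nbhs_generic hP nU')).
have rf (ij : 'I_n * 'I_m) :
    ratfun A (fun y => phi y (psi' y (delta_mx 0 ij.2)) 0 ij.1).
  apply: (regular_ratfun hP (x := A v)).
  apply: (sreg_coord (s := fun y => psi' y (delta_mx 0 ij.2)) triv _ Uv).
  by apply: (sreg_psi triv' U'v) => i; exact: regular_at_cst.
have [M gM] := common_pole x rf; exists M => N /gM[g gE] s sx i.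
exists (fun y => \sum_j phi' y (s y) 0 j * g (i, j) y); split.
  apply: regular_at_sum => j.
  by apply: regular_atM (sreg_coord triv' j U'x sx) _; have [] := gE (i, j).
have := gen_all (fun i => (gE i).2).
apply: generically2 (nbhs_generic hP nU') => y U'y gy.
rewrite -[in RHS](trivKl triv' (s y) U'y) [in RHS](row_sum_delta (phi' y (s y))).
rewrite !linear_sum !summxE mulr_sumr.
by apply: eq_bigr => j _; rewrite gy !linearZ !mxE mulrCA.
Qed.

Lemma poly_zeros (g : {poly k}) : g != 0 ->
  exists us : seq k, forall u, g.[u] = 0 -> u \in us.
Proof.
move=> g0; have [us gE] := closed_field_poly_normal g; exists us => u /eqP.
by rewrite -/(root g u) gE rootZ ?lead_coef_eq0// root_prod_XsubC.
Qed.

Lemma poly_nonzeros (g : {poly k}) N : g != 0 ->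
  exists vs : seq k, [/\ uniq vs, size vs = N & forall v, v \in vs -> g.[v] != 0].
Proof.
move=> g0; elim: N => [|N [vs [uvs svs gvs]]]; first by exists [::].
have p0 : g * \prod_(v <- vs) ('X - v%:P) != 0.
  by rewrite mulf_neq0// -size_poly_gt0 size_prod_XsubC.
have [v] := polyF_neq0 p0; rewrite hornerM mulf_eq0 negb_or => /andP[gv].
rewrite -/(root _ v) root_prod_XsubC => vvs.
exists (v :: vs); rewrite /= vvs uvs svs; split=> // w.
by rewrite inE => /orP[/eqP ->|/gvs].
Qed.

Lemma cofinite_nbhs (x : X) (U : set X) : nbhs x U ->
  exists us : seq k, uniq us /\ forall u, u \in us <-> ~ U (A u).
Proof.
move=> /(nbhs_generic hP)[g [g0 gU]]; have [us usE] := poly_zeros g0.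
exists (undup [seq u <- us | ~~ `[< U (A u) >]]); rewrite undup_uniq; split=> // u.
rewrite mem_undup mem_filter; split=> [/andP[/asboolPn]//|nU].
apply/andP; split; [exact/asboolPn | apply: usE].
by apply/eqP; apply: contra_notT nU => /gU.
Qed.

Lemma seq_bound (us : seq k) (P : k -> nat -> Prop) :
  (forall u, exists M, forall N, (M <= N)%N -> P u N) ->
  exists N, forall u, u \in us -> P u N.
Proof.
move=> /choice[M PM]; exists (\max_(u <- us) M u)%N => u uus.
by apply: PM; apply: (leq_bigmax_seq (F := M)).
Qed.

(** The vector is extended as a constant in a trivialization around [x], and the poles of this
    rational section, at infinity and at the points outside [U], are absorbed by the twist. As [x]
    is in [U], the clearing factor is nonzero at [x] and can be normalized. *)
Lemma globally_generated x (v : fiber E x) :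
  exists d s, twisted A B (@sreg k X E) d s /\ s x = v.
Proof.
have [U [n [phi [psi [oU triv]]]]] := bundle_locally_trivial E x.
have nU := open_nbhs_nbhs oU; have Ux := nbhs_singleton nU.
pose w := phi x v.
pose s0 : bsect E := fun y => psi y w.
have s0r y : U y -> sreg s0 y.
  by move=> Uy; apply: (sreg_psi triv Uy) => i; exact: regular_at_cst.
have hR := sreg_regularity E.
have [m [s1 [s1oo s1E s1x]]] : exists m (s1 : bsect E),
    [/\ sreg (fmul (theta A B m) s1) oo, forall y, y <> oo -> s1 y = s0 y & s1 x = v].
  have [xoo|/eqP xoo] := eqVneq x oo.
    exists 0, s0; split=> //; last by rewrite /s0 /w (trivKl triv).
    apply: (reg_near hR) (s0r oo _); last by rewrite -xoo.
    by apply: nearW => y; rewrite /fmul /theta oppr0 expr0z if_same scale1r.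
  have [N tN] := transition_pole triv nU oo.
  have [t [too tE]] := tN N (leqnn N) w.
  pose s1 : bsect E := fun y => if y == oo then t y else s0 y.
  have s1E y : y <> oo -> s1 y = s0 y by rewrite /s1; case: eqP.
  exists N%:Z, s1; split=> //; last by rewrite s1E// /s0 /w (trivKl triv).
  apply: (reg_gen hP hR) too; last by rewrite /fmul /s1 eqxx (theta_oo A B) scale1r.
  apply: generically2 (generically_finite hP) tE => y yoo ->.
  rewrite /fmul (s1E _ yoo) /theta /uniformizer eqxx; case: eqP => // _.
  by rewrite exprVn exprnN.
have [us [uus usE]] := cofinite_nbhs nU.
have [N tN] := seq_bound us (fun u => transition_pole triv nU (A u)).
have [u uNus|u uin|t [Q [tH Qoo QA tE]]] := @clear_poles _ _ _ _ hP _ _ hR us N m s1 uus _ s1oo.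
- have UAu : U (A u) by apply: contrapT => /usE; rewrite (negbTE uNus).
  apply: (reg_near hR) (s0r _ UAu).
  by apply: filterS (near_A hP u) => y /s1E.
- have [t [tu tE]] := tN u uin w; exists t; split=> //.
  by apply: generically2 (generically_finite hP) tE => y /s1E ->.
have xus u : u \in us -> x <> A u by move=> /usE nUu xE; rewrite -xE in nUu.
have Qx : Q x != 0.
  have [[u xE]|->] := P1_cover hP x; last by rewrite Qoo oner_eq0.
  by rewrite xE; apply: QA; apply/negP => /xus; exact.
exists (m + (N * size us)%:Z), ((Q x)^-1 *: t); split; first exact: (twistedZ hP hR).
by rewrite dsectZE tE// scalerA mulVf// scale1r s1x.
Qed.

Lemma regular_at_regularity :
  regularity (V := fun _ : X => (k^o : lmodType k)) (@regular_at k X).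
Proof.
split=> [s t x|s t x sx tx|f s x fx sx]; first exact: near_eq_regular_at.
  exact: regular_atD sx tx.
exact: regular_atM fx sx.
Qed.

(** In a fixed trivialization the coordinates of a section of degree d become, after clearing the
    poles at the points [us], forms of degree d + D with D = [M * size us]; such a form vanishes
    once it has more zeros than its degree. The map [ev] takes the coordinates at [N] points. The
    case N = 0 says that there is no nonzero section for d < -D. *)
Lemma twisted_embedding : exists D n : nat, forall (d : int) (N : nat),
  D%:Z + d < N%:Z -> exists ev : {linear bsect E -> 'M[k]_(N, n)},
    forall s, twisted A B (@sreg k X E) d s -> ev s = 0 -> s = 0.
Proof.
have [U [n [phi [psi [oU triv]]]]] := bundle_locally_trivial E oo.
have nU := open_nbhs_nbhs oU; have Uoo := nbhs_singleton nU.
have [us [uus usE]] := cofinite_nbhs nU.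
have UA u : u \notin us -> U (A u) by move=> uN; apply: contrapT => /usE; rewrite (negbTE uN).
have [M tM] := seq_bound us (fun u => coord_pole triv nU (A u)).
exists (M * size us)%N, n => d N dN.
have [g [g0 gU]] := nbhs_generic hP nU.
have [vs [uvs svs gvs]] := poly_nonzeros N g0.
pose ev (s : bsect E) := \matrix_(l < N, i < n) phi (A vs`_l) (s (A vs`_l)) 0 i.
have ev_linear : linear ev.
  by move=> c s t; apply/matrixP => l i; rewrite !mxE dsectDE dsectZE linearP !mxE.
exists (mk_linear ev_linear) => s [sA soo] /= ev0.
have f0 i u : u \notin us -> phi (A u) (s (A u)) 0 i = 0.
  have [v vNus||v vus|t [Q [tH Qoo QA tE]]] := @clear_poles _ _ _ _ hP _ _
    regular_at_regularity us M d (fun y => phi y (s y) 0 i) uus.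
  - exact: (sreg_coord triv i (UA v vNus) (sA v)).
  - apply: near_eq_regular_at (sreg_coord triv i Uoo soo).
    by apply: nearW => y; rewrite /fmul linearZ mxE.
  - by have [r [rv rE]] := tM v vus s (sA v) i; exists r.
  have t0 : forall y, t y = 0.
    apply: (form_zero hP tH uvs) => [v vvs|]; last by rewrite svs addrC.
    have /(nthP 0)[l lN vE] := vvs; rewrite svs in lN.
    rewrite tE => [|u' /usE nU' Au']; last by apply: nU'; rewrite -Au'; exact/gU/gvs.
    have := congr1 (fun M : 'M_(N, n) => M (Ordinal lN) i) ev0.
    by rewrite !mxE /= vE => ->; rewrite scaler0.
  move=> uNus; have /eqP := t0 (A u); rewrite tE => [|u' u'us]; last first.
    by move=> /(chart_inj (P1_chartA hP)) uu'; rewrite uu' u'us in uNus.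
  by rewrite mulf_eq0 (negbTE (QA u uNus)) => /eqP.
have s0 : gen (fun y => s y = 0).
  exists g; split=> // v /gU Uv; rewrite -[LHS](trivKl triv _ Uv).
  rewrite (_ : phi _ _ = 0) ?linear0//; apply/rowP => i; rewrite f0 ?mxE//.
  by apply/negP => /usE; exact.
have r0 := sreg0 E.
apply: dsectP => x; have [[u ->]|->] := P1_cover hP x.
  exact: sreg_removable (sA u) (r0 _) s0.
have := sreg_removable soo (r0 _); rewrite /fmul (theta_oo A B) scale1r; apply.
by apply: genericallyS s0 => y ->; rewrite scaler0.
Qed.

Lemma twisted_sreg_divide d s x : twisted A B (@sreg k X E) d s -> s x = 0 ->
  exists2 s', twisted A B (@sreg k X E) (d - 1) s' & s = fmul (linform A B x) s'.
Proof.
move=> sH s0; have hR := sreg_regularity E; have [sA soo] := sH.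
pose f := if x == oo then theta A B d else (fun=> 1).
have [[u xE]|xE] := P1_cover hP x; subst x.
  have [t [tu tE]] := sreg_divide (sA u) s0.
  apply: (twisted_divide hP hR sH s0 tu); case: eqP => [/(P1_infty hP)//|_].
  by apply: genericallyS tE => y <-; rewrite scale1r.
have [|t [tu tE]] := sreg_divide soo; first by rewrite /fmul s0 scaler0.
by apply: (twisted_divide hP hR sH s0 tu); rewrite eqxx.
Qed.

End BundleOnP1.

(** * Commuting operators of finite order *)

Lemma prim_root_exists (k : numClosedFieldType) n : (n > 0)%N ->
  exists z : k, n.-primitive_root z.
Proof.
pose p : {poly k} := 'X^n - 1; have [r Dp] := closed_field_poly_normal p.
move=> n_gt0; rewrite (monicP _) ?monicXnsubC // scale1r in Dp.
have rn1 : all n.-unity_root r by apply/allP=> z; rewrite -root_prod_XsubC -Dp.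
have sz_r : (n < (size r).+1)%N.
  by rewrite -(size_prod_XsubC r id) -Dp size_XnsubC.
have [|z] := hasP (has_prim_root n_gt0 rn1 _ sz_r); last by exists z.
by rewrite -separable_prod_XsubC -Dp separable_Xn_sub_1 // pnatr_eq0 -lt0n.
Qed.

Section Subspaces.
Context (k : fieldType).

Definition lin_subspace (S : lmodType k) (W : S -> Prop) : Prop :=
  W 0 /\ forall c s t, W s -> W t -> W (c *: s + t).

Lemma subspace_sum (S : lmodType k) (W : S -> Prop) (I : Type) (r : seq I) (F : I -> S) :
  lin_subspace W -> (forall i, W (F i)) -> W (\sum_(i <- r) F i).
Proof.
move=> [W0 WD] WF; elim: r => [|i r IHr]; first by rewrite big_nil.
by rewrite big_cons -[F i]scale1r; exact: WD.
Qed.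

(** Take a subspace of maximal dimension among those contained in [W]: a vector of [W] outside it
    would enlarge it. *)
Lemma subspace_vspace (V : vectType k) (W : V -> Prop) : lin_subspace W ->
  exists U : {vspace V}, forall v, v \in U <-> W v.
Proof.
move=> [W0 WD].
pose Q n := `[< exists U : {vspace V}, (forall v, v \in U -> W v) /\ \dim U = n >].
have Q0 : exists n, Q n.
  exists 0%N; apply/asboolP; exists 0%VS; rewrite dimv0; split=> // v.
  by rewrite memv0 => /eqP ->.
have Qb n : Q n -> (n <= \dim {:V})%N.
  by move=> /asboolP[U [_ <-]]; exact: dimvS (subvf U).
case: (ex_maxnP Q0 Qb) => n /asboolP[U [UW Un]] maxn.
exists U => v; split=> [/UW//|Wv]; apply: contraT => vU.
have : Q (\dim (U + <[v]>)); last first.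
  move/maxn; rewrite leqNgt -Un => /negP[].
  rewrite ltn_neqAle dimvS ?addvSl// andbT; apply: contra vU => /eqP eUv.
  have /eqP -> : U == (U + <[v]>)%VS by rewrite eqEdim addvSl eUv/=.
  by rewrite (subvP (addvSr _ _))// memv_line.
apply/asboolP; exists (U + <[v]>)%VS; split=> // w /memv_addP[u /UW Wu [v' /vlineP[c ->] ->]].
by rewrite addrC; exact: WD.
Qed.

End Subspaces.

Section Diagonalization.
Context (k : numClosedFieldType) (S : lmodType k) (I : Type) (a : I -> {linear S -> S}).
Hypothesis a_comm : forall i j s, a i (a j s) = a j (a i s).
Hypothesis a_order : forall i, exists2 m, (0 < m)%N & forall s, iter m (a i) s = s.
Context (V : vectType k) (ev : {linear S -> V}).

Definition stable (W : S -> Prop) : Prop := forall i s, W s -> W (a i s).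

Definition eigenvector (s : S) : Prop := forall i, exists c, a i s = c *: s.

(** Fourier analysis on a cyclic group of order [m]: [p j] is the component of [s] for the
    eigenvalue [z ^+ j]. *)
Lemma eigen_decomposition (i : I) m (z : k) s :
  m.-primitive_root z -> (forall s, iter m (a i) s = s) ->
  let p (j : nat) := m%:R^-1 *: \sum_(l < m) (z ^- (j * l)) *: iter l (a i) s in
  (forall j, a i (p j) = z ^+ j *: p j) /\ s = \sum_(j < m) p j.
Proof.
move=> zm am p; have m_gt0 := prim_order_gt0 zm.
have z0 : z != 0.
  by rewrite -unitfE; apply/unitrPr; exists (z ^+ m.-1); rewrite -exprS prednK// prim_expr_order.
split=> [j|].
  rewrite linearZ /= scalerA mulrC -scalerA; congr (_ *: _).
  rewrite linear_sum scaler_sumr /=.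
  pose F l := z ^+ j *: (z ^- (j * l) *: iter l (a i) s).
  transitivity (\sum_(l < m) F l.+1).
    apply: eq_bigr => l _; rewrite linearZ /F /= scalerA mulnS exprD invfM mulrA.
    by rewrite divff ?mul1r// expf_neq0.
  have F0 : \sum_(l < m.+1) F l = F 0%N + \sum_(l < m) F l.+1.
    by rewrite big_ord_recl; congr (_ + _); apply: eq_bigr.
  apply: (addrI (F 0%N)); rewrite -F0 big_ord_recr addrC; congr (_ + _).
  have zjm : z ^+ (j * m) = 1 by rewrite mulnC exprM (prim_expr_order zm) expr1n.
  by rewrite /F zjm muln0 expr0 am.
rewrite -scaler_sumr exchange_big /=.
under eq_bigr => l _ do rewrite -scaler_suml.
rewrite (bigD1 (Ordinal m_gt0)) //= [X in _ + X]big1 ?addr0 => [|l l0].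
    under eq_bigr => j _ do rewrite /= muln0 expr0 invr1.
  by rewrite sumr_const card_ord scalerA mulVf ?scale1r// pnatr_eq0 -lt0n.
rewrite (_ : \sum_(j < _) _ = 0) ?scale0r//.
have {}l0 : (0 < l)%N by rewrite lt0n; apply: contraNneq l0 => l0; apply/eqP/val_inj.
(* For l > 0 the coefficient is a geometric sum of ratio w, with w distinct from 1 and w^m = 1,
   hence zero. *)
pose w := (z ^+ l)^-1.
have w1 : w != 1.
  by rewrite invr_eq1 -(prim_order_dvd zm) gtnNdvd.
have wE j : (z ^+ (j * l))^-1 = w ^+ j by rewrite exprVn -exprM mulnC.
under eq_bigr => j _ do rewrite wE.
apply/eqP; have /eqP := subrX1 w m.
rewrite exprVn -exprM mulnC exprM (prim_expr_order zm) expr1n invr1 subrr.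
by rewrite eq_sym mulf_eq0 subr_eq0 (negbTE w1).
Qed.

(** The ambient space may be infinite dimensional and [ev] need not commute with the operators: it
    only measures the size of [W]. If some operator is not scalar on [W], each of its eigenspaces in
    [W] is stable under the others and has a strictly smaller image, since [ev] is injective on [W];
    the induction applies to each component of [s]. *)
Lemma eigenvectors_span n (W : S -> Prop) (U : {vspace V}) :
  lin_subspace W -> stable W -> (forall s, W s -> ev s = 0 -> s = 0) ->
  (forall v, v \in U <-> exists2 s, W s & ev s = v) -> (\dim U < n)%N ->
  forall s, W s -> exists r : seq S, s = \sum_(e <- r) e /\
    forall e, e \in r -> W e /\ eigenvector e.
Proof.
elim: n W U => // n IHn W U WS aW injW WU dimU s Ws; have [W0 WD] := WS.
have [scal|] := pselect (forall i, exists c, forall t, W t -> a i t = c *: t).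
  exists [:: s]; rewrite big_seq1; split=> // e; rewrite inE => /eqP ->; split=> // i.
  by have [c cE] := scal i; exists c; exact: cE.
move=> /existsNP[i /forallNP nscal].
have [m m0 am] := a_order i; have [z zm] := prim_root_exists k m0.
pose p (j : nat) := m%:R^-1 *: \sum_(l < m) (z ^- (j * l)) *: iter l (a i) s.
have [pE sE] : (forall j, a i (p j) = z ^+ j *: p j) /\ s = \sum_(j < m) p j
  := eigen_decomposition s zm am.
have Wp j : W (p j).
  rewrite -[p j]addr0; apply: (WD _ _ _ _ W0); apply: subspace_sum => // l.
  rewrite -[_ *: _]addr0; apply: (WD _ _ _ _ W0).
  by elim: (nat_of_ord l) => // l' /(aW i).
pose Wj j t := W t /\ a i t = z ^+ j *: t.
have WjS j : lin_subspace (Wj j).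
  split=> [|c t t' [Wt at_] [Wt' at']]; first by split=> //; rewrite linear0 scaler0.
  split; first exact: WD.
  by rewrite linearP at_ at' scalerDr !scalerA mulrC.
have evS j : lin_subspace (fun v => exists2 t, Wj j t & ev t = v).
  have [Wj0 WjD] := WjS j.
  split=> [|c v v' [t Wt <-] [t' Wt' <-]]; first by exists 0; rewrite ?linear0.
  by exists (c *: t + t'); [exact: WjD | rewrite linearP].
have dec (j : 'I_m) : exists r : seq S, p j = \sum_(e <- r) e /\
    forall e, e \in r -> W e /\ eigenvector e.
  have [Uj UjE] := subspace_vspace (evS j).
  have sUj : (Uj <= U)%VS.
    by apply/subvP => v /UjE[t [Wt _] <-]; apply/WU; exists t.
  have [|||r [rE rW]] := IHn (Wj j) Uj (WjS j) _ _ UjE _ (p j) (conj (Wp j) (pE j)).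
  - by move=> i' t [Wt ti]; split; [exact: aW | rewrite a_comm ti linearZ].
  - by move=> t [Wt _]; exact: injW.
  - apply: (leq_trans _ (dimU : (\dim U <= n)%N)); rewrite ltn_neqAle dimvS// andbT.
    apply/eqP => eqd; apply: (nscal (z ^+ j)) => t Wt.
    have /eqP eU : Uj == U by rewrite eqEdim sUj eqd leqnn.
    have : ev t \in Uj by rewrite eU; apply/WU; exists t.
    move=> /UjE[t' [Wt' t'E] ett'].
    have /eqP : - 1 *: t + t' = 0.
      by apply: injW; [exact: WD | rewrite linearP ett' scaleN1r addNr].
    by rewrite scaleN1r addrC subr_eq0 => /eqP <-.
  by exists r; split=> // e /rW[[We _] ee].
have [r rE] := choice dec.
exists (flatten [seq r j | j <- enum 'I_m]); split.
  rewrite big_flatten big_map big_enum sE; apply: eq_bigr => j _.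
  by have [] := rE j.
by move=> e /flatten_mapP[j _]; have [_] := rE j; exact.
Qed.

End Diagonalization.

(** * Free generators of the sections of all twists *)

Section Greedy.
Context (k : closedFieldType) (X : swfType k) (A B : k -> X).
Hypothesis hP : is_P1 A B.
Local Notation oo := (B 0).
Context (E : vectorBundle X) (good : bsect E -> Prop).
Local Notation twisted := (twisted A B (@sreg k X E)).
Local Notation hform := (hform A B).
(** This is how the spanning of H_d by good sections is used: a subspace that misses some element of
    H_d misses a good one. *)
Hypothesis good_ex : forall d (N : bsect E -> Prop), lin_subspace N ->
  forall s, twisted d s -> ~ N s -> exists e, [/\ twisted d e, good e & ~ N e].
Implicit Types (s t : bsect E) (es : seq (bsect E * int)).

Let hR := sreg_regularity E.

Lemma hform_linear m c f g : hform m f -> hform m g ->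
  hform m (fun x => c * f x + g x).
Proof.
move=> [fA foo] [gA goo]; split=> [u|].
  by apply: regular_atD (regular_atM (regular_at_cst c _) (fA u)) (gA u).
apply: near_eq_regular_at (regular_atD (regular_atM (regular_at_cst c _) foo) goo).
by apply: nearW => y; rewrite mulrDr mulrCA.
Qed.

Lemma hform0 m : hform m (fun=> 0).
Proof.
split=> [u|]; first exact: regular_at_cst.
by under eq_fun do rewrite mulr0; exact: regular_at_cst.
Qed.

(* The sections of E(d) generated by the sections e of E(d'), (e, d') in es. *)
Fixpoint comb (d : int) es s : Prop :=
  if es is ed :: es' then
    exists2 f, hform (d - ed.2) f & comb d es' (s - fmul f ed.1)
  else s = 0.

Lemma comb_subspace d es : lin_subspace (comb d es).
Proof.
elim: es => [|[e d'] es [IH0 IHD]] /=.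
  by split=> // c s t -> ->; rewrite scaler0 addr0.
split=> [|c s t [f hf sf] [g hg tg]].
  exists (fun=> 0); first exact: hform0.
  rewrite (_ : 0 - _ = 0)//; apply: dsectP => x.
  by rewrite dsectDE dsectNE /fmul scale0r subr0.
exists (fun x => c * f x + g x); first exact: hform_linear.
rewrite (_ : _ - _ = c *: (s - fmul f e) + (t - fmul g e)); first exact: IHD.
apply: dsectP => x; rewrite !(dsectDE, dsectNE, dsectZE) /fmul.
by rewrite scalerBr scalerDl scalerA opprD addrACA.
Qed.

Lemma comb_linform d es s x : comb d es s -> comb (d + 1) es (fmul (linform A B x) s).
Proof.
elim: es s => [|[e d'] es IH] s /=.
  by move=> ->; apply: dsectP => y; rewrite /fmul scaler0.
move=> [f hf /IH sf]; exists (fun y => linform A B x y * f y).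
  by rewrite addrAC addrC; apply: (form_mul hP) => //; exact: form_linform.
rewrite (_ : _ - _ = fmul (linform A B x) (s - fmul f e))//.
apply: dsectP => y; rewrite !(dsectDE, dsectNE) /fmul !(dsectDE, dsectNE).
by rewrite scalerBr scalerA.
Qed.

Lemma comb_twisted d es s : (forall ed, ed \in es -> twisted ed.2 ed.1) ->
  comb d es s -> twisted d s.
Proof.
elim: es s => [|[e d'] es IH] s /= tes.
  move=> ->; split=> [u|]; first exact: sreg0.
  rewrite (_ : fmul _ _ = 0); first exact: sreg0.
  by apply: dsectP => x; rewrite /fmul scaler0.
move=> [f hf sf]; rewrite -(subrK (fmul f e) s); apply: (twistedD hR).
  by apply: IH sf => ed edes; apply: tes; rewrite inE edes orbT.
rewrite -[d](subrK d'); apply: (twisted_form hP hR hf).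
exact: tes (mem_head _ _).
Qed.

Lemma comb_weaken d ed es s : comb d es s -> comb d (ed :: es) s.
Proof.
move=> sE; exists (fun=> 0); first exact: hform0.
by rewrite (_ : s - _ = s)//; apply: dsectP => x; rewrite dsectDE dsectNE /fmul scale0r subr0.
Qed.

Definition values es x : seq (fiber E x) := [seq ed.1 x | ed <- es].

(** For each generator of degree d' at most [d] there is a form of degree d - d' with value 1 at
    [x]. Hence the monotonicity of the degrees in [admissible]. *)
Lemma comb_ex d es x v : all (fun ed => ed.2 <= d) es -> v \in <<values es x>>%VS ->
  exists2 s, comb d es s & s x = v.
Proof.
elim: es v => [|[e d'] es IH] v /=.
  by rewrite span_nil memv0 => _ /eqP ->; exists 0.
move=> /andP[d'd /IH{}IH]; rewrite span_cons => /memv_addP[_ /vlineP[c ->] [w /IH[s sE <-] ->]].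
have [q [hq qx]] : exists q, hform (d - d') q /\ q x = 1.
  have -> : d - d' = (absz (d - d')%R)%:Z by rewrite gez0_abs ?subr_ge0.
  exact: form_eq1.
exists (fmul (fun y => c * q y + 0) e + s); last first.
  by rewrite dsectDE /fmul qx addr0 mulr1.
exists (fun y => c * q y + 0); last by rewrite addrC addKr.
exact: hform_linear hq (hform0 _).
Qed.

Lemma comb_value d es s x : comb d es s -> s x \in <<values es x>>%VS.
Proof.
elim: es s => [|[e d'] es IH] s /=; first by move=> ->; exact: mem0v.
move=> [f _ /IH sf]; rewrite span_cons -(subrK (f x *: e x) (s x)) addrC.
by rewrite memv_add// memvZ// memv_line.
Qed.

(** The latest section is at the head of the list. The fourth clause expresses the minimality of its
    degree: in lower degrees the earlier sections already generate everything. *)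
Fixpoint admissible es : Prop :=
  if es is ed :: es' then
    [/\ admissible es', twisted ed.2 ed.1 /\ good ed.1, ~ comb ed.2 es' ed.1,
        forall d s, d < ed.2 -> twisted d s -> comb d es' s &
        all (fun ed' => ed'.2 <= ed.2) es']
  else True.

Lemma admissible_in es ed : admissible es -> ed \in es -> twisted ed.2 ed.1 /\ good ed.1.
Proof.
elim: es => // ed' es IH /= [aes te _ _ _]; rewrite inE => /orP[/eqP -> //|].
exact: IH.
Qed.

(* A linear relation between the values at x would be the value at x of a
   section divisible by a linear form, hence of lower degree. *)
Lemma admissible_free es x : admissible es -> free (values es x).
Proof.
elim: es => [|[e d] es IH] /=; first by rewrite nil_free.
move=> [aes [te _] ncomb low ed]; rewrite free_cons IH// andbT.
apply/negP => /(comb_ex ed)[s sE sx].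
have ts : twisted d s.
  by apply: comb_twisted sE => ed' /(admissible_in aes)[].
have tes : twisted d (e - s) by apply: (twistedD hR) te _; exact: (twistedN hP hR).
have [|s' ts' esE] := twisted_sreg_divide hP tes (x := x).
  by rewrite dsectDE dsectNE sx subrr.
apply: ncomb; rewrite -(subrK s e) esE -[fmul _ _]scale1r.
apply: (comb_subspace d es).2 => //; rewrite -[d](subrK 1).
by apply: comb_linform; apply: low ts'; rewrite ltrBlDr ltrDl.
Qed.

Lemma admissible_bound es d s : admissible es -> twisted d s -> ~ comb d es s ->
  all (fun ed => ed.2 <= d) es.
Proof.
case: es => //= -[e d'] es [aes _ _ low] /= ales ts ns.
have d'd : d' <= d.
  rewrite leNgt; apply/negP => dd'; apply: ns.
  exact: (@comb_weaken d (e, d') es s (low _ _ dd' ts)).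
by rewrite d'd; apply: sub_all ales => ed /le_trans; exact.
Qed.

Lemma admissible_extend es d s : admissible es -> twisted d s -> ~ comb d es s ->
  exists ed, admissible (ed :: es).
Proof.
move=> aes ts ns; have [D [n emb]] := twisted_embedding hP E.
have zero d' t : d' < - D%:Z -> twisted d' t -> t = 0.
  move=> d'D tt; have [|ev evP] := emb d' 0%N; first by rewrite -ltrBrDl sub0r.
  by apply: evP tt _; exact: flatmx0.
(* Degrees are shifted by [D] to become natural numbers, since nothing lives below [- D]; this is
   what gives a least degree. *)
pose Q j := `[< exists2 t, twisted (j%:Z - D%:Z) t & ~ comb (j%:Z - D%:Z) es t >].
have QP d' t : twisted d' t -> ~ comb d' es t -> exists2 j, d' = j%:Z - D%:Z & Q j.
  move=> tt nt; have d'D : - D%:Z <= d'.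
    rewrite leNgt; apply/negP => /zero/(_ tt) t0.
    by apply: nt; rewrite t0; exact: (comb_subspace d' es).1.
  have d'E : d' = (absz (d' + D%:Z)%R)%:Z - D%:Z by rewrite gez0_abs; lia.
  by exists (absz (d' + D%:Z)%R) => //; apply/asboolP; exists t; rewrite -d'E.
have Q0 : exists j, Q j by have [j _ Qj] := QP _ _ ts ns; exists j.
case: (ex_minnP Q0) => j /asboolP[t tt nt] jmin.
have [e [te ge ne]] := good_ex (comb_subspace _ es) tt nt.
exists (e, j%:Z - D%:Z) => /=; split=> //; last exact: admissible_bound te ne.
move=> d' s' d'j ts'; apply: contrapT => /(QP _ _ ts')[i d'E /jmin].
by move: d'j; rewrite d'E; lia.
Qed.

Lemma admissible_basis : exists es : seq (bsect E * int),
  (forall ed, ed \in es -> twisted ed.2 ed.1 /\ good ed.1) /\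
  forall x, basis_of {:fiber E x} (values es x).
Proof.
have [[es [aes full]]|nfull] := pselect (exists es, admissible es /\
    forall d s, twisted d s -> comb d es s).
  exists es; split=> [ed|x]; first exact: admissible_in.
  rewrite /basis_of admissible_free// andbT eqEsubv subvf /=.
  apply/subvP => v _; have [d [s [ts <-]]] := globally_generated hP v.
  exact: comb_value (full d s ts).
have ext n : exists2 es, admissible es & size es = n.
  elim: n => [|n [es aes sn]]; first by exists [::].
  have [d [s [ts ns]]] : exists d s, twisted d s /\ ~ comb d es s.
    apply: contrapT => nds; apply: nfull; exists es; split=> // d s ts.
    by apply: contrapT => ns; apply: nds; exists d, s.
  by have [ed aed] := admissible_extend aes ts ns; exists (ed :: es) => //=; rewrite sn.
have [es /(admissible_free oo)] := ext (\dim {:fiber E oo}).+1.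
rewrite /free size_map => /eqP <- sE.
by have := dimvS (subvf <<values es oo>>%VS); rewrite sE ltnn.
Qed.

End Greedy.

(** * Tori *)

(** A primitive root of unity of order [size p] has [size p] distinct powers, more than [p] has
    roots. *)
Lemma root_of_unity_nonroot (k : numClosedFieldType) (p : {poly k}) : p != 0 ->
  exists z m, [/\ (0 < m)%N, z ^+ m = 1 & p.[z] != 0].
Proof.
move=> p0; have m0 : (0 < size p)%N by rewrite size_poly_gt0.
have [z zm] := prim_root_exists k m0.
have [allz|] := boolP (all (root p) [seq z ^+ i | i <- iota 0 (size p)]).
  suff : (size p < size p)%N by rewrite ltnn.
  rewrite -[X in (X < _)%N](size_iota 0) -(size_map (fun i => z ^+ i)).
  apply: max_poly_roots => //; rewrite map_inj_in_uniq ?iota_uniq// => i j.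
  rewrite !mem_iota !add0n => /andP[_ im] /andP[_ jm] /eqP.
  by rewrite (eq_prim_root_expr zm) !modn_small// => /eqP.
move=> /allPn[_ /mapP[i _ ->] zi]; exists (z ^+ i), (size p); split=> //.
by rewrite -exprM mulnC exprM (prim_expr_order zm) expr1n.
Qed.

(** The coordinates are replaced by roots of unity one at a time; each replacement concerns a
    nonzero polynomial in one variable. *)
Lemma nonzero_at_roots_of_unity (k : numClosedFieldType) r (h : mpoly.mpoly r k)
    (v : 'rV[k]_r) : polyval h v != 0 -> (forall i, v 0 i != 0) ->
  exists w : 'rV[k]_r, polyval h w != 0 /\
    forall i, exists2 m, (0 < m)%N & w 0 i ^+ m = 1.
Proof.
move=> hv v0.
have step j : (j <= r)%N -> exists w : 'rV[k]_r, [/\ polyval h w != 0,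
    forall i, w 0 i != 0 &
    forall i : 'I_r, (i < j)%N -> exists2 m, (0 < m)%N & w 0 i ^+ m = 1]; last first.
  by have [w [hw _ wr]] := step r (leqnn r); exists w; split=> // i; exact: wr.
elim: j => [|j IHj] jr; first by exists v.
have [w [hw w0 wr]] := IHj (ltnW jr); pose j' := Ordinal jr.
pose upd x : 'rV[k]_r := \row_i if i == j' then x else w 0 i.
have [p pE] : exists p : {poly k}, forall x, p.[x] = polyval h (upd x).
  exists (\sum_(m <- mpoly.msupp h) (mpoly.mcoeff m h)%:P *
    \prod_i (if i == j' then 'X else (w 0 i)%:P) ^+ (m i)) => x.
  rewrite /polyval mpoly.mevalE horner_sum; apply: eq_bigr => m _.
  rewrite hornerM hornerC horner_prod; congr (_ * _); apply: eq_bigr => i _.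
  by rewrite horner_exp mxE; case: eqP => _; rewrite ?hornerX ?hornerC.
have updw : upd (w 0 j') = w by apply/rowP => i; rewrite mxE; case: eqP => [->|].
have p0 : p != 0 by apply: (@horner_neq0 _ _ (w 0 j')); rewrite pE updw.
have [z [m [m0 zm pz]]] := root_of_unity_nonroot p0.
have z0 : z != 0.
  by apply: contraNneq (oner_neq0 k) => z0; rewrite -zm z0 expr0n gtn_eqF.
exists (upd z); rewrite -pE; split=> // i; rewrite mxE.
  by case: (i == j').
case: (eqVneq i j') => [_ _|ij]; first by exists m.
rewrite ltnS leq_eqVlt => /orP[/eqP ij'|]; last exact: wr.
by case/eqP: ij; apply/val_inj.
Qed.

Section Torus.
Context (k : numClosedFieldType) (T : algGroupType k).
Hypothesis hT : is_torus T.

Lemma torus_commute (s t : T) : (s * t = t * s)%g.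
Proof.
have [r [chi [psi [_ [chiK _] chiM _ _]]]] := hT.
apply: (can_inj chiK); apply/rowP => i; rewrite !chiM; exact: mulrC.
Qed.

Definition torsion (t : T) : Prop := exists2 m, (0 < m)%N & (t ^+ m = 1)%g.

Let chi1 r (chi : T -> affine k r) (chi0 : forall t i, chi t 0 i != 0)
  (chiM : forall s t i, chi (s * t)%g 0 i = chi s 0 i * chi t 0 i) i : chi 1%g 0 i = 1.
Proof.
by apply: (mulfI (chi0 1%g i)); rewrite -chiM mulg1 mulr1.
Qed.

Let chiX r (chi : T -> affine k r) (chi0 : forall t i, chi t 0 i != 0)
  (chiM : forall s t i, chi (s * t)%g 0 i = chi s 0 i * chi t 0 i) t n i :
  chi (t ^+ n)%g 0 i = chi t 0 i ^+ n.
Proof.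
elim: n => [|n IHn]; first by rewrite expg0 expr0 (chi1 chi0).
by rewrite expgS exprS chiM IHn.
Qed.

Lemma torus_root (t : T) n : (0 < n)%N -> exists s : T, (s ^+ n = t)%g.
Proof.
have [r [chi [psi [chi0 [chiK psiK] chiM _ _]]]] := hT; move=> n0.
pose v : affine k r := \row_i n.-root (chi t 0 i).
have v0 i : v 0 i != 0 by rewrite mxE rootC_eq0//; exact: chi0.
exists (psi v); apply: (can_inj chiK); apply/rowP => i.
by rewrite (chiX chi0 chiM) psiK// mxE rootCK.
Qed.

Lemma torsion_dense (t : T) (P : set T) : nbhs t P -> exists2 s, torsion s & P s.
Proof.
have [r [chi [psi [chi0 [chiK psiK] chiM _ mpsi]]]] := hT; move=> nP.
have [cpsi _] := mpsi _ (chi0 t).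
have : nbhs (chi t) (psi @^-1` P) by apply: cpsi; rewrite chiK.
move=> [h [ht hP]]; have [w [hw wr]] := nonzero_at_roots_of_unity ht (chi0 t).
have w0 i : w 0 i != 0.
  have [m m0 wm] := wr i; apply: contraNneq (oner_neq0 k) => wi0.
  by rewrite -wm wi0 expr0n gtn_eqF.
exists (psi w); last exact: hP.
have [m mE] := choice (fun i => let: ex_intro2 m a b := wr i in ex_intro _ m (conj a b)).
exists (\prod_i m i)%N; first by rewrite prodn_gt0// => i; have [] := mE i.
apply: (can_inj chiK); apply/rowP => i; rewrite (chiX chi0 chiM) psiK//.
rewrite (chi1 chi0 chiM); have [_ wi] := mE i.
by rewrite (bigD1 i)//= exprM wi expr1n.
Qed.

End Torus.

(** * A fixed point of the torus *)

Section SelfMaps.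
Context (k : closedFieldType) (X : swfType k) (A B : k -> X).
Hypothesis hP : is_P1 A B.
Local Notation oo := (B 0).
Context (phi : X -> X) (mphi : morphism phi) (phi_inj : injective phi).

(* The point with homogeneous coordinates [p : q]. *)
Definition hpoint (p q : k) : X := if q == 0 then oo else A (p / q).

Lemma hpointB p q : p != 0 -> hpoint p q = B (q / p).
Proof.
move=> p0; rewrite /hpoint; have [->|q0] := eqVneq q 0; first by rewrite mul0r.
by rewrite (P1_flop hP) ?mulf_neq0 ?invr_eq0// invf_div.
Qed.

Lemma hpoint_eq p q p' q' : (p != 0) || (q != 0) -> (p' != 0) || (q' != 0) ->
  hpoint p q = hpoint p' q' <-> p * q' = p' * q.
Proof.
rewrite /hpoint; have [->|q0] := eqVneq q 0; have [->|q'0] := eqVneq q' 0.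
- by rewrite !mulr0.
- rewrite orbF => p0 _; split=> [/esym/(P1_infty hP)//|/eqP].
  by rewrite mulr0 mulf_eq0 (negbTE p0) (negbTE q'0).
- rewrite orbF => _ p0; split=> [/(P1_infty hP)//|/esym/eqP].
  by rewrite mulr0 mulf_eq0 (negbTE p0) (negbTE q0).
move=> _ _; split=> [/(chart_inj (P1_chartA hP))/eqP|e].
  by rewrite eqr_div// => /eqP.
by congr A; apply/eqP; rewrite eqr_div//; apply/eqP.
Qed.

(** The fraction a/h comes from pulling back the coordinate z or 1/z, according to whether the image
    of the point is finite or not; in the second case numerator and denominator are exchanged. *)
Lemma map_rep (C : k -> X) (hC : open_chart C) u : exists a h g : {poly k},
  g.[u] != 0 /\ forall v, g.[v] != 0 ->
    ((a.[v] != 0) || (h.[v] != 0)) /\ phi (C v) = hpoint a.[v] h.[v].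
Proof.
have [cphi rphi] := mphi (C u).
have [[w wE]|uoo] := P1_cover hP (phi (C u)).
  have := regular_zcoord hP w; rewrite -wE => /rphi/(chart_regular hC)[a [h [hu fE]]].
  have : nbhs (phi (C u)) [set y | y <> oo] by rewrite wE; exact: near_A.
  move=> /cphi /(chart_nbhs hC)[g [gu gE]].
  exists a, h, (g * h); rewrite hornerM mulf_neq0//; split=> // v.
  rewrite hornerM mulf_eq0 negb_or => /andP[/gE/= voo hv]; rewrite hv orbT; split=> //.
  by rewrite /hpoint (negbTE hv) -fE// (zcoordK hP voo).
have := regular_wcoord hP 0; rewrite -uoo => /rphi/(chart_regular hC)[a [h [hu fE]]].
have : nbhs (phi (C u)) [set y | y <> A 0].
  rewrite uoo; apply: filterS (generic_near hP oo (generically_neqA hP 0)) => y.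
  by case=> [-> /esym/(P1_infty hP)|//].
move=> /cphi /(chart_nbhs hC)[g [gu gE]].
exists h, a, (g * h); rewrite hornerM mulf_neq0//; split=> // v.
rewrite hornerM mulf_eq0 negb_or => /andP[/gE/= v0 hv]; rewrite hv; split=> //.
rewrite hpointB// -fE//= .
have [[w wE]|->] := P1_cover hP (phi (C v)); last by rewrite (zcoord_oo hP) invr0.
rewrite wE (zcoordA hP) (P1_flip hP) ?invrK// invr_eq0.
by apply: contra_not_neq v0 => w0; rewrite wE w0.
Qed.

(** The reduced fraction found near one point is compared with the local formula at any other point.
    The two agree generically, and coprimality extends the agreement to every point. *)
Lemma map_rational : exists P Q : {poly k}, coprimep P Q /\
  forall v, phi (A v) = hpoint P.[v] Q.[v].
Proof.
have [a [h [g [g0 gE]]]] := map_rep (P1_chartA hP) 0.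
pose d := gcdp a h.
have d0 : d != 0.
  rewrite gcdp_eq0; have [+ _] := gE 0 g0; apply: contraL => /andP[/eqP -> /eqP ->].
  by rewrite horner0 eqxx.
have ah0 : (a != 0) || (h != 0) by rewrite -negb_and -gcdp_eq0.
exists (a %/ d), (h %/ d); split; first exact: coprimep_div_gcd.
set P := a %/ d; set Q := h %/ d.
have aE : a = P * d by rewrite /P divpK ?dvdp_gcdl.
have hE : h = Q * d by rewrite /Q divpK ?dvdp_gcdr.
have /Bezout_coprimepP[[b c] /= bc] : coprimep P Q by exact: coprimep_div_gcd.
have [r r0 bcE] : exists2 r, r != 0 & b * P + c * Q = r%:P.
  by apply/size_poly1P; rewrite (eqp_size bc) size_poly1.
move=> v; have [a' [h' [g' [g'0 gE']]]] := map_rep (P1_chartA hP) v.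
have cross : a' * Q = P * h'.
  apply: (@poly_eq_generic _ (g * g' * d)) => [|w].
    by rewrite !mulf_neq0// ?(horner_neq0 g0)// (horner_neq0 g'0).
  rewrite !hornerM !mulf_eq0 !negb_or => /andP[/andP[gw g'w] dw].
  have [ne e] := gE w gw; have [ne' e'] := gE' w g'w.
  have /(hpoint_eq ne' ne) := etrans (esym e') e.
  rewrite aE hE !hornerM => ee.
  by apply: (mulIf dw); rewrite -mulrA ee; ring.
(* By the Bezout relation and the cross product identity, the local formula is [m] times the reduced
   one; since its two entries do not both vanish at [v], neither does [m]. *)
pose m := r^-1 *: (b * a' + c * h').
have rm : forall p : {poly k}, p = r^-1 *: (r%:P * p).
  by move=> p; rewrite mul_polyC scalerA mulVf ?scale1r.
have a'E : a' = m * P.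
  rewrite [LHS]rm -bcE /m -scalerAl; congr (_ *: _).
  by rewrite mulrDl mulrDl -(mulrA c Q) [Q * a']mulrC cross; ring.
have h'E : h' = m * Q.
  rewrite [LHS]rm -bcE /m -scalerAl; congr (_ *: _).
  by rewrite mulrDl mulrDl -(mulrA b P) -cross; ring.
have [ne ->] := gE' v g'0; move: ne; rewrite a'E h'E !hornerM !mulf_eq0 !negb_or => ne.
have mv : m.[v] != 0 by case/orP: ne => /andP[].
rewrite mv /= in ne; have ne2 : (m.[v] * P.[v] != 0) || (m.[v] * Q.[v] != 0).
  by rewrite !mulf_eq0 (negbTE mv).
by apply/(hpoint_eq ne2 ne); ring.
Qed.

(* phi is z |-> P/Q; its fixed points on the affine line are the zeros of
   zQ - P, and it fixes infinity if this polynomial is a nonzero constant. *)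
Lemma fixed_points_finite : ~ (forall x, phi x = x) ->
  exists fs : seq X, fs != [::] /\ forall x, phi x = x <-> x \in fs.
Proof.
move=> nid; have [P [Q [PQ phiE]]] := map_rational.
have ne v : (P.[v] != 0) || (Q.[v] != 0).
  rewrite -negb_and; apply/negP => /andP[/eqP Pv Qv].
  by have := coprimep_root PQ (introT rootP Pv); rewrite Qv.
have fixE v : phi (A v) = A v <-> ('X * Q - P).[v] = 0.
  have -> : A v = hpoint v 1 by rewrite /hpoint oner_eq0 divr1.
  rewrite {1}/hpoint oner_eq0 divr1 phiE hpoint_eq ?oner_eq0 ?orbT// mulr1 !hornerE.
  by split=> [->|/eqP]; rewrite ?subrr// subr_eq0 => /eqP.
have [F0|F0] := eqVneq ('X * Q - P) 0.
  exfalso; apply: nid => x; have idA v : phi (A v) = A v by apply/fixE; rewrite F0 horner0.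
  have [[v ->]//|->] := P1_cover hP x.
  (* If the image of infinity were a finite point, this point, being fixed, would have two
     preimages. *)
  have [[v vE]|//] := P1_cover hP (phi oo).
  by move: vE; rewrite -{1}(idA v) => /phi_inj/esym/(P1_infty hP).
have [us usE] := poly_zeros F0.
have memE x : phi x = x <->
    x \in [seq y <- oo :: [seq A u | u <- us] | phi y == y].
  rewrite mem_filter; split=> [xx|/andP[/eqP//]]; rewrite xx eqxx /= inE.
  have [[v xE]|->] := P1_cover hP x; last by rewrite eqxx.
  by rewrite xE in xx *; apply/orP; right; apply/map_f/usE/fixE.
exists [seq y <- oo :: [seq A u | u <- us] | phi y == y]; split=> //.
suff [x /memE xin] : exists x, phi x = x by apply: contraTneq xin => ->.
have [/size_poly1P[c c0 FE]|] := boolP (size ('X * Q - P) == 1); last first.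
  by move=> /closed_rootP[v /eqP Fv]; exists (A v); apply/fixE.
exists oo; have PE : P = 'X * Q - c%:P by rewrite -FE opprB addrC subrK.
have [a [h [g [g0 gE]]]] := map_rep (P1_chartB hP) 0.
have [ne0 ->] := gE 0 g0.
suff -> : h.[0] = 0 by rewrite /hpoint eqxx.
pose n := (size Q).-1; have [q [q0 qE]] := reverse_poly (leqSpred (size Q)).
(* In the coordinate v = 1/z, equate the local formula [a : h] with [P : Q], where P = zQ - c, and
   multiply by v^(n+1). At v = 0 this reads q(0) h(0) = 0, where q(0) is the leading coefficient of
   [Q]. *)
have e : (q - c *: 'X^(n.+1)) * h = a * 'X * q.
  apply: (@poly_eq_generic _ (g * 'X)) => [|v].
    by rewrite mulf_neq0 ?polyX_eq0// (horner_neq0 g0).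
  rewrite hornerM hornerX mulf_eq0 negb_or => /andP[gv v0].
  have [nev] := gE v gv; rewrite (P1_flip hP v0) phiE hpoint_eq// PE.
  rewrite !(hornerM, hornerD, hornerN, hornerC, hornerX, hornerZ, hornerXn) qE// => e.
  have -> : a.[v] * v * (v ^+ (size Q).-1 * Q.[v^-1]) =
    v * v ^+ n * (a.[v] * Q.[v^-1]) by rewrite -/n; ring.
  by rewrite -e exprS -/n; field.
have := congr1 (fun p : {poly k} => p.[0]) e.
rewrite !(hornerM, hornerD, hornerN, hornerC, hornerX, hornerZ, hornerXn) expr0n /=.
rewrite !mulr0 mul0r subr0 q0 -lead_coefE => /eqP; rewrite mulf_eq0 => /orP[|/eqP//].
(* In the degenerate case Q = 0, the same identity forces h = 0. *)
rewrite lead_coef_eq0 => /eqP Q0; move: e.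
have -> : q = 0.
  apply: (@poly_eq_generic _ 'X) => [|v]; first by rewrite polyX_eq0.
  by rewrite hornerX => v0; rewrite qE// Q0 !horner0 mulr0.
rewrite mulr0 sub0r => /eqP; rewrite mulf_eq0 oppr_eq0 scaler_eq0 (negbTE c0).
by rewrite expf_eq0 polyX_eq0 andbF => /eqP ->; rewrite horner0.
Qed.

End SelfMaps.

Section Actions.
Context (k : fieldType) (X : swfType k) (T : algGroupType k) (a : algAction T X).

Lemma action1 x : a 1%g x = x. Proof. by case: (action_algebraic a). Qed.

Lemma actionM s t x : a (s * t)%g x = a s (a t x).
Proof. by case: (action_algebraic a). Qed.

Lemma actionK t : cancel (a t) (a t^-1%g).
Proof. by move=> x; rewrite -actionM mulVg action1. Qed.

Lemma actionKV t : cancel (a t^-1%g) (a t).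
Proof. by move=> x; rewrite -actionM mulgV action1. Qed.

Lemma morphism_at_cst (Y Z : swfType k) (z : Z) (y : Y) :
  morphism_at (fun=> z) y.
Proof.
split=> [|f fz]; first exact: cst_continuous.
by rewrite (_ : f \o _ = fun=> f z)//; exact: regular_at_cst.
Qed.

Lemma action_morphism t : morphism (a t).
Proof.
move=> x; have [_ _ ma] := action_algebraic a.
have mp : morphism_at (fun y => (t, y) : zprod (T : swfType k) X) x.
  by apply: morphism_at_pair; [exact: morphism_at_cst | exact: morphism_at_id].
exact: morphism_at_comp mp (ma _).
Qed.

Lemma actionX t n x : a (t ^+ n)%g x = iter n (a t) x.
Proof.
elim: n => [|n IHn] /=; first by rewrite expg0 action1.
by rewrite expgS actionM IHn.
Qed.

End Actions.

Section FixedPoint.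
Context (k : numClosedFieldType) (X : swfType k) (A B : k -> X).
Hypothesis hP : is_P1 A B.
Context (T : algGroupType k) (hT : is_torus T) (a : algAction T X).

(* The fixed points of a t that does not act trivially are permuted by the
   divisible group T, and a divisible group acts trivially on a finite set. *)
Lemma torus_fixed_point : exists q, forall t, a t q = q.
Proof.
have [triv|] := pselect (forall t x, a t x = x); first by exists (B 0).
move=> /existsNP[t0 nt0].
have [fs [fs0 fsE]] := fixed_points_finite hP (action_morphism a t0)
  (can_inj (actionK a t0)) nt0.
case: fs fs0 fsE => // q fs _ fsE; exists q => s.
(* With n fixed points, the orbit of [q] under [r] returns to [q] after some d between 1 and n.
   Since d divides n!, a root of order n! is taken. *)
have [r <-] := torus_root hT s (fact_gt0 (size (q :: fs))).
have stab i : a t0 (iter i (a r) q) = iter i (a r) q.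
  elim: i => [|i IHi] /=; first by apply/fsE; rewrite mem_head.
  by rewrite -actionM (torus_commute hT) actionM IHi.
pose orb i := iter i (a r) q.
have inj_iter i x y : iter i (a r) x = iter i (a r) y -> x = y.
  by elim: i => //= i IHi /(can_inj (actionK a r))/IHi.
have [d] : exists d, [/\ (0 < d)%N, (d <= size (q :: fs))%N & orb d = q].
  apply: contrapT => nd.
  have : (size [seq orb i | i <- iota 0 (size (q :: fs)).+1] <= size (q :: fs))%N.
    apply: uniq_leq_size; last by move=> _ /mapP[i _ ->]; apply/fsE; exact: stab.
    rewrite map_inj_in_uniq ?iota_uniq// => i j; rewrite !mem_iota !add0n !ltnS.
    wlog ij : i j / (i <= j)%N => [hw im jm e|].
      by case: (leqP i j) => [/hw|/ltnW/hw] H; [apply: H | apply/esym/H].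
    move=> /andP[_ im] /andP[_ jm] e; apply/eqP; rewrite eqn_leq ij /= leqNgt.
    apply/negP => ltij; apply: nd; exists (j - i)%N; split.
    - by rewrite subn_gt0.
    - exact: leq_trans (leq_subr _ _) jm.
    - by apply: (inj_iter i); rewrite /orb -iterD subnKC ?e//.
  by rewrite size_map size_iota ltnn.
move=> [d0 dn dq]; have /dvdnP[m ->] := dvdn_fact (introT andP (conj d0 dn)).
rewrite actionX mulnC; elim: m => [|m IHm]; first by rewrite muln0.
by rewrite mulnS addnC iterD -/(orb d) dq.
Qed.

End FixedPoint.

(** * The torus action on sections *)

Section ActionOnSections.
Context (k : fieldType) (X : swfType k) (T : algGroupType k).
Context (a : algAction T X) (E : eqvBundle a).
Implicit Types (s : bsect E) (t : T).

(** The action of t sends the fiber at t^-1 x to the fiber at t (t^-1 x), which is a different type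
    from the fiber at x. Identities are checked in the total space, where the transport
    disappears. *)
Definition castv x y (xy : x = y) (v : fiber E x) : fiber E y :=
  eq_rect x (fiber E) v y xy.

Lemma point_castv x y (xy : x = y) v : point (castv xy v) = point v :> total E.
Proof. by case: _ / xy. Qed.

Lemma castv_linear x y (xy : x = y) : linear (castv xy).
Proof. by case: _ / xy. Qed.

Lemma castvZ x y (xy : x = y) c v : castv xy (c *: v) = c *: castv xy v.
Proof. by case: _ / xy. Qed.

Definition sect_act t s : bsect E :=
  fun x => castv (actionKV a t x) (act E t (a t^-1%g x) (s (a t^-1%g x))).

Lemma sect_act_linear t : linear (sect_act t).
Proof.
move=> c s s'; apply: dsectP => x.
by rewrite /sect_act dsectDE dsectZE linearP castv_linear.
Qed.

HB.instance Definition _ t :=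
  GRing.isLinear.Build k (bsect E) (bsect E) *:%R (sect_act t) (sect_act_linear t).

Lemma point_sect_act t s x :
  point (sect_act t s x) = total_act t (point (s (a t^-1%g x)) : total E).
Proof. by rewrite /sect_act point_castv. Qed.

Lemma sect_actE t s x : point (sect_act t s (a t x)) = point (act E t x (s x)) :> total E.
Proof. by rewrite point_sect_act actionK. Qed.

Lemma sect_act1 s : sect_act 1%g s = s.
Proof.
apply: dsectP => x; apply: point_inj; rewrite point_sect_act.
have [a1 _ _] := act_algebraic E; rewrite /total_act a1.
by rewrite invg1 action1.
Qed.

Lemma sect_actM t t' s : sect_act (t * t')%g s = sect_act t (sect_act t' s).
Proof.
apply: dsectP => x; apply: point_inj; rewrite !point_sect_act.
have [_ aM _] := act_algebraic E; rewrite /total_act aM -/(total_act _ _).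
by rewrite invgM actionM.
Qed.

Lemma sect_actX t n s : sect_act (t ^+ n)%g s = iter n (sect_act t) s.
Proof.
elim: n => [|n IHn] /=; first by rewrite expg0 sect_act1.
by rewrite expgS sect_actM IHn.
Qed.

Lemma sect_act_fmul t f s x :
  sect_act t (fmul f s) x = f (a t^-1%g x) *: sect_act t s x.
Proof. by rewrite /sect_act /fmul linearZ castvZ. Qed.

Lemma total_act_morphism t : morphism (total_act t : total E -> total E).
Proof.
move=> e; have [_ _ ma] := act_algebraic E.
have mp : morphism_at (fun e' => (t, e') : zprod (T : swfType k) (total E)) e.
  by apply: morphism_at_pair; [exact: morphism_at_cst | exact: morphism_at_id].
exact: morphism_at_comp mp (ma _).
Qed.

Lemma sreg_sect_act t s x : sreg s (a t^-1%g x) -> sreg (sect_act t s) x.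
Proof.
move=> sx; rewrite /sreg; under eq_fun do rewrite point_sect_act.
have m1 := morphism_at_comp (action_morphism a t^-1%g x) sx.
exact: morphism_at_comp m1 (total_act_morphism t _).
Qed.

End ActionOnSections.

(** * Eigensections of the torsion points *)

Section Eigensections.
Context (k : numClosedFieldType) (X : swfType k) (A B : k -> X).
Hypothesis hP : is_P1 A B.
Local Notation oo := (B 0).
Local Notation gen := (generically A).
Local Notation th := (theta A B).
Context (T : algGroupType k) (hT : is_torus T) (a : algAction T X) (E : eqvBundle a).
Hypothesis a_oo : forall t, a t oo = oo.
Local Notation twisted := (twisted A B (@sreg k X E)).
Local Notation iota := (linform A B oo).
Implicit Types (s : bsect E) (t : T).

Let hR := sreg_regularity E.

Lemma iota_neq y : y <> oo -> iota y = 1.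
Proof. by move=> yoo; rewrite /linform eqxx; case: eqP. Qed.

Lemma action_neq_oo t y : y <> oo -> a t y <> oo.
Proof.
by move=> yoo; rewrite -(a_oo t) => /(can_inj (actionK a t)).
Qed.

Lemma twisted_eq d s s' : twisted d s -> twisted d s' ->
  (forall x, x <> oo -> s x = s' x) -> s = s'.
Proof.
move=> [sA soo] [sA' soo'] ss'; apply: dsectP => x.
have [->|/eqP] := eqVneq x oo; last exact: ss'.
have := sreg_removable hP soo soo'; rewrite /fmul theta_oo !scale1r; apply.
by apply: genericallyS (generically_finite hP) => y /ss' ->.
Qed.

Lemma near_oo_gen (P : X -> Prop) : gen P -> \forall y \near oo, y <> oo -> P y.
Proof.
by move/(generic_near hP oo); apply: filterS => y [->|].
Qed.

Lemma theta_nat (n : nat) y : y <> oo -> th n%:Z y = uniformizer A B oo y ^+ n.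
Proof.
by move=> yoo; rewrite /theta /uniformizer eqxx; case: eqP => // _; rewrite exprVn exprnN.
Qed.

(** As t fixes infinity, it changes the uniformizer there by a regular factor, and so rescales the
    frame of O(d) regularly. The equality is asked off infinity only, where [theta] is not given by
    convention. *)
Lemma theta_ratio t d : exists kappa, regular_at kappa oo /\
  \forall y \near oo, y <> oo -> th d y = kappa y * th d (a t y).
Proof.
have quot (t' : T) : exists g, regular_at g oo /\ \forall y \near oo, y <> oo ->
    uniformizer A B oo (a t' y) = uniformizer A B oo y * g y.
  have [cf rf] := action_morphism a t' oo.
  have [||g [gr gE]] := divide_uniformizer hP (x := oo)
      (f := fun y => uniformizer A B oo (a t' y)).
  - by apply: rf; rewrite a_oo; exact: regular_uniformizer.
  - by rewrite a_oo uniformizer0.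
  - by exists g; split=> //; exact: near_oo_gen.
have [g [gr gE]] := quot t; have [h [hr hE]] := quot t^-1%g.
have [cf rf] := action_morphism a t oo.
have hr' : regular_at (fun y => h (a t y)) oo by apply: rf; rewrite a_oo.
have hE' : \forall y \near oo, y <> oo -> uniformizer A B oo y =
    uniformizer A B oo (a t y) * h (a t y).
  have hE2 : nbhs (a t oo) [set z | z <> oo -> uniformizer A B oo (a t^-1%g z) =
      uniformizer A B oo z * h z] by rewrite a_oo.
  have : nbhs oo (a t @^-1` _) := cf _ hE2.
  by apply: filterS => y hy yoo; rewrite -hy ?actionK//; exact: action_neq_oo.
have [n dE] : exists n : nat, d = n%:Z \/ d = - n%:Z.
  by case: d => n; [exists n; left|exists n.+1; right; rewrite NegzE].
(* The factor of t^-1 serves for d nonnegative and that of t otherwise, so neither has to be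
   inverted as a regular function. *)
case: dE => ->.
  exists (fun y => h (a t y) ^+ n); split; first exact: regular_atX.
  apply: filterS hE' => y hy yoo; rewrite !theta_nat//; last exact: action_neq_oo.
  by rewrite hy// exprMn mulrC.
have nz : \forall y \near oo, y <> oo -> uniformizer A B oo (a t y) != 0.
  have noo : nbhs (a t oo) [set z | z = oo \/ (zcoord A z != 0 /\ z <> oo)].
    by rewrite a_oo; exact: near_oo.
  have : nbhs oo (a t @^-1` _) := cf _ noo.
  apply: filterS => y + /(@action_neq_oo t) tyoo => -[//|[z0 _]].
  by rewrite /uniformizer eqxx invr_eq0.
exists (fun y => g y ^+ n); split; first exact: regular_atX.
near=> y => yoo; have taoo := @action_neq_oo t y yoo.
have tN z : z <> oo -> th (- n%:Z) z = (th n%:Z z)^-1.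
  by move=> zoo; rewrite /theta; case: eqP => // _; rewrite opprK -exprnN invrK.
rewrite !tN// !theta_nat//.
have gy : uniformizer A B oo (a t y) = uniformizer A B oo y * g y.
  by move: yoo; near: y.
have : uniformizer A B oo (a t y) != 0 by move: yoo; near: y.
rewrite gy mulf_eq0 negb_or => /andP[u0 g0].
by rewrite exprMn; field; rewrite !expf_neq0.
Unshelve. all: by end_near. Qed.

(** The elements of H_d with their value at infinity replaced by 0. The action on sections ignores
    the frame of O(d), so it gets this value wrong on H_d; once the value is erased, the space is
    stable. *)
Definition W d s : Prop := exists2 s', twisted d s' & s = fmul iota s'.

Lemma W_sect_act t d s : W d s -> W d (sect_act t s).
Proof.
move=> [s' [sA soo] ->]; have [kappa [kr kE]] := theta_ratio t^-1%g d.
pose s'' := fmul (th d) s'.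
have roo : sreg (sect_act t s'') oo by apply: sreg_sect_act; rewrite a_oo.
(* The translate of an element of H_d, with the value at infinity that makes it an element of H_d
   again: [theta d * r] is [kappa] times the translate of [theta d * s']. *)
pose r : bsect E := fun y =>
  if y == oo then kappa y *: sect_act t s'' y else sect_act t s' y.
have rE y : y <> oo -> r y = sect_act t s' y by rewrite /r; case: eqP.
exists r; last first.
  apply: dsectP => y; rewrite sect_act_fmul /fmul.
  have [->|/eqP yoo] := eqVneq y oo; first by rewrite a_oo linform0 !scale0r.
  by rewrite rE// !iota_neq//; exact: action_neq_oo.
split=> [u|].
  apply: (reg_near hR (s := sect_act t s')).
    by apply: filterS (near_A hP u) => y /rE.
  apply: sreg_sect_act.
  have [[v ->]|] := P1_cover hP (a t^-1%g (A u)); first exact: sA.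
  by move/eqP; rewrite -(inj_eq (can_inj (actionK a t))) actionKV a_oo => /eqP/(P1_infty hP).
apply: (reg_near hR) (regM hR kr roo); apply: filterS kE => y ky.
have [->|/eqP yoo] := eqVneq y oo.
  by rewrite /fmul /r eqxx theta_oo scale1r.
by rewrite /fmul rE// sect_act_fmul ky// scalerA.
Qed.

(* e is an eigensection of the torsion points of T, up to its value at infinity,
   which depends on the choice of a frame of O(d). *)
Definition eigensection (e : bsect E) : Prop := forall t, torsion t ->
  exists c, forall x, x <> oo -> sect_act t e x = c *: e x.

Lemma eigensection_ex d (N : bsect E -> Prop) : lin_subspace N ->
  forall s, twisted d s -> ~ N s -> exists e, [/\ twisted d e, eigensection e & ~ N e].
Proof.
move=> NS s ts ns.
pose op (t : {t : T | torsion t}) : {linear bsect E -> bsect E} := sect_act (sval t).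
have [D [n emb]] := twisted_embedding hP E.
(* Multiplication by the linear form at infinity puts [W d] in degree 1 + d, whence this number of
   sample points. *)
pose M := (absz (D%:Z + (1 + d))%R).+1.
have [|ev evP] := emb (1 + d) M; first by rewrite /M; lia.
have WS : lin_subspace (W d).
  split.
    exists (0 *: s); first exact: (twistedZ hP hR).
    by apply: dsectP => x; rewrite /fmul dsectZE scale0r scaler0.
  move=> c _ _ [u tu ->] [v tv ->]; exists (c *: u + v).
    by apply: (twistedD hR) tv; exact: (twistedZ hP hR).
  apply: dsectP => x; rewrite /fmul !(dsectDE, dsectZE) /fmul scalerDr.
  by rewrite !scalerA mulrC.
have evS : lin_subspace (fun v => exists2 u, W d u & ev u = v).
  have [W0 WD] := WS; split; first by exists 0; rewrite ?linear0.
  by move=> c _ _ [u Wu <-] [v Wv <-]; exists (c *: u + v); [exact: WD|rewrite linearP].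
have [U UE] := subspace_vspace evS.
have Winj u : W d u -> ev u = 0 -> u = 0.
  move=> [u' tu' ->]; apply: evP; apply: (twisted_form hP hR) tu'.
  exact: form_linform.
have opC i j u : op i (op j u) = op j (op i u).
  by rewrite /op /= -!sect_actM (torus_commute hT).
have opO i : exists2 m, (0 < m)%N & forall u, iter m (op i) u = u.
  have [m m0 im] := svalP i; exists m => // u.
  by rewrite -sect_actX im sect_act1.
have Wst : stable op (W d) by move=> i u; exact: W_sect_act.
have [r [rE rW]] := eigenvectors_span opC opO WS Wst Winj UE (ltnSn _)
  (ex_intro2 _ _ s ts erefl : W d (fmul iota s)).
apply: contrapT => nex; apply: ns.
(* If every eigensection of degree [d] were in [N], the decomposition of [s] in [W d] would lift
   term by term to an element of [N] of degree [d]. It equals [s] off infinity, hence everywhere by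
   continuity. *)
have [r' [Nr' tr' r'E]] : exists r', [/\ N r', twisted d r' & fmul iota r' = \sum_(e <- r) e].
  elim: r rW {rE} => [_|e r IHr rW].
    exists (0 *: s); split.
    - by rewrite scale0r; exact: NS.1.
    - exact: (twistedZ hP hR).
    - by rewrite big_nil; apply: dsectP => x; rewrite /fmul dsectZE scale0r scaler0.
  have [|r' [Nr' tr' r'E]] := IHr; first by move=> e' e'r; apply: rW; rewrite inE e'r orbT.
  have [[e' te' eE] eig] := rW e (mem_head _ _).
  have Ne' : N e'.
    apply: contrapT => ne'; apply: nex; exists e'; split=> // t tt.
    have [c cE] := eig (exist _ t tt); exists c => x xoo.
    have := congr1 (fun u : bsect E => u x) cE.
    rewrite eE /op /= sect_act_fmul /fmul dsectZE !iota_neq ?scale1r//.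
    exact: action_neq_oo.
  exists (1 *: e' + r'); split; first exact: NS.2.
    by apply: (twistedD hR) tr'; exact: (twistedZ hP hR).
  rewrite big_cons -r'E eE; apply: dsectP => x.
  by rewrite /fmul !(dsectDE, dsectZE) scale1r scalerDr.
rewrite (twisted_eq ts tr')// => x xoo.
have := congr1 (fun u : bsect E => u x) rE.
by rewrite -r'E /fmul iota_neq// !scale1r.
Qed.

End Eigensections.

(** * Frames *)

Section RegularMatrices.
Context (k : fieldType) (Z : swfType k) (z : Z).

Lemma regular_at_prod (I : Type) (r : seq I) (P : pred I)
    (f : I -> Z -> k) : (forall i, regular_at (f i) z) ->
  regular_at (fun w => \prod_(i <- r | P i) f i w) z.
Proof.
move=> rf; elim: r => [|i r IHr].
  by under eq_fun do rewrite big_nil; exact: regular_at_cst.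
under eq_fun do rewrite big_cons; case: (P i) => //.
exact: regular_atM.
Qed.

Lemma regular_at_det n (M : Z -> 'M[k]_n) :
  (forall i j, regular_at (fun w => M w i j) z) -> regular_at (fun w => \det (M w)) z.
Proof.
move=> rM; apply: regular_at_sum => s.
by apply: regular_atM (regular_at_cst _ _) _; exact: regular_at_prod.
Qed.

Lemma regular_at_invmx n (M : Z -> 'M[k]_n) :
  (forall i j, regular_at (fun w => M w i j) z) -> M z \in unitmx ->
  forall i j, regular_at (fun w => invmx (M w) i j) z.
Proof.
move=> rM; rewrite unitmxE unitfE => det0 i j; have rdet := regular_at_det rM.
have radj : regular_at (fun w => \adj (M w) i j) z.
  under eq_fun do rewrite mxE; apply: regular_atM (regular_at_cst _ _) _.
  apply: regular_at_det => i' j'; under eq_fun do rewrite !mxE.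
  exact: rM.
apply: near_eq_regular_at (regular_atM (regular_atV rdet det0) radj).
apply: filterS (regular_at_neq0 rdet det0) => w dw.
by rewrite /invmx unitmxE unitfE dw [RHS]mxE.
Qed.

End RegularMatrices.

Section BundleMaps.
Context (k : fieldType) (X : swfType k) (E : vectorBundle X).

Lemma proj_morphism : morphism (@proj k X E).
Proof.
move=> e; have [U [n [phi [psi [oU triv]]]]] := bundle_locally_trivial E (proj e).
have Ue := nbhs_singleton (open_nbhs_nbhs oU).
by have [] := @trivialization_fst _ _ _ _ _ _ _ e triv Ue.
Qed.

Lemma regular_at_comp (Z Y : swfType k) (f : Z -> Y) (g : Y -> k) z :
  morphism_at f z -> regular_at g (f z) -> regular_at (fun w => g (f w)) z.
Proof. by move=> [_ rf] /rf. Qed.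

Section Families.
Context (U : set X) (n : nat) (phi : forall x, {linear fiber E x -> 'rV[k]_n})
  (psi : forall x, {linear 'rV[k]_n -> fiber E x}).
Hypothesis triv : trivialization U phi psi.
Context (Z : swfType k) (p : Z -> X) (z : Z).

Lemma family_coord (F : forall w, fiber E (p w)) i : U (p z) ->
  morphism_at (fun w => point (F w) : total E) z ->
  regular_at (fun w => phi (p w) (F w) 0 i) z.
Proof.
move=> Uz mF; have [_ m2] := @trivialization_fst _ _ _ _ _ _ _ (point (F z)) triv Uz.
exact: morphism_at_coord (morphism_at_comp mF m2) i.
Qed.

Lemma family_psi (f : Z -> 'rV[k]_n) : U (p z) -> morphism_at p z ->
  (forall i, regular_at (fun w => f w 0 i) z) ->
  morphism_at (fun w => point (psi (p w) (f w)) : total E) z.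
Proof.
move=> Uz mp rf; have [_ _ mpsi] := triv.
have mf : morphism_at (fun w => (p w, f w) : zprod X (affine k n)) z.
  by apply: morphism_at_pair => //; exact: morphism_at_to_affine.
exact: morphism_at_comp mf (mpsi (p z, f z) Uz).
Qed.

End Families.

Lemma family_add (Z : swfType k) (p : Z -> X) (F G : forall w, fiber E (p w)) z :
  morphism_at (fun w => point (F w) : total E) z ->
  morphism_at (fun w => point (G w) : total E) z ->
  morphism_at (fun w => point (F w + G w) : total E) z.
Proof.
move=> mF mG.
have [U [n [phi [psi [oU triv]]]]] := bundle_locally_trivial E (p z).
have nU := open_nbhs_nbhs oU; have Uz := nbhs_singleton nU.
have mp : morphism_at p z := morphism_at_comp mF (proj_morphism _).
have rF i := family_coord triv i Uz mF; have rG i := family_coord triv i Uz mG.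
have rFG i : regular_at (fun w => (phi (p w) (F w) + phi (p w) (G w)) 0 i) z.
  by under eq_fun do rewrite mxE; exact: regular_atD.
apply: near_eq_morphism_at (family_psi triv Uz mp rFG).
have [cp _] := mp; have : nbhs z (p @^-1` U) := cp _ nU.
by apply: filterS => w Uw; rewrite -linearD (trivKl triv).
Qed.

Lemma sreg_near (s : bsect E) x : sreg s x -> \forall y \near x, sreg s y.
Proof.
move=> sx; have [U [n [phi [psi [[oU Ux] triv]]]]] := bundle_locally_trivial E x.
have nU : nbhs x U by exact: open_nbhs_nbhs.
have : \forall y \near x, forall i, regular_at (fun y => phi y (s y) 0 i) y.
  apply: filter_forall => i; exact: regular_at_near (sreg_coord triv i Ux sx).
apply: filterS2 nU => y Uy ry; apply: (sreg_from_coord triv) => //.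
exact: open_nbhs_nbhs.
Qed.

Lemma trivialization_dim (U : set X) n (phi : forall x, {linear fiber E x -> 'rV[k]_n})
    (psi : forall x, {linear 'rV[k]_n -> fiber E x}) x :
  trivialization U phi psi -> U x -> \dim {:fiber E x} = n.
Proof.
move=> triv Ux; pose f : 'Hom(fiber E x, 'rV[k]_n) := linfun (phi x).
have fE v : f v = phi x v by rewrite lfunE.
have <- : \dim (f @: {:fiber E x}) = \dim {:fiber E x}.
  apply: limg_dim_eq; apply/eqP; rewrite -subv0; apply/subvP => v.
  rewrite memv_cap memv_ker memv0 fE => /andP[_ /eqP v0].
  by rewrite -(trivKl triv v Ux) v0 linear0.
have -> : (f @: {:fiber E x})%VS = {: 'rV[k]_n}%VS.
  apply/eqP; rewrite eqEsubv subvf; apply/subvP => w _.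
  by rewrite -(trivKr triv w Ux) -fE memv_img// memvf.
by rewrite dimvf /dim /= mul1n.
Qed.

End BundleMaps.

Section Frames.
Context (k : fieldType) (X : swfType k) (E : vectorBundle X).
Context (n : nat) (e : 'I_n -> bsect E).
Hypothesis basis_e : forall x, basis_of {:fiber E x} [tuple e i x | i < n].
Hypothesis local_e : forall x : X, exists c : 'I_n -> X -> k,
  \forall y \near x, forall i, c i y != 0 /\ sreg (fmul (c i) (e i)) y.

Definition fcoord (x : X) (i : 'I_n) (v : fiber E x) : k :=
  coord [tuple e i x | i < n] i v.

Lemma fcoord_linear x i c (u v : fiber E x) :
  fcoord i (c *: u + v) = c * fcoord i u + fcoord i v.
Proof. by rewrite /fcoord linearP. Qed.

Lemma fcoordK x (v : fiber E x) : \sum_i fcoord i v *: e i x = v.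
Proof.
rewrite [in RHS](coord_basis (basis_e x) (memvf v)); apply: eq_bigr => i _.
by rewrite -tnth_nth tnth_mktuple.
Qed.

Lemma fcoord_e x i j : fcoord i (e j x) = (i == j)%:R.
Proof.
have := coord_free j i (basis_free (basis_e x)).
by rewrite -tnth_nth tnth_mktuple eq_sym.
Qed.

Lemma fcoord_sum x i (w : 'I_n -> k) : fcoord i (\sum_j w j *: e j x) = w i.
Proof.
rewrite /fcoord linear_sum /= (bigD1 i)//= linearZ /= -/(fcoord i (e i x)).
rewrite fcoord_e eqxx mulr1 big1 ?addr0// => j ji.
by rewrite linearZ /= -/(fcoord i (e j x)) fcoord_e eq_sym (negbTE ji) mulr0.
Qed.

(** The permutation allows any chosen vector of the frame to come first, and the separate index [m]
    allows the form 1 + (n - 1), as in the definition of a line subbundle. *)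
Lemma frame_trivialization x0 m (sg : 'I_m -> 'I_n) : bijective sg ->
  exists (U : set X) (phi : forall y, {linear fiber E y -> 'rV[k]_m})
    (psi : forall y, {linear 'rV[k]_m -> fiber E y}) (c : 'I_m -> X -> k),
  [/\ open_nbhs x0 U, trivialization U phi psi,
    forall y l, U y -> c l y != 0,
    forall y v l, phi y v 0 l = fcoord (sg l) v / c l y &
    forall y w, psi y w = \sum_l w 0 l *: (c l y *: e (sg l) y)].
Proof.
move=> bsg; have [c /nbhs_interior] := local_e x0.
rewrite /= nbhsE => -[U oU Uc].
have {}Uc y : U y -> forall i, c i y != 0 /\ sreg (fmul (c i) (e i)) y.
  by move=> /Uc/nbhs_singleton.
have phil y : linear (fun v : fiber E y => \row_l (fcoord (sg l) v / c (sg l) y)).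
  move=> b u v; apply/rowP => l.
  by rewrite !mxE fcoord_linear mulrDl mulrA.
have psil y : linear (fun w : 'rV[k]_m => \sum_l w 0 l *: (c (sg l) y *: e (sg l) y)).
  move=> b u v; rewrite scaler_sumr -big_split /=; apply: eq_bigr => l _.
  by rewrite !mxE scalerDl -scalerA.
exists U, (fun y => mk_linear (phil y)), (fun y => mk_linear (psil y)).
exists (fun l => c (sg l)); split=> //; last 2 first.
- by move=> y l /Uc/(_ (sg l))[].
- by move=> y v l; rewrite /= mxE.
have cK y : U y -> forall v, \sum_l (\row_l (fcoord (sg l) v / c (sg l) y)) 0 l *:
    (c (sg l) y *: e (sg l) y) = v.
  move=> /Uc cU v; rewrite -[RHS]fcoordK (reindex sg)/=; last exact: onW_bij.
  apply: eq_bigr => l _; rewrite mxE scalerA divfK//.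
  by have [] := cU (sg l).
have [tau sgK tauK] := bsg.
have cK' y : U y -> forall w : 'rV[k]_m, \row_l (fcoord (sg l)
    (\sum_l' w 0 l' *: (c (sg l') y *: e (sg l') y)) / c (sg l) y) = w.
  move=> /Uc cU w; apply/rowP => l; rewrite mxE.
  rewrite (reindex tau)/=; last by exists sg => ? _; [exact: tauK | exact: sgK].
  under eq_bigr => i _ do rewrite tauK scalerA.
  rewrite fcoord_sum sgK mulfK//.
  by have [] := cU (sg l).
have nm : n = m.
  by rewrite -[LHS]card_ord -[RHS]card_ord; apply/esym/(bij_eq_card bsg).
split=> [y Uy|e0 Ue0|q Uq] /=.
- by split=> [v|w] /=; [exact: cK | exact: cK'].
- have [U0 [n0 [phi0 [psi0 [oU0 triv0]]]]] := bundle_locally_trivial E (proj e0).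
  have nU0 := open_nbhs_nbhs oU0; have U0y := nbhs_singleton nU0.
  have n0m : n0 = m.
    by rewrite -(trivialization_dim triv0 U0y) (size_basis (basis_e _)).
  subst n0.
  (* The rescaled frame written in a known trivialization. The coordinates in the frame are those of
     [phi0] times the inverse of this matrix, regular by Cramer's formula. *)
  pose M y : 'M[k]_m := \matrix_l phi0 y (fmul (c (sg l)) (e (sg l)) y).
  have mulM y w : w *m M y = phi0 y (\sum_l w 0 l *: (c (sg l) y *: e (sg l) y)).
    rewrite mulmx_sum_row linear_sum; apply: eq_bigr => l _.
    by rewrite linearZ rowK.
  have unitM y : U y -> U0 y -> M y \in unitmx.
    move=> Uy Uy0; rewrite -row_free_unit; apply: inj_row_free => w.
    rewrite mulM => /(congr1 (psi0 y)); rewrite (trivKl triv0)// linear0 => w0.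
    by rewrite -[w](cK' y Uy) w0; apply/rowP => l; rewrite !mxE /fcoord linear0 mul0r.
  have mp := @proj_morphism _ _ E e0.
  apply: morphism_at_pair => //; apply: morphism_at_to_affine => l.
  have rM i j : regular_at (fun e' : total E => M (proj e') i j) e0.
    under eq_fun do rewrite mxE.
    exact: (@regular_at_comp _ _ _ (@proj k X E) _ _ mp (sreg_coord triv0 j U0y (Uc _ Ue0 _).2)).
  have rV j : regular_at (fun e' : total E => phi0 (proj e') (vec e') 0 j) e0.
    have [_ m2] := trivialization_fst triv0 U0y.
    exact: morphism_at_coord m2 j.
  have rI i j := regular_at_invmx rM (unitM _ Ue0 U0y) i j.
  have rs : regular_at (fun e' : total E =>
      \sum_j phi0 (proj e') (vec e') 0 j * invmx (M (proj e')) j l) e0.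
    by apply: regular_at_sum => j; exact: regular_atM.
  apply: near_eq_regular_at rs.
  have : nbhs e0 (@proj k X E @^-1` (U `&` U0)).
    by apply: (mp.1 _); apply: filterI => //; exact: open_nbhs_nbhs (conj oU.1 Ue0).
  apply: filterS => e' [Ue' U0e'].
  pose r := \row_l (fcoord (sg l) (vec e') / c (sg l) (proj e')).
  have rE : phi0 (proj e') (vec e') = r *m M (proj e') by rewrite mulM cK.
  transitivity ((r *m M (proj e') *m invmx (M (proj e'))) 0 l).
    by rewrite [RHS]mxE; apply: eq_bigr => j _; rewrite rE.
  by rewrite mulmxK ?unitM.
- have [U0 [n0 [phi0 [psi0 [oU0 triv0]]]]] := bundle_locally_trivial E q.1.
  have nU0 := open_nbhs_nbhs oU0; have U0y := nbhs_singleton nU0.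
  pose f (r : zprod X (affine k m)) : 'rV[k]_n0 :=
    \sum_l r.2 0 l *: phi0 r.1 (fmul (c (sg l)) (e (sg l)) r.1).
  have rf i : regular_at (fun r => f r 0 i) q.
    rewrite /f; under eq_fun do rewrite summxE.
    apply: regular_at_sum => l; under eq_fun do rewrite mxE.
    apply: regular_atM; first exact: morphism_at_coord (morphism_at_snd q) l.
    exact: (@regular_at_comp _ _ _ (fun r : zprod X (affine k m) => r.1) _ q
      (morphism_at_fst q) (sreg_coord triv0 i U0y (Uc _ Uq _).2)).
  apply: near_eq_morphism_at (family_psi triv0 U0y (morphism_at_fst q) rf).
  have : nbhs q (fst @^-1` U0) := (morphism_at_fst q).1 _ nU0.
  apply: filterS => r U0r; congr point; rewrite linear_sum; apply: eq_bigr => l _.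
  by rewrite linearZ /= (trivKl triv0).
Qed.

End Frames.

(** * Invariant lines and the splitting *)

Section Lines.
Context (k : fieldType) (X : swfType k) (E : vectorBundle X).
Context (n : nat) (e : 'I_n -> bsect E).
Hypothesis basis_e : forall x, basis_of {:fiber E x} [tuple e i x | i < n].
Hypothesis local_e : forall x : X, exists c : 'I_n -> X -> k,
  \forall y \near x, forall i, c i y != 0 /\ sreg (fmul (c i) (e i)) y.
Local Notation fc := (@fcoord k X E n e _).

Definition fline (i : 'I_n) (x : X) : {vspace fiber E x} := <[e i x]>%VS.

Lemma flineP i x (v : fiber E x) :
  v \in fline i x <-> forall j, j != i -> fc j v = 0.
Proof.
split=> [/vlineP[c ->] j ji|v0].
  rewrite -[c *: _]addr0 fcoord_linear fcoord_e// (negbTE ji) mulr0 add0r.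
  by rewrite /fcoord linear0.
rewrite -(fcoordK basis_e v) (bigD1 i)//= big1 ?addr0 ?memvZ ?memv_line// => j ji.
by rewrite v0// scale0r.
Qed.

Lemma fline_subbundle i : is_subbundle 1 (fline i).
Proof.
move=> x0; have n1 : (1 + n.-1)%N = n by rewrite add1n prednK// (leq_ltn_trans _ (ltn_ord i)).
pose i0 := cast_ord n1 (lshift n.-1 ord0).
pose sg (l : 'I_(1 + n.-1)) := tperm i0 i (cast_ord n1 l).
have bsg : bijective sg.
  exists (fun j => cast_ord (esym n1) (tperm i0 i j)) => l; rewrite /sg ?tpermK ?cast_ordK//.
  by rewrite cast_ordKV tpermK.
have sg0 : sg (lshift n.-1 ord0) = i by rewrite /sg tpermL.
have [U [phi [psi [c [oU triv c0 phiE _]]]]] := frame_trivialization basis_e local_e x0 bsg.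
exists U, n.-1, phi, psi; split=> // y Uy v; split=> [/flineP v0|rv].
  apply/rowP => j; rewrite !mxE phiE v0 ?mul0r//.
  by rewrite -sg0 (inj_eq (bij_inj bsg)) eq_rlshift.
apply/flineP => j ji; have [tau sgK tauK] := bsg.
rewrite -(tauK j) in ji *; case: (splitP (tau j)) ji => l lE ji.
  case/negP: ji; apply/eqP; rewrite -[RHS]sg0; congr sg; apply/val_inj.
  by rewrite /= lE ord1.
have : phi y v 0 (rshift 1 l) = 0.
  by have := congr1 (fun w : 'rV_n.-1 => w 0 l) rv; rewrite !mxE.
have -> : tau j = rshift 1 l by apply/val_inj.
rewrite phiE => /eqP; rewrite mulf_eq0 invr_eq0 (negbTE (c0 _ _ Uy)) orbF => /eqP.
exact.
Qed.

Lemma fproj_linear i x : linear (fun v : fiber E x => fc i v *: e i x).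
Proof. by move=> c u v; rewrite fcoord_linear scalerDl scalerA. Qed.

Definition fproj i x : {linear fiber E x -> fiber E x} := mk_linear (@fproj_linear i x).

Lemma fproj_line i x v : fproj i x v \in fline i x.
Proof. by rewrite memvZ// memv_line. Qed.

Lemma fproj_id i x v : v \in fline i x -> fproj i x v = v.
Proof.
move=> /vlineP[c ->]; rewrite linearZ /=; congr (_ *: _).
by rewrite fcoord_e// eqxx scale1r.
Qed.

Lemma fproj_eq0 i j x v : j != i -> v \in fline i x -> fproj j x v = 0.
Proof. by move=> ji /flineP/(_ j ji) v0; rewrite /= v0 scale0r. Qed.

Lemma fproj_sum x v : \sum_i fproj i x v = v.
Proof. exact: fcoordK. Qed.

Lemma fproj_morphism i : morphism (total_map (fproj i)).
Proof.
move=> e0; have bid : bijective (@id 'I_n) by exists id.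
have [U [phi [psi [c [oU triv c0 phiE psiE]]]]] :=
  frame_trivialization basis_e local_e (proj e0) bid.
have nU := open_nbhs_nbhs oU; have Ue := nbhs_singleton nU.
have mp := @proj_morphism _ _ E e0.
pose f (e' : total E) : 'rV[k]_n := \row_l (phi (proj e') (vec e') 0 i * (l == i)%:R).
have rf l : regular_at (fun e' => f e' 0 l) e0.
  under eq_fun do rewrite mxE; apply: regular_atM (regular_at_cst _ _).
  have [_ m2] := trivialization_fst triv Ue.
  exact: morphism_at_coord m2 i.
apply: near_eq_morphism_at (family_psi triv Ue mp rf).
have : nbhs e0 (@proj k X E @^-1` U) := mp.1 _ nU.
apply: filterS => e' Ue'; rewrite /total_map; congr point.
rewrite psiE (bigD1 i)//= big1 ?addr0 => [|l li]; rewrite mxE.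
  by rewrite eqxx mulr1 phiE scalerA divfK// c0.
by rewrite (negbTE li) mulr0 scale0r.
Qed.

End Lines.

(** A subbundle is closed, being cut out locally by the last coordinates. The parameter space [Z] is
    X itself when approaching the point at infinity, and T when approximating by torsion points. *)
Lemma line_closed (k : fieldType) (X : swfType k) (E : vectorBundle X) d
    (L : forall x, {vspace fiber E x}) (hL : is_subbundle d L)
    (Z : swfType k) (p : Z -> X) (F : forall w, fiber E (p w)) (z : Z) :
  morphism_at (fun w => point (F w) : total E) z -> ~ F z \in L (p z) ->
  \forall w \near z, ~ F w \in L (p w).
Proof.
move=> mF nL; have [U [m [phi [psi [oU triv inL]]]]] := hL (p z).
have nU := open_nbhs_nbhs oU; have Uz := nbhs_singleton nU.
have mp : morphism_at p z := morphism_at_comp mF (@proj_morphism _ _ E _).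
have [i phi0] : exists i, phi (p z) (F z) 0 (rshift d i) != 0.
  apply: contrapT => /forallNP nphi; apply: nL; apply/(inL _ Uz)/rowP => i.
  by rewrite !mxE; have /negP := nphi i; rewrite negbK => /eqP.
have rF := family_coord triv (rshift d i) Uz mF.
have nUz : nbhs z (p @^-1` U) := mp.1 _ nU.
apply: filterS2 nUz (regular_at_neq0 rF phi0) => w Uw phiw /(inL _ Uw) rw.
have := congr1 (fun w : 'rV_m => w 0 i) rw; rewrite !mxE => r0.
by rewrite r0 eqxx in phiw.
Qed.

(** * The sum map of a family of lines and its inverse built from projections *)

Section DirectSumIso.
Context (k : fieldType) (T : algGroupType k) (X : swfType k) (a : algAction T X).
Context (E : eqvBundle a).

Lemma family_zero (Z : swfType k) (p : Z -> X) z : morphism_at p z ->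
  morphism_at (fun w => point (0 : fiber E (p w)) : total E) z.
Proof.
move=> mp; have [U [n [phi [psi [oU triv]]]]] := bundle_locally_trivial E (p z).
have nU := open_nbhs_nbhs oU; have Uz := nbhs_singleton nU.
have rf (i : 'I_n) : regular_at (fun w : Z => (0 : 'rV[k]_n) 0 i) z.
  exact: regular_at_cst.
apply: near_eq_morphism_at (family_psi triv Uz mp rf).
by apply: nearW => w; rewrite linear0.
Qed.

Lemma sum_map_morphism (Ls : seq (eqvLineSubbundle E)) :
  morphism (total_map (sum_map Ls)).
Proof.
elim: Ls => [|L Ls IH] e0.
  exact: family_zero (@proj_morphism _ _ (eqv_zero (a := a)) e0).
have mi := @morphism_at_induced _ _ _ (@sum_inj k X (eqv_sub L) (direct_sum Ls)) e0.
have m1 := morphism_at_comp mi (morphism_at_fst _).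
have m2 := morphism_at_comp mi (morphism_at_snd _).
have m1' := morphism_at_comp m1 (@morphism_at_induced _ _ _ (@sub_inj k X E L) _).
have m2' := morphism_at_comp m2 (IH _).
exact: (family_add (p := @proj k X (direct_sum (L :: Ls))) m1' m2').
Qed.

Lemma sum_map_eqv (Ls : seq (eqvLineSubbundle E)) t x v :
  sum_map Ls (a t x) (act (direct_sum Ls) t x v) = act E t x (sum_map Ls x v).
Proof.
elim: Ls v => [|L Ls IH] v /=; first by rewrite linear0.
by rewrite linearD IH vsprojK//; apply: line_stable; exact: subvsP.
Qed.

Section Splitting.
Context (n : nat) (L : 'I_n -> eqvLineSubbundle E).
Context (pr : forall (i : 'I_n) x, {linear fiber E x -> fiber E x}).
Hypothesis pr_line : forall i x v, pr i x v \in L i x.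
Hypothesis pr_id : forall i x v, v \in L i x -> pr i x v = v.
Hypothesis pr_eq0 : forall i j x v, j != i -> v \in L i x -> pr j x v = 0.
Hypothesis pr_sum : forall x v, \sum_i pr i x v = v.
Hypothesis pr_morphism : forall i, morphism (total_map (pr i)).

Lemma split_map0_linear x : linear (fun _ : fiber E x => 0 : fiber (eqv_zero (a := a)) x).
Proof. by move=> c u v; rewrite scaler0 addr0. Qed.

Lemma split_mapS_linear i (F : eqvBundle a) x (f : {linear fiber E x -> fiber F x}) :
  linear (fun v => (vsproj (L i x) (pr i x v), f v) : fiber (eqv_sum (eqv_sub (L i)) F) x).
Proof. by move=> c u v; rewrite !linearP. Qed.

Fixpoint split_map (js : seq 'I_n) (x : X) :
    {linear fiber E x -> fiber (direct_sum (map L js)) x} :=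
  if js is j :: js' then mk_linear (@split_mapS_linear j _ x (split_map js' x))
  else mk_linear (@split_map0_linear x).

Lemma split_mapK js x v : sum_map (map L js) x (split_map js x v) = \sum_(j <- js) pr j x v.
Proof.
elim: js => [|j js IH] /=; first by rewrite big_nil.
by rewrite big_cons IH vsprojK//; exact: pr_line.
Qed.

Lemma pr_sum_map js x v j : j \notin js -> pr j x (sum_map (map L js) x v) = 0.
Proof.
elim: js v => [|i js IH] v /=; first by rewrite linear0.
rewrite inE negb_or => /andP[ji jjs]; rewrite linearD IH// addr0.
by apply: pr_eq0 ji _; exact: subvsP.
Qed.

Lemma split_map_line js x v i : i \notin js -> v \in L i x -> split_map js x v = 0.
Proof.
move=> + vL; elim: js => [|j js IH] //=; rewrite inE negb_or => /andP[ij ijs].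
by rewrite IH// (pr_eq0 _ vL) 1?eq_sym// linear0.
Qed.

Lemma sum_mapK js x v : uniq js -> split_map js x (sum_map (map L js) x v) = v.
Proof.
elim: js v => [|j js IH] v /=; first by move=> _; rewrite [v]thinmx0.
move=> /andP[jjs ujs]; rewrite !linearD /= pr_sum_map// linear0 addr0 IH//.
rewrite pr_id; last exact: subvsP.
rewrite (split_map_line jjs (subvsP _)) add0r vsvalK.
by case: v.
Qed.

Lemma split_map_morphism js : morphism (total_map (split_map js)).
Proof.
elim: js => [|j js IH] e0; apply: morphism_at_to_induced.
  exact: (@proj_morphism _ _ E e0).
apply: morphism_at_pair; last exact: IH.
apply: morphism_at_to_induced; apply: near_eq_morphism_at (pr_morphism j e0).
by apply: nearW => e1; rewrite /sub_inj /= vsprojK//; exact: pr_line.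
Qed.

Lemma split_iso : eqv_bundle_iso (sum_map (map L (enum 'I_n))).
Proof.
split; last exact: sum_map_eqv.
exists (split_map (enum 'I_n)); split.
- by move=> x v; rewrite sum_mapK// enum_uniq.
- by move=> x v; rewrite split_mapK big_enum pr_sum.
- exact: sum_map_morphism.
- exact: split_map_morphism.
Qed.

End Splitting.

End DirectSumIso.

(** * Invariance of the lines and the splitting for a fixed point at infinity *)

Section EquivariantSplitting.
Context (k : numClosedFieldType) (X : swfType k) (A B : k -> X).
Hypothesis hP : is_P1 A B.
Local Notation oo := (B 0).
Context (T : algGroupType k) (hT : is_torus T) (a : algAction T X) (E : eqvBundle a).
Hypothesis a_oo : forall t, a t oo = oo.

Lemma local_twisted_frame n (e : 'I_n -> bsect E) (d : 'I_n -> int) :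
  (forall i, twisted A B (@sreg k X E) (d i) (e i)) ->
  forall x : X, exists c : 'I_n -> X -> k,
    \forall y \near x, forall i, c i y != 0 /\ sreg (fmul (c i) (e i)) y.
Proof.
move=> te x; have hR := sreg_regularity E.
have [[u ->]|->] := P1_cover hP x.
  exists (fun _ _ => 1); apply: filter_forall => i; have [eA _] := te i.
  apply: filterS (near_A hP u) => y yoo; rewrite oner_neq0; split=> //.
  have [[v ->]|//] := P1_cover hP y.
  apply: (reg_near hR) (eA v).
  by apply: nearW => z; rewrite /fmul scale1r.
exists (fun i => theta A B (d i)); apply: filter_forall => i; have [_ eoo] := te i.
by apply: filterS2 (theta_neq0_near hP (d i)) (sreg_near eoo).
Qed.

(* Torsion points of T preserve the lines off infinity, hence everywhere by
   continuity, and they are dense in T. *)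
Lemma eigenline_stable n (e : 'I_n -> bsect E) (d : 'I_n -> int)
    (basis_e : forall x, basis_of {:fiber E x} [tuple e i x | i < n])
    (te : forall i, twisted A B (@sreg k X E) (d i) (e i))
    (eig : forall i, eigensection B (e i)) i t x v :
  v \in fline e i x -> act E t x v \in fline e i (a t x).
Proof.
move=> vL; have sub := fline_subbundle basis_e (local_twisted_frame te) i.
have fin s y : torsion s -> y <> oo -> act E s y (e i y) \in fline e i (a s y).
  move=> /(eig i)[c cE] yoo.
  have -> : act E s y (e i y) = c *: e i (a s y).
    by apply: point_inj; rewrite -sect_actE cE//; exact: action_neq_oo.
  by rewrite memvZ// memv_line.
have tors s y : torsion s -> act E s y (e i y) \in fline e i (a s y).
  move=> sT; have [->|/eqP yoo] := eqVneq y oo; last exact: fin.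
  (* A failure at infinity would persist at nearby points, against [fin]. Since [e i] need not be
     regular at infinity, the argument runs on its multiple by [c i], which spans the same line. *)
  apply: contrapT => nL; have [c cnear] := local_twisted_frame te oo.
  have [ci0 ci] := nbhs_singleton cnear i.
  have [] := generically_ex (generically2 (fun z => @conj _ _) (nbhs_generic hP cnear)
    (nbhs_generic hP (line_closed sub (p := a s)
      (F := fun y => act E s y (fmul (c i) (e i) y)) (z := oo) _ _))).
  - exact: morphism_at_comp ci (total_act_morphism s _).
  - apply: contra_not nL; rewrite /fmul linearZ => /(memvZ (c i oo)^-1).
    by rewrite scalerA mulVf// scale1r.
  move=> w [_]; apply; rewrite /fmul linearZ memvZ//.
  by apply: fin => //; exact: P1_infty hP w.
have all_t : act E t x (e i x) \in fline e i (a t x).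
  apply: contrapT => nL.
  have [_ _ ma] := act_algebraic E.
  have mF : morphism_at (fun s => point (act E s x (e i x)) : total E) t.
    have mp : morphism_at (fun s => (s, point (e i x)) : zprod (T : swfType k) (total E)) t.
      by apply: morphism_at_pair; [exact: morphism_at_id | exact: morphism_at_cst].
    exact: morphism_at_comp mp (ma _).
  have [s sT] := torsion_dense hT (line_closed sub (p := fun s => a s x) mF nL).
  by apply; exact: tors.
by move: vL => /vlineP[c ->]; rewrite linearZ memvZ.
Qed.

Theorem equivariant_splitting : exists Ls : seq (eqvLineSubbundle E),
  eqv_bundle_iso (sum_map Ls).
Proof.
have [es [esP esB]] := @admissible_basis _ X A B hP E (eigensection B (E := E))
  (fun d N NS s ts ns => eigensection_ex hP hT a_oo NS ts ns).
pose n := size es.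
pose e (i : 'I_n) : bsect E := (nth (0, 0) es i).1.
pose d (i : 'I_n) : int := (nth (0, 0) es i).2.
have basis_e x : basis_of {:fiber E x} [tuple e i x | i < n].
  have := esB x; rewrite (_ : values es x = [tuple e i x | i < n])//.
  apply: (@eq_from_nth _ 0); rewrite ?size_tuple ?size_map// => i ni.
  rewrite /values (nth_map ((0, 0) : bsect E * int))//.
  by rewrite (nth_mktuple (fun i => e i x) 0 (Ordinal ni)).
have te i : twisted A B (@sreg k X E) (d i) (e i).
  by have [] := esP _ (mem_nth (0, 0) (ltn_ord i)).
have eig i : eigensection B (e i).
  by have [] := esP _ (mem_nth (0, 0) (ltn_ord i)).
have loc := local_twisted_frame te.
pose L i := EqvLineSubbundle (fline_subbundle basis_e loc i)
  (fun t x v => @eigenline_stable n e d basis_e te eig i t x v).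
exists (map L (enum 'I_n)); apply: (split_iso (pr := fproj e)).
- exact: fproj_line.
- exact: fproj_id.
- exact: fproj_eq0.
- exact: fproj_sum.
- exact: fproj_morphism.
Qed.

End EquivariantSplitting.

Theorem mainTheorem1 (R : realType) (T : algGroupType R[i]) (hT : is_torus T)
    (a : algAction T (projective R[i] 1)) (E : eqvBundle a) :
  exists Ls : seq (eqvLineSubbundle E), eqv_bundle_iso (sum_map Ls).
Proof.
have v0 : (delta_mx 0 0 : 'rV[R[i]]_2) != 0.
  by apply/eqP => /rowP/(_ 0)/eqP; rewrite !mxE /= oner_eq0.
(* These auxiliary charts only serve to find the fixed point; new charts then put it at infinity. *)
have [A0 [B0 [hP0 _]]] := projective_chart_at (proj_line v0).
have [q aq] := torus_fixed_point hP0 hT a.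
have [A [B [hP qE]]] := projective_chart_at q.
by apply: (equivariant_splitting hP hT) => t; rewrite qE.
Qed.
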